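(* Let $\mathrm{SCL}^{\mathrm{rp}} := \{ \mathrm{scl}_G(g) \mid G \text{ a recursively presented group},\ g \in G,\ \mathrm{scl}_G(g)<\infty \} \subset \mathbb{R}^{\geq 0}$ and let $\mathrm{RC}^{\geq 0} := \{ \alpha \in \mathbb{R} \mid \alpha \geq 0,\ \alpha \text{ right-computable} \}$. Then $$\mathrm{SCL}^{\mathrm{rp}} = \mathrm{RC}^{\geq 0}$$ as subsets of $\mathbb{R}^{\geq 0}$. Moreover, every non-negative computable real number and every non-negative algebraic real number lies in $\mathrm{SCL}^{\mathrm{rp}}$. The set $\mathrm{SCL}^{\mathrm{rp}}$ is closed under addition but not under subtraction, i.e.\ there are $\alpha, \beta \in \mathrm{SCL}^{\mathrm{rp}}$ with $\alpha - \beta > 0$ but $\alpha - \beta \notin \mathrm{SCL}^{\mathrm{rp}}$.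
   Context: For a group $G$ with commutator subgroup $G'=[G,G]$ and $g\in G'$, the commutator length $\mathrm{cl}_G(g)$ is the least $n$ such that $g=[x_1,y_1]\cdots[x_n,y_n]$ with $[x,y]=xyx^{-1}y^{-1}$, and the stable commutator length is $\mathrm{scl}_G(g)=\lim_{n\to\infty}\mathrm{cl}_G(g^n)/n$. For general $g\in G$: if $g^N\in G'$ for some $N\geq 1$ set $\mathrm{scl}_G(g)=\mathrm{scl}_G(g^N)/N$, otherwise $\mathrm{scl}_G(g)=\infty$. A presentation $\langle S\mid\mathcal{R}\rangle$ (with $S$ a finite alphabet) is recursive if $\mathcal{R}\subset F(S)$ is recursively enumerable; a group is recursively presented if it admits such a presentation. A real number $\alpha$ is computable if the set $\{q\in\mathbb{Q}\mid \alpha<q\}$ is computable (decidable by a Turing machine), and right-computable if this set is recursively enumerable. *)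

(* Defs.v *)
From Stdlib Require Import Reals Lra Lia ZArith List.
From Coquelicot Require Import Coquelicot.
Import ListNotations.
Open Scope R_scope.

Inductive prf : Type :=
  | PZero : prf
  | PSucc : prf
  | PProj : nat -> prf
  | PComp : prf -> list prf -> prf
  | PPrec : prf -> prf -> prf
  | PMu   : prf -> prf.

Inductive peval : prf -> list nat -> nat -> Prop :=
  | ev_zero : forall v, peval PZero v 0
  | ev_succ : forall x v, peval PSucc (x :: v) (S x)
  | ev_proj : forall i v, peval (PProj i) v (nth i v 0%nat)
  | ev_comp : forall f gs v ys z,
      List.Forall2 (fun g y => peval g v y) gs ys ->
      peval f ys z -> peval (PComp f gs) v z
  | ev_prec0 : forall f g v z,
      peval f v z -> peval (PPrec f g) (0%nat :: v) z
  | ev_precS : forall f g n v y z,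
      peval (PPrec f g) (n :: v) y -> peval g (n :: y :: v) z ->
      peval (PPrec f g) (S n :: v) z
  | ev_mu : forall f v n,
      peval f (n :: v) 0%nat ->
      (forall m, (m < n)%nat -> exists k, peval f (m :: v) (S k)) ->
      peval (PMu f) v n.

Definition RE (A : nat -> Prop) : Prop :=
  exists f : prf, forall n, A n <-> exists y, peval f [n] y.

Definition Decidable (A : nat -> Prop) : Prop :=
  exists f : prf, forall n,
    (A n -> peval f [n] 1%nat) /\ (~ A n -> peval f [n] 0%nat).

Definition npair (a b : nat) : nat := ((a + b) * (a + b + 1) / 2 + b)%nat.

Definition zcode (z : Z) : nat :=
  match z with
  | Z0 => 0%nat
  | Zpos p => (2 * Pos.to_nat p)%nat
  | Zneg p => (2 * Pos.to_nat p - 1)%nat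
  end.

(* code of the fraction z/d (d >= 1); every rational has (many) codes *)
Definition qcode (z : Z) (d : nat) : nat := npair (zcode z) d.

Definition upper_cut (alpha : R) : nat -> Prop :=
  fun c => exists (z : Z) (d : nat), c = qcode z d /\ (0 < d)%nat /\
                              alpha < IZR z / INR d.

Definition computable_real (alpha : R) : Prop := Decidable (upper_cut alpha).
Definition right_computable (alpha : R) : Prop := RE (upper_cut alpha).

Fixpoint zpoly_eval (cs : list Z) (x : R) : R :=
  match cs with
  | [] => 0
  | c :: cs' => IZR c + x * zpoly_eval cs' x
  end.

Definition algebraic_real (alpha : R) : Prop :=
  exists cs : list Z, List.Exists (fun c => c <> 0%Z) cs /\ zpoly_eval cs alpha = 0.

(* a letter (i, b): generator s_i if b = true, its inverse if b = false *)
Definition letter := (nat * bool)%type.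
Definition word := list letter.

Definition flip (x : letter) : letter := (fst x, negb (snd x)).
Definition winv (w : word) : word := rev (map flip w).
Definition wpow (w : word) (n : nat) : word := concat (repeat w n).
Definition comm (x y : word) : word := x ++ y ++ winv x ++ winv y.

Definition over (k : nat) (w : word) : Prop := List.Forall (fun x => (fst x < k)%nat) w.

Inductive eqG (Rl : word -> Prop) : word -> word -> Prop :=
  | eqG_refl : forall w, eqG Rl w w
  | eqG_sym : forall u v, eqG Rl u v -> eqG Rl v u
  | eqG_trans : forall u v w, eqG Rl u v -> eqG Rl v w -> eqG Rl u w
  | eqG_ctx : forall a b u v, eqG Rl u v -> eqG Rl (a ++ u ++ b) (a ++ v ++ b)
  | eqG_free : forall x, eqG Rl [x; flip x] []
  | eqG_rel : forall r, Rl r -> eqG Rl r [].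

Definition lcode (x : letter) : nat := (2 * fst x + (if snd x then 1 else 0))%nat.
Fixpoint wcode (w : word) : nat :=
  match w with
  | [] => 0%nat
  | x :: w' => S (npair (lcode x) (wcode w'))
  end.

Definition recursive_presentation (k : nat) (Rl : word -> Prop) : Prop :=
  (forall r, Rl r -> over k r) /\
  RE (fun c => exists r, Rl r /\ c = wcode r).

Definition cl_le (k : nat) (Rl : word -> Prop) (w : word) (n : nat) : Prop :=
  exists ps : list (word * word),
    length ps = n /\ List.Forall (fun p => over k (fst p) /\ over k (snd p)) ps /\
    eqG Rl w (flat_map (fun p => comm (fst p) (snd p)) ps).

Definition in_commutator (k : nat) (Rl : word -> Prop) (w : word) : Prop :=
  exists n, cl_le k Rl w n.

(* commutator length (a finite natural number for elements of G') *)
Definition cl (k : nat) (Rl : word -> Prop) (w : word) : R :=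
  real (Glb_Rbar (fun x => exists n, x = INR n /\ cl_le k Rl w n)).

(* scl_G(g) = alpha (finite): for some N >= 1, g^N in G' and
   scl(g) = scl(g^N)/N = lim_m cl(g^(N m)) / (N m). *)
Definition scl_is (k : nat) (Rl : word -> Prop) (w : word) (alpha : R) : Prop :=
  exists N : nat, (1 <= N)%nat /\ in_commutator k Rl (wpow w N) /\
    is_lim_seq (fun m => cl k Rl (wpow w (N * S m)) / INR (N * S m)) alpha.

Definition SCLrp (alpha : R) : Prop :=
  exists (k : nat) (Rl : word -> Prop) (w : word),
    recursive_presentation k Rl /\ over k w /\ scl_is k Rl w alpha.

(* Main.v *)
(** Upper bounds.  A commutator has [scl <= 1/2]: each exchange [A B C -> C B A] costs one
    commutator and turns [x^n y^n (xy)^2] into [x^(n+2) y^(n+2)], so that [(x y)^n x^-n y^-n] is a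
    product of about [n/2] commutators, and [(x y)^n] is [[a,b]^n] for [x = a], [y = b a^-1 b^-1].
    Hence a relation [g^q = c^p] with [c] a commutator forces [scl(g) <= p/(2q)].

    Lower bounds.  On increasing bijections of the line commuting with [x -> x + 1], a product of
    [m] commutators moves a point by at most [2m]; if [g] acts as the translation by [beta], then
    [scl(g) >= beta/2].

    Given [alpha] right-computable and [beta = 2 alpha], we impose [g^q = c_i^p] for all fractions
    [p/q > beta], enumerated by [i]; this gives [scl(g) <= alpha].  For the lower bound only
    finitely many relations matter, and each [c_i] has to act as the translation by
    [q beta / p < 1].  Such a translation is a commutator [[u_i,v]] with [v] independent of [i]
    and [u_i] supported on two arcs.  The infinitely many [u_i] are obtained from finitely many
    generators as [[s^-i F s^i, h]], where [F] contains copies of all [u_i] on disjoint intervals.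

    Conversely, membership of [(n, m)] in the relation "[g^n] is a product of [m] commutators" is
    semi-decidable, and [alpha < r] iff [m/n < r] for one such pair.  For subtraction,
    the real with binary digits the halting set is not right-computable, but its difference to
    [1] is. *)

(* The upper bound is [p/(2q)] and the lower bound [beta/2]; they meet as [p/q] decreases to [beta],
   whence [beta = 2 alpha].

   The obstacle is that the translation lengths [q beta / p] stay below 1 but approach 1 as [p/q]
   approaches [beta], while the construction of [v] needs a gap below 1. So no single action
   satisfying all relations is built: the action is chosen after a derivation is given, for the
   finitely many relators that the derivation uses, and the remaining [c_i] act trivially.

   Hardly any program is written out. Predicates are shown to be Sigma_1 through closure under
   connectives, quantifiers and inductive definitions, and a total function with a Sigma_1 graph is
   computable. Only for the diagonal argument are programs themselves coded as numbers.

   For an algebraic number, an integer polynomial with a simple root at [alpha] changes sign there,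
   so near [alpha] the upper cut is a sign condition on integers. *)
Require Import Defs.
From Stdlib Require Import Reals Lra Lia ZArith Cantor Classical ClassicalEpsilon Setoid Morphisms.
From Coquelicot Require Import Coquelicot.
From Stdlib Require Import List.
Import ListNotations.

(** * Computable functions and semi-decidable predicates *)
Local Open Scope nat_scope.

Lemma prf_ind_nested (P : prf -> Prop) :
  P PZero -> P PSucc -> (forall i, P (PProj i)) ->
  (forall f gs, P f -> Forall P gs -> P (PComp f gs)) ->
  (forall f g, P f -> P g -> P (PPrec f g)) ->
  (forall f, P f -> P (PMu f)) -> forall f, P f.
Proof.
  intros H0 H1 H2 H3 H4 H5. fix IH 1. intros [| |i|f gs|f g|f].
  - exact H0.
  - exact H1.
  - apply H2.
  - apply H3; [apply IH|]. induction gs as [|g gs IHgs]; constructor; [apply IH|exact IHgs].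
  - apply H4; apply IH.
  - apply H5; apply IH.
Qed.

(** The premises of [ev_comp] and [ev_mu] hide [peval] under [Forall2] and under an existential;
    here both come with an induction hypothesis. *)
Lemma peval_ind_nested (P : prf -> list nat -> nat -> Prop) :
  (forall v, P PZero v 0) ->
  (forall x v, P PSucc (x :: v) (S x)) ->
  (forall i v, P (PProj i) v (nth i v 0)) ->
  (forall f gs v ys z, Forall2 (fun g y => peval g v y) gs ys ->
     Forall2 (fun g y => P g v y) gs ys -> peval f ys z -> P f ys z -> P (PComp f gs) v z) ->
  (forall f g v z, peval f v z -> P f v z -> P (PPrec f g) (0 :: v) z) ->
  (forall f g n v y z, peval (PPrec f g) (n :: v) y -> P (PPrec f g) (n :: v) y ->
     peval g (n :: y :: v) z -> P g (n :: y :: v) z -> P (PPrec f g) (S n :: v) z) ->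
  (forall f v n, peval f (n :: v) 0 -> P f (n :: v) 0 ->
     (forall m, m < n -> exists k, peval f (m :: v) (S k) /\ P f (m :: v) (S k)) ->
     P (PMu f) v n) ->
  forall f v y, peval f v y -> P f v y.
Proof.
  intros H0 H1 H2 H3 H4 H5 H6. fix IH 4.
  intros f v y [v'|x v'|i v'|f' gs v' ys z F E|f' g v' z E|f' g n v' y' z E1 E2|f' v' n E E2].
  - apply H0.
  - apply H1.
  - apply H2.
  - apply H3 with ys; [exact F| |exact E|apply IH; exact E].
    clear E. induction F as [|g y' gs ys E F IHF]; constructor; [apply IH; exact E|exact IHF].
  - apply H4; [exact E|apply IH; exact E].
  - apply H5 with y'; [exact E1|apply IH; exact E1|exact E2|apply IH; exact E2].
  - apply H6; [exact E|apply IH; exact E|].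
    intros m Hm. destruct (E2 m Hm) as [k Ek]. exists k. split; [exact Ek|apply IH; exact Ek].
Qed.

Lemma peval_det f v y : peval f v y -> forall y', peval f v y' -> y = y'.
Proof.
  revert f v y. apply (peval_ind_nested (fun f v y => forall y', peval f v y' -> y = y')).
  - intros v y' E; inversion E; auto.
  - intros x v y' E; inversion E; auto.
  - intros i v y' E; inversion E; auto.
  - intros f gs v ys z _ F E1 IH y' E. inversion E as [| | |? ? ? ys' ? F' E2| | |]; subst.
    apply IH. replace ys with ys'; auto. clear -F F'. revert ys' F'.
    induction F; intros ys' F'; inversion F'; subst; f_equal; auto. symmetry; auto.
  - intros f g v z E IH y' E'. inversion E'; subst; auto.
  - intros f g n v y z E1 IH1 E2 IH2 y' E'. inversion E'; subst.
    apply IH2. erewrite IH1; eauto.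
  - intros f v n E IH Hlt y' E'. inversion E' as [| | | | | |? ? ? E2 Hlt2]; subst.
    destruct (Nat.lt_trichotomy n y') as [H|[H|H]]; auto.
    + destruct (Hlt2 n H) as [k Hk]. specialize (IH _ Hk). discriminate.
    + destruct (Hlt y' H) as [k [Hk1 Hk2]]. specialize (Hk2 _ E2). discriminate.
Qed.

(** [F] is any function on lists, possibly defined by choice, such as [capp] below; only its values
    at lists of length [m] have to be computed. *)
Definition Comp (m : nat) (F : list nat -> nat) : Prop :=
  exists f, forall v, length v = m -> peval f v (F v).

(* A tuple of [k] computable functions of [m] arguments, i.e. a substitution. *)
Definition Env (m k : nat) (E : list nat -> list nat) : Prop :=
  exists Gs, length Gs = k /\ Forall (Comp m) Gs /\
    forall v, length v = m -> E v = map (fun G : list nat -> nat => G v) Gs.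

Lemma Comp_ext m F G : (forall v, length v = m -> F v = G v) -> Comp m F -> Comp m G.
Proof. intros H [f Hf]. exists f. intros v Hv. rewrite <- H; auto. Qed.

Lemma Comp_nth m i : Comp m (fun v => nth i v 0).
Proof. exists (PProj i). intros; constructor. Qed.

Lemma Comp_Env m k F E : Comp k F -> Env m k E -> Comp m (fun v => F (E v)).
Proof.
  intros [f Hf] [Gs [HL [HG HE]]].
  assert (exists gs, forall v, length v = m ->
            Forall2 (fun g y => peval g v y) gs (map (fun G : list nat -> nat => G v) Gs)) as [gs Hgs].
  { clear HL HE. induction HG as [|G Gs [g Hg] _ [gs Hgs]].
    - exists []. intros; constructor.
    - exists (g :: gs). intros v Hv. constructor; auto. }
  exists (PComp f gs). intros v Hv. apply ev_comp with (E v).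
  - rewrite HE by auto. auto.
  - apply Hf. rewrite HE, length_map by auto. exact HL.
Qed.

Lemma Env_nil m : Env m 0 (fun _ => []).
Proof. exists []. repeat split; auto. Qed.

Lemma Env_cons m k X E : Comp m X -> Env m k E -> Env m (S k) (fun v => X v :: E v).
Proof.
  intros HX [Gs [HL [HG HE]]]. exists (X :: Gs). repeat split; simpl; auto.
  intros v Hv. rewrite HE; auto.
Qed.

Lemma Env_tl m k E : Env m (S k) E -> Env m k (fun v => tl (E v)).
Proof.
  intros [[|G Gs] [HL [HG HE]]]; [discriminate|]. exists Gs.
  inversion HG; subst. repeat split; auto.
  intros v Hv. rewrite HE; auto.
Qed.

Lemma map_nth_seq (v : list nat) : map (fun i => nth i v 0) (seq 0 (length v)) = v.
Proof.
  apply nth_ext with 0 0; rewrite length_map, length_seq; auto.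
  intros n Hn. rewrite nth_indep with (d' := nth 0 v 0) by (rewrite length_map, length_seq; auto).
  rewrite (map_nth (fun i => nth i v 0)). rewrite seq_nth; auto.
Qed.

Lemma Env_id m : Env m m (fun v => v).
Proof.
  exists (map (fun i v => nth i v 0) (seq 0 m)). repeat split.
  - rewrite length_map, length_seq; auto.
  - apply Forall_forall. intros G HG. apply in_map_iff in HG as [i [<- _]]. apply Comp_nth.
  - intros v Hv. rewrite map_map. subst m. symmetry. apply map_nth_seq.
Qed.

Lemma Comp_nthE m k i E : Env m k E -> Comp m (fun v => nth i (E v) 0).
Proof. apply (Comp_Env m k (fun v => nth i v 0)). apply Comp_nth. Qed.

Lemma Comp_S m X : Comp m X -> Comp m (fun v => S (X v)).
Proof.
  intros HX. apply (Comp_Env m 1 (fun v => S (nth 0 v 0)) (fun v => [X v])).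
  - exists PSucc. intros [|x v] Hv; [discriminate|]. simpl. constructor.
  - apply Env_cons; auto. apply Env_nil.
Qed.

Lemma Comp_const m n : Comp m (fun _ => n).
Proof. induction n; [exists PZero; intros; constructor | apply Comp_S; auto]. Qed.

Lemma Comp_prec m F G N : Comp m F -> Comp (S (S m)) G -> Comp m N ->
  Comp m (fun v => nat_rect (fun _ => nat) (F v) (fun n y => G (n :: y :: v)) (N v)).
Proof.
  intros [f Hf] [g Hg] HN.
  apply (Comp_Env m (S m)
    (fun w => nat_rect (fun _ => nat) (F (tl w)) (fun n y => G (n :: y :: tl w)) (nth 0 w 0))
    (fun v => N v :: v)).
  - exists (PPrec f g). intros [|n v] Hv; [discriminate|]. simpl in *. injection Hv as Hv.
    induction n; simpl.
    + constructor; auto.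
    + econstructor; eauto. apply Hg. simpl; auto.
  - apply Env_cons; auto. apply Env_id.
Qed.

Lemma Comp_mu m F U : Comp (S m) F ->
  (forall v, length v = m -> F (U v :: v) = 0 /\ forall x, x < U v -> F (x :: v) <> 0) -> Comp m U.
Proof.
  intros [f Hf] H. exists (PMu f). intros v Hv. destruct (H v Hv) as [H1 H2]. constructor.
  - rewrite <- H1. apply Hf. simpl; auto.
  - intros x Hx. specialize (H2 x Hx). exists (pred (F (x :: v))).
    replace (S (pred (F (x :: v)))) with (F (x :: v)) by lia. apply Hf. simpl; auto.
Qed.

(** A hook, redefined as new closure properties are proved, so that [comp] and [env] can use
    them. *)
Ltac comp_user := fail.
Ltac comp :=
  cbv beta;
  lazymatch goal with
  | |- Comp _ (fun v => nth _ _ 0) => eapply Comp_nthE; env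
  | |- Comp _ _ =>
      first [ apply Comp_const | apply Comp_S; comp | assumption | comp_user
            | eapply Comp_Env; [eassumption | env] ]
  end
with env :=
  cbv beta;
  first [ apply Env_id | apply Env_nil | apply Env_tl; env | apply Env_cons; [comp | env] ].

Lemma Comp_add m X Y : Comp m X -> Comp m Y -> Comp m (fun v => X v + Y v).
Proof.
  intros HX HY.
  apply Comp_ext with (fun v => nat_rect (fun _ => nat) (X v)
     (fun n y => (fun w => S (nth 1 w 0)) (n :: y :: v)) (Y v)).
  - intros v _. generalize (Y v) as n. induction n; simpl in *; lia.
  - apply (Comp_prec m X (fun w => S (nth 1 w 0)) Y); auto. comp.
Qed.

Ltac comp_user ::= apply Comp_add; comp.

Lemma Comp_mul m X Y : Comp m X -> Comp m Y -> Comp m (fun v => X v * Y v).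
Proof.
  intros HX HY.
  apply Comp_ext with (fun v => nat_rect (fun _ => nat) 0
     (fun n y => (fun w => nth 1 w 0 + X (tl (tl w))) (n :: y :: v)) (Y v)).
  - intros v _. generalize (Y v) as n. induction n; simpl in *; lia.
  - apply (Comp_prec m (fun _ => 0) (fun w => nth 1 w 0 + X (tl (tl w))) Y); comp.
Qed.

Lemma Comp_sub m X Y : Comp m X -> Comp m Y -> Comp m (fun v => X v - Y v).
Proof.
  intros HX HY.
  assert (HP : Comp 1 (fun v => pred (nth 0 v 0))).
  { apply Comp_ext with (fun v => nat_rect (fun _ => nat) 0
       (fun n y => (fun w => nth 0 w 0) (n :: y :: v)) (nth 0 v 0)).
    - intros v _. destruct (nth 0 v 0); auto.
    - apply (Comp_prec 1 (fun _ => 0) (fun w => nth 0 w 0) (fun v => nth 0 v 0)); comp. }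
  apply Comp_ext with (fun v => nat_rect (fun _ => nat) (X v)
     (fun n y => (fun w => pred (nth 1 w 0)) (n :: y :: v)) (Y v)).
  - intros v _. generalize (Y v) as n. induction n; simpl in *; lia.
  - apply (Comp_prec m X (fun w => pred (nth 1 w 0)) Y); auto.
    apply (Comp_Env _ 1 (fun v => pred (nth 0 v 0)) (fun w => [nth 1 w 0])); auto; env.
Qed.

Ltac comp_user ::=
  first [ apply Comp_add; comp | apply Comp_mul; comp | apply Comp_sub; comp ].

(** * Pairing, bounded quantifiers and finite sequences *)

Definition tri (n : nat) : nat := nat_rect (fun _ => nat) 0 (fun n y => y + S n) n.

Lemma Comp_tri m X : Comp m X -> Comp m (fun v => tri (X v)).
Proof.
  intros HX. unfold tri.
  apply (Comp_prec m (fun _ => 0) (fun w => nth 1 w 0 + S (nth 0 w 0)) X); comp.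
Qed.

Lemma tri_spec n : tri n * 2 = n * S n.
Proof. induction n; simpl in *; lia. Qed.

(** The division in [npair] is exact and computes a triangular number, which has a primitive
    recursion. *)
Lemma npair_tri a b : npair a b = tri (a + b) + b.
Proof.
  unfold npair. f_equal. rewrite Nat.add_1_r, <- tri_spec, Nat.div_mul; lia.
Qed.

(** Bijectivity, and with it the projections [p1] and [p2], comes from the Cantor pairing. *)
Lemma npair_cantor a b : npair a b = to_nat (a, b).
Proof.
  rewrite npair_tri. pose proof (to_nat_spec a b). pose proof (tri_spec (a + b)).
  rewrite (Nat.add_comm b a) in H. nia.
Qed.

Lemma Comp_npair m X Y : Comp m X -> Comp m Y -> Comp m (fun v => npair (X v) (Y v)).
Proof.
  intros HX HY. apply Comp_ext with (fun v => tri (X v + Y v) + Y v).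
  - intros; symmetry; apply npair_tri.
  - apply Comp_add; auto. apply Comp_tri. comp.
Qed.

Definition p1 (n : nat) : nat := fst (of_nat n).
Definition p2 (n : nat) : nat := snd (of_nat n).

Lemma p1_npair a b : p1 (npair a b) = a.
Proof. unfold p1. rewrite npair_cantor, cancel_of_to. auto. Qed.
Lemma p2_npair a b : p2 (npair a b) = b.
Proof. unfold p2. rewrite npair_cantor, cancel_of_to. auto. Qed.
Lemma npair_p n : npair (p1 n) (p2 n) = n.
Proof. unfold p1, p2. rewrite npair_cantor, <- surjective_pairing, cancel_to_of. auto. Qed.
Lemma npair_inj a b c d : npair a b = npair c d -> a = c /\ b = d.
Proof.
  intros H. split; [rewrite <- (p1_npair a b), H, p1_npair | rewrite <- (p2_npair a b), H, p2_npair]; auto.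
Qed.
Lemma npair_ge_r a b : b <= npair a b.
Proof. rewrite npair_tri. lia. Qed.

(** Bounded quantifiers in arithmetic form: with zero as truth, a product is an existential and a
    sum a universal quantifier. *)
Definition nprod (n : nat) (f : nat -> nat) : nat := nat_rect (fun _ => nat) 1 (fun i y => y * f i) n.
Definition nsum (n : nat) (f : nat -> nat) : nat := nat_rect (fun _ => nat) 0 (fun i y => y + f i) n.

Lemma nprod_0 n f : nprod n f = 0 <-> exists i, i < n /\ f i = 0.
Proof.
  induction n; simpl.
  - split; [discriminate|intros [i [Hi _]]; lia].
  - rewrite Nat.mul_eq_0, IHn. split.
    + intros [[i [Hi H]]|H]; [exists i|exists n]; auto with arith.
    + intros [i [Hi H]]. assert (i = n \/ i < n) as [->|] by lia; eauto.
Qed.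
Lemma nsum_0 n f : nsum n f = 0 <-> forall i, i < n -> f i = 0.
Proof.
  induction n; simpl.
  - split; [intros; lia|auto].
  - rewrite Nat.eq_add_0, IHn. split.
    + intros [H H'] i Hi. assert (i = n \/ i < n) as [->|] by lia; auto.
    + intros H; split; auto.
Qed.

Lemma Comp_nprod m F N : Comp (S m) F -> Comp m N -> Comp m (fun v => nprod (N v) (fun i => F (i :: v))).
Proof.
  intros HF HN.
  apply (Comp_prec m (fun _ => 1) (fun w => nth 1 w 0 * F (nth 0 w 0 :: tl (tl w))) N); comp.
Qed.
Lemma Comp_nsum m F N : Comp (S m) F -> Comp m N -> Comp m (fun v => nsum (N v) (fun i => F (i :: v))).
Proof.
  intros HF HN.
  apply (Comp_prec m (fun _ => 0) (fun w => nth 1 w 0 + F (nth 0 w 0 :: tl (tl w))) N); comp.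
Qed.

(** A search for the least [a] such that [npair a b = n] for some [b <= n], the bound coming from
    [npair_ge_r]. Equality is the vanishing of the sum of the two truncated differences. *)
Lemma Comp_p1 m X : Comp m X -> Comp m (fun v => p1 (X v)).
Proof.
  intros HX.
  apply Comp_mu with (fun w => nprod (S (X (tl w)))
    (fun b => (fun w => (npair (nth 1 w 0) (nth 0 w 0) - X (tl (tl w)))
                        + (X (tl (tl w)) - npair (nth 1 w 0) (nth 0 w 0))) (b :: w))).
  - apply (Comp_nprod _ (fun w => (npair (nth 1 w 0) (nth 0 w 0) - X (tl (tl w)))
      + (X (tl (tl w)) - npair (nth 1 w 0) (nth 0 w 0))) (fun w => S (X (tl w)))); [|comp].
    apply Comp_add; apply Comp_sub; try comp; apply Comp_npair; comp.
  - intros v _. cbn [nth tl]. split.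
    + apply nprod_0. exists (p2 (X v)). pose proof (npair_p (X v)).
      pose proof (npair_ge_r (p1 (X v)) (p2 (X v))). split; lia.
    + intros x Hx H. apply nprod_0 in H as [b [Hb H]].
      assert (E : npair x b = X v) by lia. rewrite <- E, p1_npair in Hx. lia.
Qed.

Lemma Comp_p2 m X : Comp m X -> Comp m (fun v => p2 (X v)).
Proof.
  intros HX.
  apply Comp_mu with (fun w => (npair (p1 (X (tl w))) (nth 0 w 0) - X (tl w))
                        + (X (tl w) - npair (p1 (X (tl w))) (nth 0 w 0))).
  - apply Comp_add; apply Comp_sub; try comp; apply Comp_npair; try comp; apply Comp_p1; comp.
  - intros v _. simpl. split.
    + rewrite npair_p. lia.
    + intros x Hx H. assert (E : npair (p1 (X v)) x = X v) by lia.
      rewrite <- E, p2_npair in Hx. lia.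
Qed.

(* [lnth i L] reads the [i]-th entry of the finite sequence coded by the iterated pair [L]. *)
Definition lnth (i L : nat) : nat := p1 (nat_rect (fun _ => nat) L (fun _ y => p2 y) i).

Lemma Comp_lnth m I L : Comp m I -> Comp m L -> Comp m (fun v => lnth (I v) (L v)).
Proof.
  intros HI HL. apply Comp_p1.
  apply (Comp_prec m L (fun w => p2 (nth 1 w 0)) I); auto. apply Comp_p2. comp.
Qed.

Lemma lnth_0 a L : lnth 0 (npair a L) = a.
Proof. apply p1_npair. Qed.
Lemma lnth_S i a L : lnth (S i) (npair a L) = lnth i L.
Proof.
  unfold lnth. f_equal. induction i; simpl in *; [apply p2_npair|].
  rewrite IHi. auto.
Qed.
Lemma lnth_ex n (f : nat -> nat) : exists L, forall i, i < n -> lnth i L = f i.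
Proof.
  revert f. induction n; intros f; [exists 0; lia|].
  destruct (IHn (fun i => f (S i))) as [L HL]. exists (npair (f 0) L).
  intros [|i] Hi; [apply lnth_0|]. rewrite lnth_S. apply HL. lia.
Qed.

Ltac comp_arith :=
  first [ apply Comp_add; comp | apply Comp_mul; comp | apply Comp_sub; comp
        | apply Comp_npair; comp | apply Comp_p1; comp | apply Comp_p2; comp
        | apply Comp_lnth; comp ].
Ltac comp_user ::= comp_arith.

(* [Sigma_1] predicates on lists of length [m]. *)
Definition Sg (m : nat) (P : list nat -> Prop) : Prop :=
  exists B, Comp (S m) B /\ forall v, length v = m -> (P v <-> exists t, B (t :: v) = 0).

Lemma Sg_ext m P Q : (forall v, length v = m -> (P v <-> Q v)) -> Sg m P -> Sg m Q.
Proof. intros H [B [HB HP]]. exists B. split; auto. intros v Hv. rewrite <- H; auto. Qed.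

Lemma Sg_zero m X : Comp m X -> Sg m (fun v => X v = 0).
Proof.
  intros HX. exists (fun w => X (tl w)). split; [comp|].
  intros v Hv. simpl. split; [exists 0; auto|intros [_ H]; auto].
Qed.
Lemma Sg_eq m X Y : Comp m X -> Comp m Y -> Sg m (fun v => X v = Y v).
Proof.
  intros. apply Sg_ext with (fun v => (X v - Y v) + (Y v - X v) = 0); [intros; lia|].
  apply Sg_zero. comp.
Qed.
Lemma Sg_le m X Y : Comp m X -> Comp m Y -> Sg m (fun v => X v <= Y v).
Proof.
  intros. apply Sg_ext with (fun v => X v - Y v = 0); [intros; lia|]. apply Sg_zero. comp.
Qed.
Lemma Sg_lt m X Y : Comp m X -> Comp m Y -> Sg m (fun v => X v < Y v).
Proof. intros. apply (Sg_le m (fun v => S (X v)) Y); auto. comp. Qed.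
Lemma Sg_false m : Sg m (fun _ => False).
Proof.
  apply Sg_ext with (fun _ => 1 = 0); [intros; split; [discriminate|tauto]|].
  apply (Sg_zero m (fun _ => 1)). comp.
Qed.
Lemma Sg_true m : Sg m (fun _ => True).
Proof.
  apply Sg_ext with (fun _ => 0 = 0); [tauto|]. apply (Sg_zero m (fun _ => 0)). comp.
Qed.

Lemma Sg_Env m k P E : Sg k P -> Env m k E -> Sg m (fun v => P (E v)).
Proof.
  intros [B [HB HP]] HE. exists (fun w => B (nth 0 w 0 :: E (tl w))). split.
  - assert (HE' : Env (S m) k (fun w => E (tl w))).
    { destruct HE as [Gs [HL [HG HE]]].
      exists (map (fun G w => G (tl w)) Gs). rewrite length_map. repeat split; auto.
      - apply Forall_forall. intros G' HG'. apply in_map_iff in HG' as [G [<- HGi]].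
        rewrite Forall_forall in HG. specialize (HG G HGi). comp.
      - intros [|x v] Hv; [discriminate|]. rewrite map_map. apply HE. auto. }
    eapply Comp_Env; [eassumption|]. apply Env_cons; [comp|exact HE'].
  - intros v Hv. simpl. apply HP. destruct HE as [Gs [HL [_ HE]]].
    rewrite HE, length_map; auto.
Qed.

Lemma Sg_and m P Q : Sg m P -> Sg m Q -> Sg m (fun v => P v /\ Q v).
Proof.
  intros [B [HB HP]] [C [HC HQ]].
  exists (fun w => B (p1 (nth 0 w 0) :: tl w) + C (p2 (nth 0 w 0) :: tl w)). split; [comp|].
  intros v Hv. rewrite HP, HQ by auto. simpl. split.
  - intros [[s Hs] [t Ht]]. exists (npair s t). rewrite p1_npair, p2_npair. lia.
  - intros [t Ht]. split; [exists (p1 t)|exists (p2 t)]; lia.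
Qed.
Lemma Sg_or m P Q : Sg m P -> Sg m Q -> Sg m (fun v => P v \/ Q v).
Proof.
  intros [B [HB HP]] [C [HC HQ]].
  exists (fun w => B w * C w). split; [comp|].
  intros v Hv. rewrite HP, HQ by auto. split.
  - intros [[s Hs]|[s Hs]]; exists s; rewrite Hs; lia.
  - intros [t Ht]. apply Nat.mul_eq_0 in Ht as [Ht|Ht]; eauto.
Qed.
Lemma Sg_ex m P : Sg (S m) (fun w => P (nth 0 w 0) (tl w)) -> Sg m (fun v => exists x, P x v).
Proof.
  intros [B [HB HP]].
  exists (fun w => B (p1 (nth 0 w 0) :: p2 (nth 0 w 0) :: tl w)). split; [comp|].
  intros v Hv. simpl. split.
  - intros [x Hx]. apply (HP (x :: v)) in Hx as [t Ht]; [|simpl; auto].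
    exists (npair t x). rewrite p1_npair, p2_npair. auto.
  - intros [t Ht]. exists (p2 t). apply (HP (p2 t :: v)); [simpl; auto|]. eauto.
Qed.
(** Sigma_1 collection: one number [L] codes witnesses for all [x] below the bound, and checking
    them is a bounded sum. *)
Lemma Sg_all m N P : Comp m N -> Sg (S m) (fun w => P (nth 0 w 0) (tl w)) ->
  Sg m (fun v => forall x, x < N v -> P x v).
Proof.
  intros HN [B [HB HP]].
  exists (fun w => nsum (N (tl w))
     (fun x => (fun u => B (lnth (nth 0 u 0) (nth 1 u 0) :: nth 0 u 0 :: tl (tl u))) (x :: w))).
  split.
  - apply (Comp_nsum _ (fun u => B (lnth (nth 0 u 0) (nth 1 u 0) :: nth 0 u 0 :: tl (tl u)))
      (fun w => N (tl w))); comp.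
  - intros v Hv. simpl. split.
    + intros H.
      assert (Ht : forall x, exists t, x < N v -> B (t :: x :: v) = 0).
      { intros x. destruct (classic (x < N v)) as [Hx|Hx]; [|exists 0; tauto].
        specialize (H x Hx). apply (HP (x :: v)) in H as [t Ht]; [|simpl; auto]. eauto. }
      destruct (lnth_ex (N v) (fun x => proj1_sig (constructive_indefinite_description _ (Ht x)))) as [L HL].
      exists L. apply nsum_0. intros x Hx. rewrite HL by auto.
      destruct (constructive_indefinite_description _ (Ht x)) as [t H']; simpl; auto.
    + intros [L HL] x Hx. apply (HP (x :: v)); [simpl; auto|].
      exists (lnth x L). revert HL. rewrite nsum_0. auto.
Qed.

(** Search for the least pair of a value and a witness that it belongs to the graph; totality of [F]
    makes the search end. *)
Lemma graph_Comp m F : Sg (S m) (fun w => nth 0 w 0 = F (tl w)) -> Comp m F.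
Proof.
  intros [B [HB HP]].
  assert (HT : forall v, exists t, length v = m ->
      B (p2 t :: p1 t :: v) = 0 /\ forall x, x < t -> B (p2 x :: p1 x :: v) <> 0).
  { intros v. destruct (classic (length v = m)) as [Hv|Hv]; [|exists 0; tauto].
    assert (H : exists t, B (p2 t :: p1 t :: v) = 0).
    { destruct (proj1 (HP (F v :: v) (f_equal S Hv)) eq_refl) as [t Ht].
      exists (npair (F v) t). rewrite p1_npair, p2_npair. auto. }
    destruct H as [t0 H0]. revert H0. induction (lt_wf t0) as [t0 _ IH]. intros H0.
    destruct (classic (exists x, x < t0 /\ B (p2 x :: p1 x :: v) = 0)) as [[x [Hx1 Hx2]]|Hn].
    - apply (IH x); auto.
    - exists t0. intros _. split; auto. intros x Hx E. apply Hn; eauto. }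
  pose (T := fun v => proj1_sig (constructive_indefinite_description _ (HT v))).
  assert (HT' : forall v, length v = m ->
      B (p2 (T v) :: p1 (T v) :: v) = 0 /\ forall x, x < T v -> B (p2 x :: p1 x :: v) <> 0).
  { intros v. unfold T. destruct (constructive_indefinite_description _ (HT v)); auto. }
  apply Comp_ext with (fun v => p1 (T v)).
  - intros v Hv. destruct (HT' v Hv) as [H _].
    symmetry. pose proof (proj2 (HP (p1 (T v) :: v) (f_equal S Hv))) as H'. simpl in H'.
    rewrite H'; eauto.
  - apply Comp_p1. apply Comp_mu with (fun w => B (p2 (nth 0 w 0) :: p1 (nth 0 w 0) :: tl w)); [comp|].
    intros v Hv. simpl. apply HT'. auto.
Qed.

Ltac sg_user := fail.
Ltac sg :=
  cbv beta;
  lazymatch goal with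
  | |- Sg _ (fun v => _ /\ _) => apply Sg_and; sg
  | |- Sg _ (fun v => _ \/ _) => apply Sg_or; sg
  | |- Sg _ (fun v => exists x, _) => apply Sg_ex; sg
  | |- Sg _ (fun v => forall x, x < _ -> _) => apply Sg_all; [comp | sg]
  | |- Sg _ (fun v => _ = _) => apply Sg_eq; comp
  | |- Sg _ (fun v => _ < _) => apply Sg_lt; comp
  | |- Sg _ (fun v => _ <= _) => apply Sg_le; comp
  | |- Sg _ _ => first [ apply Sg_true | apply Sg_false | assumption | sg_user
                       | eapply Sg_Env; [eassumption | env] ]
  end.

(** Induction on the program: the intermediate results of a composition or a recursion are
    quantified as one coded sequence [L]. This handles each program separately; the version uniform
    in the program is [derivable] below. *)
Lemma graph_Sg f : forall m, Sg (S m) (fun w => peval f (tl w) (nth 0 w 0)).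
Proof.
  induction f as [| |i|f gs IHf IHgs|f g IHf IHg|f IHf] using prf_ind_nested; intros m.
  - apply Sg_ext with (fun w => nth 0 w 0 = 0); [|sg].
    intros [|y v] Hw; [discriminate|]. simpl.
    split; [intros ->; constructor|intros E; inversion E; auto].
  - destruct m as [|m].
    + apply Sg_ext with (fun _ => False); [|sg].
      intros [|y [|]] Hw; try discriminate. split; [tauto|intros E; inversion E].
    + apply Sg_ext with (fun w => nth 0 w 0 = S (nth 0 (tl w) 0)); [|sg].
      intros [|y [|x v]] Hw; try discriminate. simpl.
      split; [intros ->; constructor|intros E; inversion E; auto].
  - apply Sg_ext with (fun w => nth 0 w 0 = nth i (tl w) 0); [|sg].
    intros [|y v] Hw; try discriminate. simpl.
    split; [intros ->; constructor|intros E; inversion E; auto].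
  - apply Sg_ext with (fun w => exists L,
      Forall2 (fun g y => peval g (tl w) y) gs (map (fun i => lnth i L) (seq 0 (length gs))) /\
      peval f (map (fun i => lnth i L) (seq 0 (length gs))) (nth 0 w 0)).
    + intros [|z v] Hw; [discriminate|]. simpl. split.
      * intros [L [H1 H2]]. econstructor; eauto.
      * intros E. inversion E as [| | |? ? ? ys ? F E2| | |]; subst.
        destruct (lnth_ex (length ys) (fun i => nth i ys 0)) as [L HL]. exists L.
        assert (map (fun i => lnth i L) (seq 0 (length gs)) = ys) as ->; auto.
        rewrite (Forall2_length F). etransitivity; [|apply map_nth_seq].
        apply map_ext_in. intros i Hi. apply in_seq in Hi. apply HL. lia.
    + apply Sg_ex. apply Sg_and; cbv beta.
      * enough (H : forall a, Sg (S (S m)) (fun w => Forall2 (fun g y => peval g (tl (tl w)) y) gs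
          (map (fun i => lnth i (nth 0 w 0)) (seq a (length gs))))) by apply H.
        induction IHgs as [|g gs Hg _ IH]; intros a; simpl.
        -- apply Sg_ext with (fun _ => True); [|sg]. intros; split; auto.
        -- apply Sg_ext with (fun w => peval g (tl (tl w)) (lnth a (nth 0 w 0)) /\
              Forall2 (fun g0 y => peval g0 (tl (tl w)) y) gs
                (map (fun i => lnth i (nth 0 w 0)) (seq (S a) (length gs)))).
           ++ intros w _. split; [intros [H1 H2]; constructor; auto|intros H; inversion H; auto].
           ++ apply Sg_and; auto.
              apply (Sg_Env _ (S m) (fun w => peval g (tl w) (nth 0 w 0))
                (fun w => lnth a (nth 0 w 0) :: tl (tl w))); auto. env.
      * apply (Sg_Env _ (S (length gs)) (fun w => peval f (tl w) (nth 0 w 0))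
          (fun w => nth 0 (tl w) 0 :: map (fun i => lnth i (nth 0 w 0)) (seq 0 (length gs)))); auto.
        apply Env_cons; [comp|].
        enough (H : forall a, Env (S (S m)) (length gs) (fun w =>
          map (fun i => lnth i (nth 0 w 0)) (seq a (length gs)))) by apply H.
        clear. induction gs; intros b; simpl; [env|].
        apply (Env_cons _ _ (fun w => lnth b (nth 0 w 0))); [comp|]. apply IHgs.
  - destruct m as [|m].
    + apply Sg_ext with (fun _ => False); [|sg].
      intros [|y [|]] Hw; try discriminate. split; [tauto|intros E; inversion E].
    (* [L] is the course of values: its entry [k] is the result for recursion argument [k]. *)
    + apply Sg_ext with (fun w => exists L, peval f (tl (tl w)) (lnth 0 L) /\
        nth 0 w 0 = lnth (nth 0 (tl w) 0) L /\
        forall k, k < nth 0 (tl w) 0 -> peval g (k :: lnth k L :: tl (tl w)) (lnth (S k) L)).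
      * intros [|z [|n v]] Hw; try discriminate. simpl. split.
        -- intros [L [H1 [-> H2]]]. induction n.
           ++ constructor; auto.
           ++ econstructor; [|apply H2; auto]. apply IHn; auto.
        -- intros E.
           assert (HL : exists l : nat -> nat, peval f v (l 0) /\ z = l n /\
              forall k, k < n -> peval g (k :: l k :: v) (l (S k))).
           { clear Hw. revert z E. induction n; intros z E; inversion E; subst.
             - exists (fun _ => z). repeat split; auto. lia.
             - destruct (IHn y) as [l [Hl1 [-> Hl2]]]; auto.
               exists (fun k => if k =? S n then z else l k). rewrite Nat.eqb_refl. repeat split; auto.
               intros k Hk.
               replace (k =? S n) with false by (symmetry; apply Nat.eqb_neq; lia).
               destruct (Nat.eqb_spec (S k) (S n)) as [Hkn|Hkn].
               + injection Hkn as ->; auto.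
               + apply Hl2; lia. }
           destruct HL as [l [Hl1 [-> Hl2]]]. destruct (lnth_ex (S n) l) as [L HL].
           exists L. rewrite !HL by lia. repeat split; auto.
           intros k Hk. rewrite !HL by lia. auto.
      * specialize (IHf m). specialize (IHg (S (S m))). apply Sg_ex, Sg_and; [|apply Sg_and]; cbv beta.
        -- apply (Sg_Env _ (S m) (fun w => peval f (tl w) (nth 0 w 0))
             (fun w => lnth 0 (nth 0 w 0) :: tl (tl (tl w)))); auto. env.
        -- sg.
        -- apply Sg_all; [comp|].
           apply (Sg_Env _ (S (S (S m))) (fun w => peval g (tl w) (nth 0 w 0))
             (fun w => lnth (S (nth 0 w 0)) (nth 0 (tl w) 0) :: nth 0 w 0 ::
                lnth (nth 0 w 0) (nth 0 (tl w) 0) :: tl (tl (tl (tl w))))); auto. env.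
  - apply Sg_ext with (fun w => peval f (nth 0 w 0 :: tl w) 0 /\
      forall x, x < nth 0 w 0 -> exists k, peval f (x :: tl w) (S k)).
    + intros [|n v] Hw; [discriminate|]. simpl.
      split; [intros [H1 H2]; constructor; auto|intros E; inversion E; auto].
    + specialize (IHf (S m)). apply Sg_and; [|apply Sg_all; [comp|apply Sg_ex]]; cbv beta.
      * apply (Sg_Env _ (S (S m)) (fun w => peval f (tl w) (nth 0 w 0))
             (fun w => 0 :: nth 0 w 0 :: tl w)); auto. env.
      * apply (Sg_Env _ (S (S m)) (fun w => peval f (tl w) (nth 0 w 0))
             (fun w => S (nth 0 w 0) :: nth 0 (tl w) 0 :: tl (tl (tl w)))); auto. env.
Qed.

(** Halting is an existential statement by [graph_Sg]; conversely [PMu] searches for the witness. *)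
Lemma RE_Sg A : RE A <-> Sg 1 (fun v => A (nth 0 v 0)).
Proof.
  split.
  - intros [f Hf]. apply Sg_ext with (fun v => exists y, peval f v y).
    + intros [|n [|]] Hv; try discriminate. simpl. symmetry. apply Hf.
    + pose proof (graph_Sg f 1). apply Sg_ex. auto.
  - intros [B [[f Hf] HB]]. exists (PMu f). intros n.
    rewrite (HB [n] eq_refl). simpl. split.
    + intros [t Ht].
      assert (exists t, B [t; n] = 0 /\ forall x, x < t -> B [x; n] <> 0) as [t' [H1 H2]].
      { revert Ht. induction (lt_wf t) as [t _ IH]. intros Ht.
        destruct (classic (exists x, x < t /\ B [x; n] = 0)) as [[x [Hx1 Hx2]]|Hn].
        - apply (IH x); auto.
        - exists t. split; auto. intros x Hx E. apply Hn; eauto. }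
      exists t'. constructor.
      * rewrite <- H1. apply Hf; auto.
      * intros x Hx. exists (pred (B [x; n])). specialize (H2 x Hx).
        replace (S (pred (B [x; n]))) with (B [x; n]) by lia. apply Hf; auto.
    + intros [y Hy]. inversion Hy; subst. exists y.
      apply (peval_det _ _ _ (Hf [y; n] eq_refl)). auto.
Qed.

(** Membership is the event that the program returns 1; determinism excludes this value outside
    [A]. *)
Lemma Decidable_RE A : Decidable A -> RE A.
Proof.
  intros [f Hf]. apply RE_Sg. apply Sg_ext with (fun v => peval f v 1).
  - intros [|n [|]] Hv; try discriminate. simpl. split.
    + intros E. apply NNPP. intros Hn. pose proof (peval_det _ _ _ E _ (proj2 (Hf n) Hn)). discriminate.
    + apply Hf.
  - pose proof (graph_Sg f 1) as H.
    apply (Sg_Env _ 2 (fun w => peval f (tl w) (nth 0 w 0)) (fun v => 1 :: v)); auto. env.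
Qed.

(** The common format for the inductive definitions on codes below: axioms and two-premise rules. A
    rule with one premise ignores the other, which is then filled by a copy of the first. *)
Inductive clos (Base : nat -> Prop) (Step : nat -> nat -> nat -> Prop) : nat -> Prop :=
  | clos_base c : Base c -> clos Base Step c
  | clos_step p q c : Step p q c -> clos Base Step p -> clos Base Step q -> clos Base Step c.

Lemma lnth_app n L m M : exists K, (forall i, i < n -> lnth i K = lnth i L) /\
  (forall i, i < m -> lnth (n + i) K = lnth i M).
Proof.
  destruct (lnth_ex (n + m) (fun i => if i <? n then lnth i L else lnth (i - n) M)) as [K HK].
  exists K. split; intros i Hi; rewrite HK by lia.
  - destruct (Nat.ltb_spec i n); auto. lia.
  - destruct (Nat.ltb_spec (n + i) n); [lia|]. f_equal. lia.
Qed.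

(* A member of the closure is witnessed by a list whose every entry is an axiom or follows from
   later entries. *)
Lemma clos_Sg Base Step :
  Sg 1 (fun v => Base (nth 0 v 0)) ->
  Sg 3 (fun v => Step (nth 0 v 0) (nth 1 v 0) (nth 2 v 0)) ->
  Sg 1 (fun v => clos Base Step (nth 0 v 0)).
Proof.
  intros HB HS.
  pose (ok := fun n L => forall i, i < n -> Base (lnth i L) \/
     exists j k, (i < j /\ j < n) /\ (i < k /\ k < n) /\ Step (lnth j L) (lnth k L) (lnth i L)).
  apply Sg_ext with (fun v => exists n L, 0 < n /\ lnth 0 L = nth 0 v 0 /\ ok n L).
  - intros [|c [|]] Hv; try discriminate. simpl. split.
    + intros [n [L [Hn [<- Hok]]]].
      assert (H : forall d i, i < n -> n - i <= d -> clos Base Step (lnth i L)).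
      { induction d; intros i Hi Hd; [lia|].
        destruct (Hok i Hi) as [Hb|[j [k [[Hj1 Hj2] [[Hk1 Hk2] Hs]]]]]; [constructor; auto|].
        eapply clos_step; [exact Hs| |]; apply IHd; lia. }
      apply (H n); auto; lia.
    + clear Hv. intros Hc. induction Hc as [c Hb|p q c Hs Hp IHp Hq IHq].
      * exists 1, (npair c 0). rewrite lnth_0. repeat split; auto.
        intros [|i] Hi; [|lia]. rewrite lnth_0; auto.
      * destruct IHp as [n [L [Hn [HL Hok]]]], IHq as [m [M [Hm [HM Hok']]]].
        destruct (lnth_app n L m M) as [K [HK1 HK2]].
        exists (S (n + m)), (npair c K). rewrite lnth_0. repeat split; [lia|].
        intros [|i] Hi.
        -- right. exists 1, (S n). rewrite lnth_0, !lnth_S.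
           rewrite HK1, HL by auto. pose proof (HK2 0 Hm) as HK0. rewrite Nat.add_0_r in HK0.
           rewrite HK0, HM. repeat split; auto; lia.
        -- rewrite lnth_S. destruct (Nat.lt_ge_cases i n) as [Hin|Hin].
           ++ rewrite HK1 by auto. destruct (Hok i Hin) as [Hb|[j [k [[Hj1 Hj2] [[Hk1 Hk2] Hs']]]]]; auto.
              right. exists (S j), (S k). rewrite !lnth_S, !HK1 by auto. repeat split; auto; lia.
           ++ replace i with (n + (i - n)) by lia. rewrite HK2 by lia.
              destruct (Hok' (i - n)) as [Hb|[j [k [[Hj1 Hj2] [[Hk1 Hk2] Hs']]]]]; [lia|auto|].
              right. exists (S (n + j)), (S (n + k)). rewrite !lnth_S, !HK2 by auto. repeat split; auto; lia.
  - unfold ok. apply Sg_ex, Sg_ex, Sg_and; [sg|apply Sg_and; [sg|]]. cbv beta.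
    apply Sg_all; [comp|]. apply Sg_or; cbv beta.
    + apply (Sg_Env _ 1 (fun v => Base (nth 0 v 0))
        (fun w => [lnth (nth 0 w 0) (nth 0 (tl w) 0)])); auto. env.
    + apply Sg_ex, Sg_ex, Sg_and; [sg|apply Sg_and; [sg|]]; cbv beta.
      apply (Sg_Env _ 3 (fun v => Step (nth 0 v 0) (nth 1 v 0) (nth 2 v 0))
        (fun w => [lnth (nth 0 (tl w) 0) (nth 0 (tl (tl (tl w))) 0);
                   lnth (nth 0 w 0) (nth 0 (tl (tl (tl w))) 0);
                   lnth (nth 0 (tl (tl w)) 0) (nth 0 (tl (tl (tl w))) 0)])); auto. env.
Qed.

(** * Words and their codes *)
Local Open Scope nat_scope.

Lemma lcode_inj x y : lcode x = lcode y -> x = y.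
Proof.
  destruct x as [i [|]], y as [j [|]]; unfold lcode; simpl; intros H; try lia; f_equal; lia.
Qed.

Lemma lcode_surj n : exists x, lcode x = n.
Proof.
  destruct (Nat.Even_or_Odd n) as [[i Hi]|[i Hi]]; [exists (i, false)|exists (i, true)];
    unfold lcode; simpl; lia.
Qed.

Lemma wcode_inj u v : wcode u = wcode v -> u = v.
Proof.
  revert v. induction u as [|x u IH]; intros [|y v] H; simpl in H; try discriminate; auto.
  injection H as H. apply npair_inj in H as [H1 H2]. f_equal; auto. apply lcode_inj; auto.
Qed.

Lemma wcode_surj n : exists w, wcode w = n.
Proof.
  induction (lt_wf n) as [n _ IH]. destruct n as [|n]; [exists []; auto|].
  destruct (IH (p2 n)) as [w Hw].
  { pose proof (npair_ge_r (p1 n) (p2 n)) as H. rewrite npair_p in H. lia. }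
  destruct (lcode_surj (p1 n)) as [x Hx]. exists (x :: w). simpl. rewrite Hw, Hx, npair_p. auto.
Qed.

Definition wdec (n : nat) : word := proj1_sig (constructive_indefinite_description _ (wcode_surj n)).

Lemma wcode_wdec n : wcode (wdec n) = n.
Proof. unfold wdec. destruct (constructive_indefinite_description _ (wcode_surj n)). auto. Qed.
Lemma wdec_wcode w : wdec (wcode w) = w.
Proof. apply wcode_inj, wcode_wdec. Qed.

Ltac npair_inj :=
  repeat match goal with
  | H : npair _ _ = npair _ _ |- _ => apply npair_inj in H as [? ?]
  | H : S _ = S _ |- _ => injection H as H
  end.

Definition capp (a b : nat) : nat := wcode (wdec a ++ wdec b).

Lemma wcode_app u v : wcode (u ++ v) = capp (wcode u) (wcode v).
Proof. unfold capp. rewrite !wdec_wcode. auto. Qed.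

(** The coded triples of [u], [v] and [u ++ v] are generated from [u = []] by prepending letters to
    [u], so the graph is Sigma_1 by [clos_Sg]. The predicates on words below are treated by the same
    scheme. *)
Lemma Comp_capp m X Y : Comp m X -> Comp m Y -> Comp m (fun v => capp (X v) (Y v)).
Proof.
  intros HX HY.
  apply (Comp_Env m 2 (fun v => capp (nth 0 v 0) (nth 1 v 0)) (fun v => [X v; Y v])); [|env].
  apply graph_Comp.
  pose (B := fun c => exists b, c = npair 0 (npair b b)).
  pose (St := fun p (q : nat) c => exists x a b r, p = npair a (npair b r) /\
          c = npair (S (npair x a)) (npair b (S (npair x r)))).
  assert (HC : Sg 1 (fun v => clos B St (nth 0 v 0))) by (apply clos_Sg; unfold B, St; sg).
  assert (H : forall n, clos B St n <->
            exists u v, n = npair (wcode u) (npair (wcode v) (wcode (u ++ v)))).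
  { intros n; split.
    - intros Hn; induction Hn as [c [b ->]|p q c [x [a [b [r [-> ->]]]]] _ [u [v E]] _ _].
      + exists [], (wdec b). simpl. rewrite wcode_wdec; auto.
      + npair_inj; subst. destruct (lcode_surj x) as [y <-]. exists (y :: u), v. auto.
    - intros [u [v ->]]. induction u as [|x u IH].
      + constructor. exists (wcode v). auto.
      + apply clos_step with (2 := IH) (3 := IH).
        exists (lcode x), (wcode u), (wcode v), (wcode (u ++ v)). auto. }
  apply Sg_ext with (fun w => clos B St
    (npair (nth 0 (tl w) 0) (npair (nth 1 (tl w) 0) (nth 0 w 0)))).
  - intros w _. rewrite H. split.
    + intros [u [v E]]. npair_inj. unfold capp.
      repeat match goal with HE : nth _ _ _ = _ |- _ => rewrite HE; clear HE end.
      rewrite !wdec_wcode; auto.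
    + intros ->. exists (wdec (nth 0 (tl w) 0)), (wdec (nth 1 (tl w) 0)).
      rewrite !wcode_wdec. auto.
  - apply (Sg_Env _ 1 (fun v => clos B St (nth 0 v 0)) (fun w =>
      [npair (nth 0 (tl w) 0) (npair (nth 1 (tl w) 0) (nth 0 w 0))])); auto. env.
Qed.

Ltac comp_user ::= first [ comp_arith | apply Comp_capp; comp ].

Definition cinv (a : nat) : nat := wcode (winv (wdec a)).

Lemma wcode_inv u : wcode (winv u) = cinv (wcode u).
Proof. unfold cinv. rewrite wdec_wcode. auto. Qed.

Lemma Comp_cinv m X : Comp m X -> Comp m (fun v => cinv (X v)).
Proof.
  intros HX.
  apply (Comp_Env m 1 (fun v => cinv (nth 0 v 0)) (fun v => [X v])); [|env].
  apply graph_Comp.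
  pose (B := fun c => c = npair 0 0).
  (* The letter codes [2i] and [2i + 1] belong to mutually inverse letters; the disjunction says
     that [x] and [y] are such a pair, in either order. *)
  pose (St := fun p (q : nat) c => exists x y i a r, p = npair a r /\
          ((x = i + i /\ y = S (i + i)) \/ (y = i + i /\ x = S (i + i))) /\
          c = npair (S (npair x a)) (capp r (S (npair y 0)))).
  assert (HC : Sg 1 (fun v => clos B St (nth 0 v 0))) by (apply clos_Sg; unfold B, St; sg).
  assert (H : forall n, clos B St n <-> exists u, n = npair (wcode u) (wcode (winv u))).
  { intros n; split.
    - intros Hn; induction Hn as [c ->|p q c [x [y [i [a [r [-> [Hi ->]]]]]]] _ [u E] _ _].
      + exists []. auto.
      + npair_inj; subst.
        exists ((i, if Nat.even x then false else true) :: u). unfold winv. simpl map. simpl rev.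
        fold (winv u). rewrite wcode_app. cbn [wcode]. unfold lcode, flip; simpl.
        destruct Hi as [[-> ->]|[-> ->]].
        * replace (Nat.even (i + i)) with true by (symmetry; apply Nat.even_spec; exists i; lia).
          simpl. f_equal; [do 2 f_equal; lia|do 3 f_equal; lia].
        * rewrite Nat.even_succ.
          replace (Nat.odd (i + i)) with false
            by (symmetry; rewrite <- Nat.negb_even, Bool.negb_false_iff; apply Nat.even_spec; exists i; lia).
          simpl. f_equal; [do 2 f_equal; lia|do 3 f_equal; lia].
    - intros [u ->]. induction u as [|x u IH].
      + constructor. red. auto.
      + apply clos_step with (2 := IH) (3 := IH).
        exists (lcode x), (lcode (flip x)), (fst x), (wcode u), (wcode (winv u)).
        split; [auto|split].
        * destruct x as [i [|]]; unfold lcode, flip; simpl; lia.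
        * unfold winv. simpl map. simpl rev. fold (winv u). rewrite wcode_app. auto. }
  apply Sg_ext with (fun w => clos B St (npair (nth 0 (tl w) 0) (nth 0 w 0))).
  - intros w _. rewrite H. split.
    + intros [u E]. npair_inj. unfold cinv.
      repeat match goal with HE : nth _ _ _ = _ |- _ => rewrite HE; clear HE end.
      rewrite !wdec_wcode; auto.
    + intros ->. exists (wdec (nth 0 (tl w) 0)). unfold cinv. rewrite !wcode_wdec. auto.
  - apply (Sg_Env _ 1 (fun v => clos B St (nth 0 v 0)) (fun w =>
      [npair (nth 0 (tl w) 0) (nth 0 w 0)])); auto. env.
Qed.

Definition cpow (a n : nat) : nat := wcode (wpow (wdec a) n).

Lemma wcode_pow u n : wcode (wpow u n) = cpow (wcode u) n.
Proof. unfold cpow. rewrite wdec_wcode. auto. Qed.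

Lemma Comp_cpow m X Y : Comp m X -> Comp m Y -> Comp m (fun v => cpow (X v) (Y v)).
Proof.
  intros HX HY.
  apply Comp_ext with (fun v => nat_rect (fun _ => nat) 0 (fun n y => capp (X v) y) (Y v)).
  - intros v _. unfold cpow. induction (Y v) as [|n IH]; [reflexivity|]. simpl. rewrite IH.
    unfold capp. rewrite wdec_wcode. auto.
  - apply (Comp_prec m (fun _ => 0) (fun w => capp (X (tl (tl w))) (nth 1 w 0)) Y); comp.
Qed.

Definition ccomm (a b : nat) : nat := capp a (capp b (capp (cinv a) (cinv b))).

Lemma wcode_comm u v : wcode (comm u v) = ccomm (wcode u) (wcode v).
Proof. unfold comm, ccomm. rewrite !wcode_app, !wcode_inv. auto. Qed.

Ltac comp_user ::=
  first [ comp_arith | apply Comp_capp; comp | apply Comp_cinv; comp | apply Comp_cpow; comp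
        | unfold ccomm; apply Comp_capp; comp ].

Lemma Sg_over k : Sg 1 (fun v => over k (wdec (nth 0 v 0))).
Proof.
  pose (B := fun c => c = 0).
  (* A letter has code below [2k] exactly when its generator has index below [k]. *)
  pose (St := fun p (q : nat) c => exists x, x < k + k /\ c = S (npair x p)).
  assert (HC : Sg 1 (fun v => clos B St (nth 0 v 0))) by (apply clos_Sg; unfold B, St; sg).
  refine (Sg_ext _ _ _ _ HC). intros v _.
  assert (H : forall n, clos B St n <-> exists u, n = wcode u /\ over k u).
  { intros n; split.
    - intros Hn; induction Hn as [c ->|p q c [x [Hx ->]] _ [u [-> Hu]] _ _].
      + exists []. split; auto. constructor.
      + destruct (lcode_surj x) as [y <-]. exists (y :: u). split; auto. constructor; auto.
        unfold lcode in Hx. destruct (snd y); lia.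
    - intros [u [-> Hu]]. induction Hu as [|x u Hx Hu IH].
      + constructor. red. auto.
      + apply clos_step with (2 := IH) (3 := IH).
        exists (lcode x). split; auto. unfold lcode. destruct (snd x); lia. }
  rewrite H. split.
  - intros [u [-> Hu]]. rewrite wdec_wcode; auto.
  - intros Hu. exists (wdec (nth 0 v 0)). rewrite wcode_wdec; auto.
Qed.

Definition comm_prod (ps : list (word * word)) : word := flat_map (fun p => comm (fst p) (snd p)) ps.
Definition pairs_over (k : nat) (ps : list (word * word)) : Prop :=
  Forall (fun p => over k (fst p) /\ over k (snd p)) ps.

Lemma Sg_comm_prod k : Sg 2 (fun v => exists ps, length ps = nth 0 v 0 /\ pairs_over k ps /\
  wdec (nth 1 v 0) = comm_prod ps).
Proof.
  pose proof (Sg_over k) as HO.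
  pose (B := fun c => c = npair 0 0).
  pose (St := fun p (q : nat) c => exists m u x y, over k (wdec x) /\ over k (wdec y) /\
     p = npair m u /\ c = npair (S m) (capp (ccomm x y) u)).
  assert (HC : Sg 1 (fun v => clos B St (nth 0 v 0))).
  { apply clos_Sg; unfold B, St; [sg|].
    apply Sg_ex, Sg_ex, Sg_ex, Sg_ex, Sg_and; [|apply Sg_and; [|sg]]; cbv beta.
    - apply (Sg_Env _ 1 _ (fun w => [nth 0 (tl w) 0]) HO). env.
    - apply (Sg_Env _ 1 _ (fun w => [nth 0 w 0]) HO). env. }
  assert (H : forall n, clos B St n <->
     exists ps, pairs_over k ps /\ n = npair (length ps) (wcode (comm_prod ps))).
  { intros n; split.
    - intros Hn; induction Hn as [c ->|p q c [m [u [x [y [Hx [Hy [-> ->]]]]]]] _ [ps [Hps E]] _ _].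
      + exists []. split; auto. constructor.
      + npair_inj; subst. exists ((wdec x, wdec y) :: ps). split; [constructor; auto|].
        simpl. rewrite wcode_app, wcode_comm, !wcode_wdec. auto.
    - intros [ps [Hps ->]]. induction Hps as [|[x y] ps [Hx Hy] Hps IH].
      + constructor. red. auto.
      + apply clos_step with (2 := IH) (3 := IH).
        exists (length ps), (wcode (comm_prod ps)), (wcode x), (wcode y).
        rewrite !wdec_wcode. split; [|split]; auto. split; auto. simpl.
        rewrite wcode_app, wcode_comm. auto. }
  apply Sg_ext with (fun v => clos B St (npair (nth 0 v 0) (nth 1 v 0))).
  - intros v _. rewrite H. split.
    + intros [ps [Hps E]]. npair_inj. exists ps. split; [|split]; auto.
      rewrite <- (wdec_wcode (comm_prod ps)). f_equal; auto.
    + intros [ps [E1 [Hps E2]]]. exists ps. split; auto. rewrite <- E1, <- E2, wcode_wdec. auto.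
  - apply (Sg_Env _ 1 _ (fun w => [npair (nth 0 w 0) (nth 1 w 0)]) HC). env.
Qed.

(** The word problem of a recursive presentation is semi-decidable: reflexivity, free cancellation
    and relators are the axioms; symmetry, transitivity and context are the rules. *)
Lemma Sg_eqG Rl : RE (fun c => exists r, Rl r /\ c = wcode r) ->
  Sg 2 (fun v => eqG Rl (wdec (nth 0 v 0)) (wdec (nth 1 v 0))).
Proof.
  intros HR. apply RE_Sg in HR.
  pose (B := fun c => (exists u, c = npair u u) \/
     (exists x y i, ((x = i + i /\ y = S (i + i)) \/ (y = i + i /\ x = S (i + i))) /\
        c = npair (S (npair x (S (npair y 0)))) 0) \/
     (exists r, (exists r', Rl r' /\ r = wcode r') /\ c = npair r 0)).
  pose (St := fun p q c =>
     (exists u v, p = npair u v /\ c = npair v u) \/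
     (exists u v w, p = npair u v /\ q = npair v w /\ c = npair u w) \/
     (exists a b u v, p = npair u v /\ c = npair (capp a (capp u b)) (capp a (capp v b)))).
  assert (HC : Sg 1 (fun v => clos B St (nth 0 v 0))).
  { apply clos_Sg; unfold B, St; [|sg].
    apply Sg_or; [sg|apply Sg_or; [sg|]]. apply Sg_ex, Sg_and; [|sg]. cbv beta.
    apply (Sg_Env _ 1 _ (fun w => [nth 0 w 0]) HR). env. }
  assert (H : forall n, clos B St n <->
     exists u v, eqG Rl u v /\ n = npair (wcode u) (wcode v)).
  { intros n; split.
    - intros Hn; induction Hn as [c Hc|p q c Hc Hp IHp Hq IHq].
      + destruct Hc as [[u ->]|[[x [y [i [Hi ->]]]]|[r [[r' [Hr ->]] ->]]]].
        * exists (wdec u), (wdec u). rewrite wcode_wdec. split; auto. apply eqG_refl.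
        * exists [(i, if Nat.even x then false else true); flip (i, if Nat.even x then false else true)], [].
          split; [apply eqG_free|]. simpl. unfold lcode, flip; simpl.
          destruct Hi as [[-> ->]|[-> ->]].
          -- replace (Nat.even (i + i)) with true by (symmetry; apply Nat.even_spec; exists i; lia).
             simpl. f_equal. f_equal. f_equal; [lia|]. do 2 f_equal. lia.
          -- rewrite Nat.even_succ.
             replace (Nat.odd (i + i)) with false
               by (symmetry; rewrite <- Nat.negb_even, Bool.negb_false_iff; apply Nat.even_spec; exists i; lia).
             simpl. f_equal. f_equal. f_equal; [lia|]. do 2 f_equal. lia.
        * exists r', []. split; auto. apply eqG_rel; auto.
      + destruct IHp as [s [t [Hst ->]]], IHq as [s' [t' [Hst' ->]]].
        destruct Hc as [[u [v [E ->]]]|[[u [v [w [E [E' ->]]]]]|[a [b [u [v [E ->]]]]]]];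
          npair_inj; subst.
        * exists t, s. split; auto. apply eqG_sym; auto.
        * match goal with HE : wcode _ = wcode _ |- _ => apply wcode_inj in HE; subst end.
          exists s, t'. split; auto. eapply eqG_trans; eauto.
        * exists (wdec a ++ s ++ wdec b), (wdec a ++ t ++ wdec b).
          rewrite !wcode_app, !wcode_wdec. split; auto. apply eqG_ctx; auto.
    - intros [u [v [Huv ->]]].
      induction Huv as [w|u v _ IH|u v w _ IH1 _ IH2|a b u v _ IH|x|r Hr].
      + constructor. left. eauto.
      + apply clos_step with (2 := IH) (3 := IH). left. eauto.
      + apply clos_step with (2 := IH1) (3 := IH2). right. left. repeat eexists.
      + apply clos_step with (2 := IH) (3 := IH). right. right.
        exists (wcode a), (wcode b), (wcode u), (wcode v). rewrite !wcode_app. auto.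
      + constructor. right. left. exists (lcode x), (lcode (flip x)), (fst x). split; auto.
        destruct x as [i [|]]; unfold lcode, flip; simpl; lia.
      + constructor. right. right. exists (wcode r). eauto. }
  apply Sg_ext with (fun v => clos B St (npair (nth 0 v 0) (nth 1 v 0))).
  - intros v _. rewrite H. split.
    + intros [s [t [Hst E]]]. npair_inj.
      repeat match goal with HE : nth _ _ _ = _ |- _ => rewrite HE; clear HE end.
      rewrite !wdec_wcode; auto.
    + intros Hst. do 2 eexists. split; [exact Hst|]. rewrite !wcode_wdec. auto.
  - apply (Sg_Env _ 1 _ (fun w => [npair (nth 0 w 0) (nth 1 w 0)]) HC). env.
Qed.

(** Search at once for a product of commutators and for a derivation that it equals the power of
    [w]. *)
Lemma Sg_cl_le k Rl w : RE (fun c => exists r, Rl r /\ c = wcode r) ->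
  Sg 2 (fun v => cl_le k Rl (wpow w (nth 0 v 0)) (nth 1 v 0)).
Proof.
  intros HR. pose proof (Sg_eqG Rl HR) as HE. pose proof (Sg_comm_prod k) as HP.
  apply Sg_ext with (fun v => exists u, (exists ps, length ps = nth 1 v 0 /\ pairs_over k ps /\
    wdec u = comm_prod ps) /\ eqG Rl (wdec (cpow (wcode w) (nth 0 v 0))) (wdec u)).
  - intros v _. unfold cpow. rewrite !wdec_wcode. split.
    + intros [u [[ps [H1 [H2 H3]]] H4]]. exists ps. rewrite H3 in H4. auto.
    + intros [ps [H1 [H2 H3]]]. exists (wcode (comm_prod ps)). rewrite wdec_wcode.
      split; auto. exists ps. auto.
  - apply Sg_ex, Sg_and; cbv beta.
    + apply (Sg_Env _ 2 _ (fun w => [nth 1 (tl w) 0; nth 0 w 0]) HP). env.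
    + apply (Sg_Env _ 2 _ (fun u => [cpow (wcode w) (nth 0 (tl u) 0); nth 0 u 0]) HE). env.
Qed.

(** * Commutator length in presented groups *)
Local Open Scope nat_scope.

Global Instance eqG_equiv Rl : Equivalence (eqG Rl).
Proof.
  split; [exact (eqG_refl Rl)|exact (eqG_sym Rl)|exact (eqG_trans Rl)].
Qed.

Global Instance eqG_app Rl : Proper (eqG Rl ==> eqG Rl ==> eqG Rl) (@app letter).
Proof.
  intros u u' Hu v v' Hv. transitivity (u' ++ v).
  - apply (eqG_ctx Rl [] v u u' Hu).
  - pose proof (eqG_ctx Rl u' [] v v' Hv) as H. rewrite !app_nil_r in H. exact H.
Qed.

Lemma flip_flip x : flip (flip x) = x.
Proof. destruct x as [i b]. unfold flip; simpl. rewrite Bool.negb_involutive. auto. Qed.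

Lemma winv_app u v : winv (u ++ v) = winv v ++ winv u.
Proof. unfold winv. rewrite map_app, rev_app_distr. auto. Qed.
Lemma winv_winv u : winv (winv u) = u.
Proof.
  unfold winv. rewrite map_rev, rev_involutive, map_map.
  rewrite map_ext with (g := fun x => x); [apply map_id|apply flip_flip].
Qed.

Lemma eqG_mul_inv Rl w : eqG Rl (w ++ winv w) [].
Proof.
  induction w as [|x w IH]; [apply eqG_refl|].
  change (x :: w) with ([x] ++ w). rewrite winv_app, <- app_assoc, (app_assoc w), IH.
  apply eqG_free.
Qed.
Lemma eqG_inv_mul Rl w : eqG Rl (winv w ++ w) [].
Proof. rewrite <- (winv_winv w) at 2. apply eqG_mul_inv. Qed.
Lemma eqG_cancel Rl w r : eqG Rl (w ++ winv w ++ r) r.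
Proof. rewrite app_assoc, eqG_mul_inv. apply eqG_refl. Qed.
Lemma eqG_cancel' Rl w r : eqG Rl (winv w ++ w ++ r) r.
Proof. rewrite app_assoc, eqG_inv_mul. apply eqG_refl. Qed.

Ltac grp :=
  unfold comm;
  repeat first [ rewrite winv_app | rewrite winv_winv | rewrite <- app_assoc
               | rewrite eqG_cancel | rewrite eqG_cancel' | rewrite eqG_mul_inv
               | rewrite eqG_inv_mul | rewrite app_nil_r ];
  simpl app; try reflexivity.

Lemma eqG_quot Rl u v : eqG Rl (u ++ winv v) [] <-> eqG Rl u v.
Proof.
  split; intros H.
  - rewrite <- (app_nil_r u), <- (eqG_inv_mul Rl v), app_assoc, H. reflexivity.
  - rewrite H. apply eqG_mul_inv.
Qed.

Lemma wpow_S w n : wpow w (S n) = w ++ wpow w n.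
Proof. reflexivity. Qed.
Lemma wpow_add w n m : wpow w (n + m) = wpow w n ++ wpow w m.
Proof. unfold wpow. rewrite repeat_app, concat_app. auto. Qed.
Lemma wpow_mul w n m : wpow w (n * m) = wpow (wpow w n) m.
Proof.
  induction m; [rewrite Nat.mul_0_r; auto|].
  rewrite Nat.mul_succ_r, Nat.add_comm, wpow_add, IHm. auto.
Qed.
Lemma wpow_S_r w n : wpow w (S n) = wpow w n ++ w.
Proof. rewrite <- Nat.add_1_r, wpow_add. simpl. unfold wpow at 2. simpl. rewrite app_nil_r. auto. Qed.
Global Instance eqG_wpow Rl : Proper (eqG Rl ==> eq ==> eqG Rl) wpow.
Proof.
  intros u v H n m <-. induction n; [reflexivity|]. rewrite !wpow_S. apply eqG_app; auto.
Qed.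

Lemma over_app k u v : over k u -> over k v -> over k (u ++ v).
Proof. intros. apply Forall_app; auto. Qed.
Lemma over_winv k u : over k u -> over k (winv u).
Proof.
  unfold over, winv. rewrite !Forall_forall. intros H x Hx. apply in_rev in Hx.
  apply in_map_iff in Hx as [y [<- Hy]]. apply (H y Hy).
Qed.
Lemma over_comm k u v : over k u -> over k v -> over k (comm u v).
Proof. unfold comm. auto 10 using over_app, over_winv. Qed.
Lemma over_wpow k u n : over k u -> over k (wpow u n).
Proof. intros Hu. induction n; [constructor|]. rewrite wpow_S. apply over_app; auto. Qed.

Section CommutatorLength.
Variables (k : nat) (Rl : word -> Prop).
Notation "u == v" := (eqG Rl u v) (at level 70).
Notation cl_le := (cl_le k Rl).

Global Instance cl_le_proper : Proper (eqG Rl ==> eq ==> iff) cl_le.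
Proof.
  intros u v H n m <-. split; intros [ps [H1 [H2 H3]]]; exists ps; repeat split; auto.
  - rewrite <- H; auto.
  - rewrite H; auto.
Qed.

Lemma cl_le_0 : cl_le [] 0.
Proof. exists []. repeat split; [constructor|reflexivity]. Qed.
Lemma cl_le_comm x y : over k x -> over k y -> cl_le (comm x y) 1.
Proof.
  intros. exists [(x, y)]. repeat split; [constructor; auto|]. simpl. rewrite app_nil_r. reflexivity.
Qed.
Lemma cl_le_app u v n m : cl_le u n -> cl_le v m -> cl_le (u ++ v) (n + m).
Proof.
  intros [ps [H1 [H2 H3]]] [qs [H4 [H5 H6]]]. exists (ps ++ qs).
  rewrite length_app, flat_map_app. repeat split; [lia|apply Forall_app; auto|].
  rewrite H3, H6. reflexivity.
Qed.
Lemma cl_le_wpow u n j : cl_le u n -> cl_le (wpow u j) (j * n).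
Proof. intros H. induction j; [apply cl_le_0|]. rewrite wpow_S. apply cl_le_app; auto. Qed.
Lemma conj_comm p x y : p ++ comm x y ++ winv p == comm (p ++ x ++ winv p) (p ++ y ++ winv p).
Proof. grp. Qed.
Lemma cl_le_conj p u n : over k p -> cl_le u n -> cl_le (p ++ u ++ winv p) n.
Proof.
  intros Hp [ps [H1 [H2 H3]]].
  exists (map (fun q => (p ++ fst q ++ winv p, p ++ snd q ++ winv p)) ps).
  rewrite length_map. repeat split; auto.
  - apply Forall_forall. intros q Hq. apply in_map_iff in Hq as [r [<- Hr]]. simpl.
    apply (proj1 (Forall_forall _ _) H2) in Hr as [Hr1 Hr2].
    split; auto 10 using over_app, over_winv.
  - rewrite H3. clear -p. induction ps as [|[x y] ps IH]; simpl.
    + rewrite eqG_mul_inv. reflexivity.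
    + rewrite <- IH, <- (conj_comm p x y). grp.
Qed.

(** A nonempty set of naturals attains its infimum, so the real number [cl] is a genuine minimum. *)
Lemma cl_spec w : in_commutator k Rl w ->
  exists n, cl k Rl w = INR n /\ cl_le w n /\ forall m, cl_le w m -> n <= m.
Proof.
  intros [n0 H0].
  assert (exists n, cl_le w n /\ forall m, cl_le w m -> n <= m) as [n [Hn Hm]].
  { revert H0. induction (lt_wf n0) as [n0 _ IH]. intros H0.
    destruct (classic (exists x, x < n0 /\ cl_le w x)) as [[x [Hx1 Hx2]]|Hno].
    - apply (IH x); auto.
    - exists n0. split; auto. intros m Hm. apply Nat.nlt_ge. intros Hlt. apply Hno; eauto. }
  exists n. repeat split; auto. unfold cl.
  replace (Glb_Rbar (fun x : R => exists n : nat, x = INR n /\ Defs.cl_le k Rl w n)) with (Finite (INR n)); auto.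
  symmetry. apply is_glb_Rbar_unique. split.
  - intros x [m [-> H]]. simpl. apply le_INR; auto.
  - intros b Hb. apply (Hb (INR n)). exists n; auto.
Qed.

Lemma cl_upper w n : cl_le w n -> (cl k Rl w <= INR n)%R.
Proof.
  intros H. destruct (cl_spec w) as [m [-> [_ Hm]]]; [exists n; auto|]. apply le_INR; auto.
Qed.

Section Scl.
Variables (w : word) (alpha : R).
Hypothesis Hscl : scl_is k Rl w alpha.

(** Along exponents divisible by [n], repeating the given product of commutators keeps the quotient
    at most [m/n], and the limit may be taken along this subsequence. *)
Lemma scl_le_quot n m : (1 <= n)%nat -> cl_le (wpow w n) m -> (alpha <= INR m / INR n)%R.
Proof.
  intros Hn Hm. destruct Hscl as [N [HN [_ Hlim]]].
  (* The term of index [j] in [scl_is] has exponent [N * S j], hence the subtraction of 1. *)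
  pose (phi := fun j => n * S j - 1).
  assert (Hphi : forall j, S (phi j) = n * S j) by (intros; unfold phi; nia).
  apply is_lim_seq_subseq with (phi := phi) in Hlim.
  2:{ apply eventually_subseq. intros j. specialize (Hphi j) as H1. pose proof (Hphi (S j)). nia. }
  refine (is_lim_seq_le _ _ alpha (Finite (INR m / INR n)) _ Hlim (is_lim_seq_const _)).
  intros j. cbv beta. rewrite Hphi.
  assert (H : cl_le (wpow w (N * (n * S j))) (N * S j * m)).
  { replace (N * (n * S j)) with (n * (N * S j)) by lia. rewrite wpow_mul. apply cl_le_wpow; auto. }
  apply cl_upper in H. rewrite !mult_INR in *.
  assert (0 < INR N)%R by (apply lt_0_INR; lia). assert (0 < INR n)%R by (apply lt_0_INR; lia).
  assert (0 < INR (S j))%R by (apply lt_0_INR; lia).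
  assert (0 < INR N * (INR n * INR (S j)))%R by auto using Rmult_lt_0_compat.
  apply Rmult_le_reg_r with (INR N * (INR n * INR (S j)))%R; auto.
  unfold Rdiv. rewrite Rmult_assoc, Rinv_l by lra.
  apply Rle_trans with (1 := Req_le _ _ (Rmult_1_r _)), Rle_trans with (1 := H).
  apply Req_le. field. lra.
Qed.

Lemma scl_approx r : (alpha < r)%R ->
  exists n m, 1 <= n /\ cl_le (wpow w n) m /\ (INR m / INR n < r)%R.
Proof.
  intros Hr. destruct Hscl as [N [HN [Hin Hlim]]].
  apply is_lim_seq_spec in Hlim. specialize (Hlim (mkposreal (r - alpha) ltac:(lra))) as [M HM].
  specialize (HM M (Nat.le_refl _)). simpl in HM.
  destruct (cl_spec (wpow w (N * S M))) as [m [E [H1 _]]].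
  { destruct Hin as [m Hm]. exists (S M * m). rewrite wpow_mul. apply cl_le_wpow; auto. }
  exists (N * S M), m. split; [nia|split]; auto.
  rewrite E in HM. apply Rabs_def2 in HM. simpl in *. lra.
Qed.

Lemma scl_nonneg : (0 <= alpha)%R.
Proof.
  destruct (Rle_lt_dec 0 alpha) as [H|H]; auto. exfalso.
  destruct (scl_approx 0 H) as [n [m [Hn [_ Hm]]]].
  assert (0 < INR n)%R by (apply lt_0_INR; lia). pose proof (pos_INR m).
  pose proof (Rdiv_le_0_compat (INR m) (INR n)). lra.
Qed.
End Scl.
End CommutatorLength.

Definition UC (alpha : R) (p q : nat) : Prop := 0 < q /\ (alpha < INR p / INR q)%R.

Lemma zcode_of_nat n : zcode (Z.of_nat n) = 2 * n.
Proof. destruct n; auto. simpl zcode. rewrite SuccNat2Pos.id_succ. auto. Qed.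

(** A fraction above a non-negative number has a positive numerator, so natural numerators suffice;
    [p + p] is the [zcode] of such a numerator. *)
Lemma upper_cut_UC alpha c : (0 <= alpha)%R ->
  upper_cut alpha c <-> exists p q, c = npair (p + p) q /\ UC alpha p q.
Proof.
  intros Ha. split.
  - intros [z [d [-> [Hd H]]]]. exists (Z.to_nat z), d. unfold UC.
    assert (0 < IZR z)%R.
    { destruct (Rle_lt_dec (IZR z) 0) as [Hz|Hz]; auto. exfalso.
      assert (0 < INR d)%R by (apply lt_0_INR; lia).
      assert (IZR z / INR d <= 0)%R; [|lra].
      apply Rmult_le_reg_r with (INR d); auto. unfold Rdiv.
      rewrite Rmult_assoc, Rinv_l; lra. }
    apply lt_IZR in H0. rewrite INR_IZR_INZ, Z2Nat.id by lia. repeat split; auto.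
    unfold qcode. f_equal. rewrite <- (Z2Nat.id z) at 1 by lia. rewrite zcode_of_nat. lia.
  - intros [p [q [-> [Hq H]]]]. exists (Z.of_nat p), q. rewrite <- INR_IZR_INZ.
    repeat split; auto. unfold qcode. rewrite zcode_of_nat. f_equal. lia.
Qed.

Lemma right_computable_UC alpha : (0 <= alpha)%R ->
  right_computable alpha <-> Sg 2 (fun v => UC alpha (nth 0 v 0) (nth 1 v 0)).
Proof.
  intros Ha. unfold right_computable. rewrite RE_Sg. split; intros H.
  - apply Sg_ext with (fun v => upper_cut alpha (npair (nth 0 v 0 + nth 0 v 0) (nth 1 v 0))).
    + intros v _. rewrite upper_cut_UC by auto. split.
      * intros [p [q [E Hpq]]]. apply npair_inj in E as [E1 E2].
        replace (nth 0 v 0) with p by lia. rewrite E2. auto.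
      * intros; eauto.
    + apply (Sg_Env _ 1 _ (fun v => [npair (nth 0 v 0 + nth 0 v 0) (nth 1 v 0)]) H). env.
  - apply Sg_ext with (fun v => exists p q, nth 0 v 0 = npair (p + p) q /\ UC alpha p q).
    + intros v _. rewrite upper_cut_UC by auto. reflexivity.
    + apply Sg_ex, Sg_ex, Sg_and; [sg|]. cbv beta.
      apply (Sg_Env _ 2 _ (fun v => [nth 0 (tl v) 0; nth 0 v 0]) H). env.
Qed.

Lemma quot_lt m n p q : 0 < n -> 0 < q -> (INR m / INR n < INR p / INR q)%R <-> m * q < p * n.
Proof.
  intros Hn Hq. apply lt_0_INR in Hn, Hq.
  assert (E1 : (INR m / INR n = INR (m * q) / (INR n * INR q))%R)
    by (rewrite mult_INR; field; lra).
  assert (E2 : (INR p / INR q = INR (p * n) / (INR n * INR q))%R)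
    by (rewrite mult_INR; field; lra).
  assert (H : (0 < / (INR n * INR q))%R) by (apply Rinv_0_lt_compat, Rmult_lt_0_compat; auto).
  rewrite E1, E2. unfold Rdiv. split; intros HH.
  - apply INR_lt. apply Rmult_lt_reg_r in HH; auto.
  - apply Rmult_lt_compat_r; auto. apply lt_INR; auto.
Qed.

Lemma SCLrp_right_computable alpha : SCLrp alpha -> (0 <= alpha)%R /\ right_computable alpha.
Proof.
  intros [k [Rl [w [[_ HR] [_ Hscl]]]]].
  assert (Ha := scl_nonneg _ _ _ _ Hscl). split; auto.
  apply right_computable_UC; auto.
  apply Sg_ext with (fun v => 0 < nth 1 v 0 /\ exists n m, 0 < n /\ m * nth 1 v 0 < nth 0 v 0 * n /\
     cl_le k Rl (wpow w n) m).
  - intros v _. unfold UC. split.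
    + intros [Hq [n [m [Hn [Hlt Hm]]]]]. split; auto.
      apply Rle_lt_trans with (INR m / INR n)%R; [eapply scl_le_quot; eauto|].
      apply quot_lt; auto.
    + intros [Hq H]. split; auto. apply (scl_approx _ _ _ _ Hscl) in H as [n [m [Hn [Hm H]]]].
      exists n, m. repeat split; auto. apply quot_lt in H; auto.
  - pose proof (Sg_cl_le k Rl w HR) as H.
    apply Sg_and; [sg|]. apply Sg_ex, Sg_ex, Sg_and; [sg|apply Sg_and; [sg|]]. cbv beta.
    apply (Sg_Env _ 2 _ (fun v => [nth 0 (tl v) 0; nth 0 v 0]) H). env.
Qed.

(** * Powers of commutators *)
Local Open Scope nat_scope.

Section CommutatorPowers.
Variables (k : nat) (Rl : word -> Prop).
Notation cl_le := (cl_le k Rl).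

(** Read [cl_le (u ++ winv v) a] as: [u] and [v] are at commutator distance at most [a]. This is the
    triangle inequality, and [cl_diff_ctx] is the invariance under multiplication on both sides. *)
Lemma cl_diff_trans u v w a b :
  cl_le (u ++ winv v) a -> cl_le (v ++ winv w) b -> cl_le (u ++ winv w) (a + b).
Proof.
  intros H1 H2. pose proof (cl_le_app _ _ _ _ _ _ H1 H2) as H.
  rewrite <- app_assoc, eqG_cancel' in H. exact H.
Qed.

Lemma cl_diff_ctx p q u v a : over k p ->
  cl_le (u ++ winv v) a -> cl_le ((p ++ u ++ q) ++ winv (p ++ v ++ q)) a.
Proof.
  intros Hp H. apply (cl_le_conj _ _ p) in H; auto.
  assert (E : eqG Rl ((p ++ u ++ q) ++ winv (p ++ v ++ q)) (p ++ (u ++ winv v) ++ winv p)) by grp.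
  rewrite E. exact H.
Qed.

(** The commutator of [a b] and [c a^-1] reduces freely to [a b c (c b a)^-1]. *)
Lemma cl_reverse3 a b c : over k a -> over k b -> over k c ->
  cl_le ((a ++ b ++ c) ++ winv (c ++ b ++ a)) 1.
Proof.
  intros Ha Hb Hc.
  assert (E : eqG Rl ((a ++ b ++ c) ++ winv (c ++ b ++ a)) (comm (a ++ b) (c ++ winv a))) by grp.
  rewrite E. apply cl_le_comm; auto using over_app, over_winv.
Qed.

(** Odd exponents, since exponent 1 costs nothing and every two further factors [x y] cost one
    exchange. *)
Lemma cl_wpow_app x y j : over k x -> over k y ->
  cl_le (wpow (x ++ y) (2 * j + 1) ++ winv (wpow x (2 * j + 1) ++ wpow y (2 * j + 1))) j.
Proof.
  intros Hx Hy. induction j as [|j IH].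
  - simpl. unfold wpow. simpl. rewrite !app_nil_r, eqG_mul_inv. apply cl_le_0.
  - replace (2 * S j + 1) with (S (S (2 * j + 1))) by lia.
    set (n := 2 * j + 1) in *. clearbody n.
    replace (S j) with (j + 1) by lia.
    apply cl_diff_trans with ((wpow x n ++ wpow y n) ++ (x ++ y) ++ (x ++ y)).
    + apply (cl_diff_ctx [] ((x ++ y) ++ (x ++ y))) in IH; [|constructor].
      rewrite !(wpow_S_r (x ++ y)). simpl in IH. rewrite <- !app_assoc in *. exact IH.
    + (* [y^n (xy) x -> x (xy) y^n] *)
      pose proof (cl_reverse3 (wpow y n) (x ++ y) x) as H.
      apply (cl_diff_ctx (wpow x n) y) in H; auto using over_app, over_wpow.
      rewrite (wpow_S_r x), (wpow_S_r x), (wpow_S y), (wpow_S_r y).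
      rewrite <- !app_assoc in *. exact H.
Qed.

(** With [y = b a^-1 b^-1], the product [a^n y^n] is the single commutator of [a^n] and [b]; an even
    exponent costs one commutator more. The additive constant vanishes in the limit, so a generous
    one is taken. *)
Lemma cl_comm_wpow a b n : over k a -> over k b ->
  exists m, cl_le (wpow (comm a b) n) m /\ 2 * m <= n + 4.
Proof.
  intros Ha Hb.
  assert (Hodd : forall j, cl_le (wpow (comm a b) (2 * j + 1)) (j + 1)).
  { intros j. set (y := b ++ winv a ++ winv b).
    assert (Hy : over k y) by (unfold y; auto using over_app, over_winv).
    pose proof (cl_wpow_app a y j Ha Hy) as H.
    assert (E : forall n, eqG Rl (wpow y n) (b ++ winv (wpow a n) ++ winv b)).
    { clear -y. intros n. induction n as [|n IH].
      - simpl. rewrite eqG_mul_inv. reflexivity.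
      - rewrite wpow_S, IH. unfold y. rewrite (wpow_S_r a). grp. }
    replace (comm a b) with (a ++ y) by reflexivity.
    set (n' := 2 * j + 1) in *. clearbody n'.
    assert (E' : eqG Rl (wpow (a ++ y) n')
      ((wpow (a ++ y) n' ++ winv (wpow a n' ++ wpow y n')) ++ comm (wpow a n') b)).
    { unfold comm. rewrite <- (E n').
      rewrite <- app_assoc, eqG_inv_mul, app_nil_r. reflexivity. }
    rewrite E'. apply cl_le_app; auto. apply cl_le_comm; auto using over_wpow. }
  destruct (Nat.Even_or_Odd n) as [[j ->]|[j ->]].
  - destruct j as [|j].
    + exists 0. split; [apply cl_le_0|lia].
    + exists (j + 1 + 1). split; [|lia].
      replace (2 * S j) with (S (2 * j + 1)) by lia. rewrite wpow_S_r.
      apply cl_le_app; auto. apply cl_le_comm; auto.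
  - exists (j + 1). split; [auto|lia].
Qed.
End CommutatorPowers.

Lemma rational_between (x y : R) : (0 <= x)%R -> (x < y)%R ->
  exists p q, 0 < q /\ (x < INR p / INR q < y)%R.
Proof.
  intros Hx Hxy.
  destruct (archimed_cor1 (y - x)) as [q [Hq1 Hq2]]; [lra|].
  assert (Hq : (0 < INR q)%R) by (apply lt_0_INR; lia).
  destruct (nfloor_ex (x * INR q)) as [p [Hp1 Hp2]]; [apply Rmult_le_pos; lra|].
  exists (S p), q. split; auto. rewrite S_INR. split.
  - apply Rmult_lt_reg_r with (INR q); auto.
    replace ((INR p + 1) / INR q * INR q)%R with (INR p + 1)%R by (field; lra). lra.
  - apply Rle_lt_trans with (x + / INR q)%R; [|lra].
    apply Rmult_le_reg_r with (INR q); auto.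
    replace ((INR p + 1) / INR q * INR q)%R with (INR p + 1)%R by (field; lra).
    replace ((x + / INR q) * INR q)%R with (x * INR q + 1)%R by (field; lra). lra.
Qed.

(** Convergence is part of the claim. The lower bound holds at every exponent. The upper bound is
    known at multiples of [q] only, so the exponent is divided by [q] and the remainder is paid for
    by a bounded number of commutators. *)
Lemma scl_is_intro k Rl w alpha : (0 <= alpha)%R ->
  (forall n m, cl_le k Rl (wpow w n) m -> (INR n * alpha <= INR m)%R) ->
  (forall p q, UC (2 * alpha) p q -> forall j,
     exists m, cl_le k Rl (wpow w (q * j)) m /\ 2 * m <= p * j + 4) ->
  scl_is k Rl w alpha.
Proof.
  intros Ha Hlow Hup.
  (* One fixed fraction [p0/N] puts the power [N] into the commutator subgroup and later bounds the
     cost of remainders. *)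
  destruct (rational_between (2 * alpha) (2 * alpha + 1)) as [p0 [N [HN [H0 _]]]]; [lra|lra|].
  exists N. split; [lia|].
  assert (Hin : forall n, exists m, cl_le k Rl (wpow w (N * n)) m /\ 2 * m <= p0 * n + 4).
  { intros n. apply Hup. split; auto. }
  split.
  { destruct (Hin 1) as [m [Hm _]]. exists m. rewrite Nat.mul_1_r in Hm. exact Hm. }
  apply is_lim_seq_spec. intros eps. simpl.
  destruct (rational_between (2 * alpha) (2 * alpha + eps)) as [p [q [Hq [H1 H2]]]];
    [lra|destruct eps; simpl; lra|].
  (* Beyond [M] the constant [4 + p0 q] is less than [eps/2] times the exponent; the other [eps/2]
     comes from [p/q], which exceeds [2 alpha] by less than [eps]. *)
  destruct (nfloor_ex (2 * (4 + INR p0 * INR q) / eps)) as [M [_ HM]].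
  { pose proof (pos_INR p0). pose proof (pos_INR q). apply Rdiv_le_0_compat; [nra|apply cond_pos]. }
  exists M. intros n Hn.
  destruct (Hin (S n)) as [m1 [Hm1 _]].
  destruct (cl_spec k Rl (wpow w (N * S n))) as [m [E [Hm Hmin]]]; [exists m1; auto|].
  rewrite E. clear m1 Hm1.
  assert (HM0 : (0 < INR (N * S n))%R) by (apply lt_0_INR; lia).
  apply Hlow in Hm.
  assert (Hupper : (INR m <= INR (N * S n) * (INR p / INR q / 2) + 4 + INR p0 * INR q)%R).
  { pose proof (Nat.div_mod (S n) q ltac:(lia)) as Hdiv.
    pose proof (Nat.mod_upper_bound (S n) q ltac:(lia)) as Hr.
    set (j := S n / q) in *. set (r := S n mod q) in *.
    destruct (Hup p q (conj Hq H1) (N * j)) as [m1 [Hm1 Hb1]].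
    destruct (Hin r) as [m2 [Hm2 Hb2]].
    assert (Hle : m <= m1 + m2).
    { apply Hmin. rewrite Hdiv. replace (N * (q * j + r)) with (q * (N * j) + N * r) by lia.
      rewrite wpow_add. apply cl_le_app; auto. }
    apply le_INR in Hle, Hb1, Hb2. rewrite !plus_INR, !mult_INR in *. simpl (INR 2) in *. simpl (INR 4) in *.
    assert (Hr' : (INR r <= INR q)%R) by (apply le_INR; lia).
    rewrite Hdiv, plus_INR, mult_INR.
    assert (Hq' : (0 < INR q)%R) by (apply lt_0_INR; lia).
    replace (INR N * (INR q * INR j + INR r) * (INR p / INR q / 2))%R
      with (INR p * (INR N * INR j) / 2 + INR N * INR r * (INR p / INR q) / 2)%R by (field; lra).
    assert (0 <= INR N * INR r * (INR p / INR q))%R.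
    { pose proof (pos_INR N). pose proof (pos_INR r). pose proof (pos_INR p).
      apply Rmult_le_pos; [nra|]. apply Rdiv_le_0_compat; auto. }
    pose proof (pos_INR p0). pose proof (pos_INR q).
    assert (INR p0 * INR r <= INR p0 * INR q)%R by nra.
    assert (0 <= INR p0 * INR q)%R by nra. lra. }
  assert (Hbig : (4 + INR p0 * INR q < INR (N * S n) * (eps / 2))%R).
  { assert (Hlt : (INR M + 1 <= INR (N * S n))%R).
    { rewrite <- S_INR. apply le_INR. nia. }
    assert (He := cond_pos eps).
    assert (2 * (4 + INR p0 * INR q) / eps < INR (N * S n))%R by lra.
    apply Rmult_lt_compat_r with (r := (eps / 2)%R) in H; [|lra].
    replace (2 * (4 + INR p0 * INR q) / eps * (eps / 2))%R with (4 + INR p0 * INR q)%R in H by (field; lra).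
    exact H. }
  assert (Hquot : (alpha <= INR m / INR (N * S n) < alpha + eps)%R).
  { split; apply Rmult_le_reg_r with (INR (N * S n)) || apply Rmult_lt_reg_r with (INR (N * S n)); auto;
      unfold Rdiv at 1; rewrite Rmult_assoc, Rinv_l by lra; nra. }
  apply Rabs_def1; lra.
Qed.

(** * Increasing bijections of the line *)
Local Open Scope R_scope.

(** The inverse is carried as data, so that inverting a letter involves no choice; maps are compared
    pointwise. *)
Record aut := Aut {
  fw : R -> R;
  bw : R -> R;
  fw_bw : forall x, fw (bw x) = x;
  bw_fw : forall x, bw (fw x) = x;
  fw_le : forall x y, x <= y -> fw x <= fw y;
  bw_le : forall x y, x <= y -> bw x <= bw y }.

Definition aid : aut :=
  Aut (fun x => x) (fun x => x) (fun _ => eq_refl) (fun _ => eq_refl) (fun _ _ H => H) (fun _ _ H => H).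

Definition ainv (a : aut) : aut := Aut (bw a) (fw a) (bw_fw a) (fw_bw a) (bw_le a) (fw_le a).

Program Definition acomp (a b : aut) : aut :=
  Aut (fun x => fw a (fw b x)) (fun x => bw b (bw a x)) _ _ _ _.
Next Obligation. rewrite fw_bw. apply fw_bw. Qed.
Next Obligation. rewrite bw_fw. apply bw_fw. Qed.
Next Obligation. auto using fw_le. Qed.
Next Obligation. auto using bw_le. Qed.

Program Definition atrans (t : R) : aut := Aut (fun x => x + t) (fun x => x - t) _ _ _ _.
Next Obligation. lra. Qed.
Next Obligation. lra. Qed.
Next Obligation. lra. Qed.
Next Obligation. lra. Qed.

Definition apow (a : aut) (n : nat) : aut := nat_rect (fun _ => aut) aid (fun _ b => acomp a b) n.

Definition lact (rho : nat -> aut) (l : letter) : aut :=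
  if snd l then rho (fst l) else ainv (rho (fst l)).
Fixpoint act (rho : nat -> aut) (w : word) : aut :=
  match w with [] => aid | l :: w' => acomp (lact rho l) (act rho w') end.

Lemma bw_ext a b : (forall x, fw a x = fw b x) -> forall x, bw a x = bw b x.
Proof. intros H x. rewrite <- (fw_bw b x) at 1. rewrite <- H. apply bw_fw. Qed.

Lemma act_app rho u v x : fw (act rho (u ++ v)) x = fw (act rho u) (fw (act rho v) x).
Proof. induction u; simpl; auto. rewrite IHu. auto. Qed.

Lemma act_winv rho u x : fw (act rho (winv u)) x = bw (act rho u) x.
Proof.
  revert x. induction u as [|l u IH]; intros x; auto.
  change (l :: u) with ([l] ++ u). rewrite winv_app, act_app, IH.
  simpl. f_equal. destruct l as [i [|]]; reflexivity.
Qed.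

Lemma act_comm rho u v x : fw (act rho (comm u v)) x =
  fw (act rho u) (fw (act rho v) (bw (act rho u) (bw (act rho v) x))).
Proof. unfold comm. rewrite !act_app, !act_winv. auto. Qed.

Lemma eqG_act rho Rl u v : (forall r, Rl r -> forall x, fw (act rho r) x = x) ->
  eqG Rl u v -> forall x, fw (act rho u) x = fw (act rho v) x.
Proof.
  intros HR H. induction H as [w|u v _ IH|u v w _ IH1 _ IH2|a b u v _ IH|l|r Hr]; intros x; auto.
  - rewrite IH1; auto.
  - rewrite !act_app, IH; auto.
  - change [l; flip l] with ([l] ++ winv [l]). rewrite act_app, act_winv. apply fw_bw.
Qed.

(** * Lifts of circle maps and their displacement *)

Definition periodic (a : aut) : Prop := forall x, fw a (x + 1) = fw a x + 1.

Lemma periodic_ainv a : periodic a -> periodic (ainv a).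
Proof.
  intros H x. simpl. rewrite <- (fw_bw a x) at 1. rewrite <- H. apply bw_fw.
Qed.
Lemma periodic_acomp a b : periodic a -> periodic b -> periodic (acomp a b).
Proof. intros Ha Hb x. simpl. rewrite Hb, Ha. auto. Qed.
Lemma periodic_act rho w : (forall i, periodic (rho i)) -> periodic (act rho w).
Proof.
  intros H. induction w as [|[i [|]] w IH]; [intros x; reflexivity| |]; simpl;
    apply periodic_acomp; auto; [apply H|apply periodic_ainv, H].
Qed.

Lemma periodic_IZR a n x : periodic a -> fw a (x + IZR n) = fw a x + IZR n.
Proof.
  intros H.
  assert (Hn : forall m x, fw a (x + INR m) = fw a x + INR m).
  { induction m; intros y; [simpl; rewrite !Rplus_0_r; auto|].
    rewrite S_INR, <- !Rplus_assoc, H, IHm. auto. }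
  destruct n as [|p|p].
  - rewrite !Rplus_0_r; auto.
  - rewrite <- positive_nat_Z, <- INR_IZR_INZ. apply Hn.
  - rewrite <- Pos2Z.opp_pos, opp_IZR, <- positive_nat_Z, <- INR_IZR_INZ.
    pose proof (Hn (Pos.to_nat p) (x + - INR (Pos.to_nat p))) as E.
    replace (x + - INR (Pos.to_nat p) + INR (Pos.to_nat p)) with x in E by lra. lra.
Qed.

Lemma integer_translate c x : exists n, c <= x - IZR n < c + 1.
Proof. exists (Int_part (x - c)). pose proof (base_Int_part (x - c)). lra. Qed.

(** Displacement is 1-periodic, so [y] may be moved between [x] and [x + 1], where monotonicity
    gives the bound. *)
Lemma displacement_le a x y : periodic a -> fw a y - y <= fw a x - x + 1.
Proof.
  intros H. destruct (integer_translate x y) as [n Hn].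
  pose proof (fw_le a (y - IZR n) (x + 1)) as Hle. rewrite H in Hle.
  pose proof (periodic_IZR a n (y - IZR n) H) as E.
  replace (y - IZR n + IZR n) with y in E by lra. lra.
Qed.

(** For [w = A^-1 B^-1 x] this compares [A B w] with [x = B A w]: the displacements of [A] at [w]
    and [B w], and those of [B] at [w] and [A w], each contribute a difference of at most 1. *)
Lemma act_comm_le rho u v x : (forall i, periodic (rho i)) ->
  fw (act rho (comm u v)) x <= x + 2.
Proof.
  intros H. rewrite act_comm.
  pose proof (periodic_act rho u H) as Hu. pose proof (periodic_act rho v H) as Hv.
  set (A := act rho u) in *. set (B := act rho v) in *. set (w := bw A (bw B x)).
  assert (E : fw B (fw A w) = x) by (unfold w; rewrite !fw_bw; auto).
  pose proof (displacement_le A w (fw B w) Hu). pose proof (displacement_le B (fw A w) w Hv).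
  rewrite E in *. lra.
Qed.

Lemma act_comm_prod_le rho ps x : (forall i, periodic (rho i)) ->
  fw (act rho (comm_prod ps)) x <= x + 2 * INR (length ps).
Proof.
  intros H. induction ps as [|[u v] ps IH].
  - simpl. lra.
  - unfold comm_prod in *. cbn [flat_map fst snd length]. rewrite act_app, S_INR.
    pose proof (act_comm_le rho u v (fw (act rho (flat_map (fun p => comm (fst p) (snd p)) ps)) x) H). lra.
Qed.

(** * Maps supported in an interval and their infinite products *)

Definition supp (a : aut) (c d : R) : Prop := forall x, x <= c \/ d <= x -> fw a x = x.

Lemma supp_ainv a c d : supp a c d -> supp (ainv a) c d.
Proof. intros H x Hx. simpl. rewrite <- (H x Hx) at 1. apply bw_fw. Qed.
Lemma supp_range a c d x : supp a c d -> c <= x <= d -> c <= fw a x <= d.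
Proof.
  intros H Hx. pose proof (fw_le a c x) as H1. pose proof (fw_le a x d) as H2.
  rewrite (H c) in H1 by lra. rewrite (H d) in H2 by lra. lra.
Qed.
Lemma supp_weaken a c d c' d' : c' <= c -> d <= d' -> supp a c d -> supp a c' d'.
Proof. intros H1 H2 H x Hx. apply H. lra. Qed.

(** The piecewise affine map of the interval from [c] to [d] with a single break, which carries [m]
    to [m']; exchanging [m] and [m'] inverts it. *)
Definition tentf (c m m' d x : R) : R :=
  if Rle_dec x c then x else
  if Rle_dec x m then c + (x - c) * ((m' - c) / (m - c)) else
  if Rle_dec x d then d - (d - x) * ((d - m') / (d - m)) else x.

Section Tent.
Variables c m m' d : R.
Hypothesis Hm : c < m < d.
Hypothesis Hm' : c < m' < d.

Lemma tentf_out x : x <= c \/ d <= x -> tentf c m m' d x = x.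
Proof.
  intros Hx. unfold tentf. destruct (Rle_dec x c); auto. destruct (Rle_dec x m); [lra|].
  destruct (Rle_dec x d); auto. replace x with d by lra. lra.
Qed.
Lemma tentf_lo x : c <= x <= m -> tentf c m m' d x = c + (x - c) * ((m' - c) / (m - c)).
Proof.
  intros Hx. unfold tentf. destruct (Rle_dec x c); [replace x with c by lra; lra|].
  destruct (Rle_dec x m); [auto|lra].
Qed.
Lemma tentf_hi x : m <= x <= d -> tentf c m m' d x = d - (d - x) * ((d - m') / (d - m)).
Proof.
  intros Hx. unfold tentf. destruct (Rle_dec x c); [lra|].
  destruct (Rle_dec x m); [replace x with m by lra; field; lra|].
  destruct (Rle_dec x d); [auto|lra].
Qed.
Lemma tentf_lo_range x : c <= x <= m -> c <= tentf c m m' d x <= m'.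
Proof.
  intros Hx. rewrite tentf_lo by auto.
  assert (Hk : 0 < (m' - c) / (m - c)) by (apply Rdiv_lt_0_compat; lra).
  assert (E : (m - c) * ((m' - c) / (m - c)) = m' - c) by (field; lra). nra.
Qed.
Lemma tentf_hi_range x : m <= x <= d -> m' <= tentf c m m' d x <= d.
Proof.
  intros Hx. rewrite tentf_hi by auto.
  assert (Hk : 0 < (d - m') / (d - m)) by (apply Rdiv_lt_0_compat; lra).
  assert (E : (d - m) * ((d - m') / (d - m)) = d - m') by (field; lra). nra.
Qed.
Lemma tentf_le x y : x <= y -> tentf c m m' d x <= tentf c m m' d y.
Proof.
  intros Hxy.
  assert (Hk : 0 < (m' - c) / (m - c)) by (apply Rdiv_lt_0_compat; lra).
  assert (Hk' : 0 < (d - m') / (d - m)) by (apply Rdiv_lt_0_compat; lra).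
  assert (Hcase : forall z, (z <= c \/ d <= z) \/ c <= z <= m \/ m <= z <= d) by (intros; lra).
  pose proof (tentf_lo_range x). pose proof (tentf_lo_range y).
  pose proof (tentf_hi_range x). pose proof (tentf_hi_range y).
  pose proof (tentf_out x). pose proof (tentf_out y).
  destruct (Hcase x) as [[Hx|Hx]|[Hx|Hx]], (Hcase y) as [[Hy|Hy]|[Hy|Hy]]; try lra.
  - rewrite (tentf_lo x), (tentf_lo y) by auto. nra.
  - rewrite (tentf_hi x), (tentf_hi y) by auto. nra.
Qed.
End Tent.

Lemma tentf_inv c m m' d x : c < m < d -> c < m' < d -> tentf c m' m d (tentf c m m' d x) = x.
Proof.
  intros Hm Hm'.
  assert (Hcase : (x <= c \/ d <= x) \/ c <= x <= m \/ m <= x <= d) by lra.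
  destruct Hcase as [Hx|[Hx|Hx]].
  - rewrite !tentf_out; auto. rewrite tentf_out; auto.
  - pose proof (tentf_lo_range c m m' d Hm Hm' x Hx).
    rewrite (tentf_lo _ m') by auto. rewrite tentf_lo by auto. field; lra.
  - pose proof (tentf_hi_range c m m' d Hm Hm' x Hx).
    rewrite (tentf_hi _ m') by auto. rewrite tentf_hi by auto. field; lra.
Qed.

Definition tent c m m' d (Hm : c < m < d) (Hm' : c < m' < d) : aut :=
  Aut (tentf c m m' d) (tentf c m' m d)
    (fun x => tentf_inv c m' m d x Hm' Hm) (fun x => tentf_inv c m m' d x Hm Hm')
    (tentf_le c m m' d Hm Hm') (tentf_le c m' m d Hm' Hm).

Lemma tent_ex c m m' d : c < m < d -> c < m' < d ->
  exists a, supp a c d /\ forall x, fw a x = tentf c m m' d x.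
Proof.
  intros Hm Hm'. exists (tent c m m' d Hm Hm'). split; auto.
  intros x Hx. apply tentf_out; auto.
Qed.

Section Glue.
Variables (c d : R) (gam : nat -> aut).
Hypothesis Hcd : c < d.
Hypothesis Hdisj : forall i j, (i < j)%nat -> fw (gam i) d <= fw (gam j) c.

(** The infinite product of the conjugates of [phi i] by [gam i], whose supports lie in the disjoint
    open cells from [gam i c] to [gam i d]. *)
Definition gluef (phi : nat -> aut) (x : R) : R :=
  match excluded_middle_informative (exists i, fw (gam i) c < x < fw (gam i) d) with
  | left H => let i := proj1_sig (constructive_indefinite_description _ H) in
              fw (gam i) (fw (phi i) (bw (gam i) x))
  | right _ => x
  end.

(** Cells may touch, as they do in both applications, so one of the memberships has to be strict. *)
Lemma cell_unique i j x : fw (gam i) c < x < fw (gam i) d -> fw (gam j) c <= x <= fw (gam j) d -> i = j.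
Proof.
  intros Hi Hj. destruct (Nat.lt_trichotomy i j) as [H|[H|H]]; auto; apply Hdisj in H; lra.
Qed.

Lemma cell_bw i x : fw (gam i) c <= x <= fw (gam i) d -> c <= bw (gam i) x <= d.
Proof.
  intros [H1 H2]. apply (bw_le (gam i)) in H1, H2. rewrite bw_fw in H1, H2. auto.
Qed.

Variable phi : nat -> aut.
Hypothesis Hphi : forall i, supp (phi i) c d.

Lemma gluef_in i x : fw (gam i) c <= x <= fw (gam i) d ->
  gluef phi x = fw (gam i) (fw (phi i) (bw (gam i) x)).
Proof.
  intros Hx. unfold gluef. destruct (excluded_middle_informative _) as [H|H].
  - destruct (constructive_indefinite_description _ H) as [j Hj]. simpl.
    rewrite (cell_unique j i x); auto.
  - assert (Hend : x = fw (gam i) c \/ x = fw (gam i) d).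
    { apply NNPP. intros Hn. apply H. exists i. lra. }
    destruct Hend as [->| ->]; rewrite bw_fw, Hphi; auto; lra.
Qed.

Lemma gluef_out x : (forall i, ~ (fw (gam i) c < x < fw (gam i) d)) -> gluef phi x = x.
Proof.
  intros Hx. unfold gluef. destruct (excluded_middle_informative _) as [[i H]|H]; auto.
  destruct (Hx i H).
Qed.

Lemma gluef_range i x : fw (gam i) c <= x <= fw (gam i) d ->
  fw (gam i) c <= gluef phi x <= fw (gam i) d.
Proof.
  intros Hx. rewrite (gluef_in i) by auto.
  pose proof (supp_range _ _ _ _ (Hphi i) (cell_bw i x Hx)). split; apply fw_le; lra.
Qed.

Lemma gluef_le x y : x <= y -> gluef phi x <= gluef phi y.
Proof.
  intros Hxy.
  destruct (classic (exists i, fw (gam i) c < x < fw (gam i) d)) as [[i Hi]|Hi];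
  destruct (classic (exists j, fw (gam j) c < y < fw (gam j) d)) as [[j Hj]|Hj].
  - destruct (Nat.lt_trichotomy i j) as [H|[<-|H]].
    + apply Hdisj in H. pose proof (gluef_range i x). pose proof (gluef_range j y). lra.
    + rewrite !(gluef_in i) by lra. auto using fw_le, bw_le.
    + apply Hdisj in H. lra.
  - rewrite (gluef_out y) by (intros j H; apply Hj; eauto).
    pose proof (gluef_range i x). assert (~ y < fw (gam i) d) by (intros H1; apply Hj; exists i; lra). lra.
  - rewrite (gluef_out x) by (intros i H; apply Hi; eauto).
    pose proof (gluef_range j y). assert (~ fw (gam j) c < x) by (intros H1; apply Hi; exists j; lra). lra.
  - rewrite !gluef_out; auto; intros i H; [apply Hj|apply Hi]; eauto.
Qed.
End Glue.

Lemma gluef_inv c d gam phi x : c < d ->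
  (forall i j, (i < j)%nat -> fw (gam i) d <= fw (gam j) c) ->
  (forall i, supp (phi i) c d) ->
  gluef c d gam (fun i => ainv (phi i)) (gluef c d gam phi x) = x.
Proof.
  intros Hcd Hdisj Hphi.
  destruct (classic (exists i, fw (gam i) c < x < fw (gam i) d)) as [[i Hi]|Hi].
  - rewrite (gluef_in c d gam Hdisj (fun i => ainv (phi i)) (fun i => supp_ainv _ _ _ (Hphi i)) i).
    + rewrite (gluef_in c d gam Hdisj phi Hphi i) by lra. simpl. rewrite !bw_fw, fw_bw. auto.
    + apply gluef_range; auto; lra.
  - rewrite (gluef_out c d gam phi) by (intros i H; apply Hi; eauto).
    apply gluef_out. intros i H; apply Hi; eauto.
Qed.

Lemma glue_ex c d gam phi : c < d ->
  (forall i j, (i < j)%nat -> fw (gam i) d <= fw (gam j) c) ->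
  (forall i, supp (phi i) c d) ->
  exists a, (forall x, fw a x = gluef c d gam phi x) /\
            (forall x, bw a x = gluef c d gam (fun i => ainv (phi i)) x).
Proof.
  intros Hcd Hdisj Hphi.
  assert (Hphi' : forall i, supp (ainv (phi i)) c d) by (intros; apply supp_ainv; auto).
  unshelve eexists (Aut (gluef c d gam phi) (gluef c d gam (fun i => ainv (phi i))) _ _ _ _); auto.
  - intros x. pose proof (gluef_inv c d gam (fun i => ainv (phi i)) x Hcd Hdisj Hphi') as H.
    rewrite <- H at 2. unfold gluef. reflexivity.
  - intros x. apply gluef_inv; auto.
  - apply gluef_le; auto.
  - apply gluef_le; auto.
Qed.

Lemma apow_S_r a n x : fw (apow a (S n)) x = fw (apow a n) (fw a x).
Proof. induction n; auto. simpl in *. rewrite IHn. auto. Qed.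
Lemma bw_apow_S a n x : bw (apow a (S n)) x = bw (apow a n) (bw a x).
Proof. reflexivity. Qed.

(** The interval from [c] to [a c] is a fundamental domain, so its iterates are consecutive. *)
Lemma apow_cells a c d : c < d -> fw a c = d -> forall i j, (i < j)%nat ->
  fw (apow a i) d <= fw (apow a j) c.
Proof.
  intros Hcd Ha i j Hij. rewrite <- Ha, <- apow_S_r.
  induction Hij as [|j Hij IH]; [lra|].
  apply Rle_trans with (1 := IH). rewrite (apow_S_r a j). apply fw_le. lra.
Qed.

Lemma supp_apow a c d n : supp a c d -> supp (apow a n) c d.
Proof. intros H. induction n; intros x Hx; auto. simpl. rewrite IHn, H; auto. Qed.

Definition shifted_comm (s h F : aut) (i : nat) (x : R) : R :=
  let f y := bw (apow s i) (fw F (fw (apow s i) y)) in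
  let f' y := bw (apow s i) (bw F (fw (apow s i) y)) in
  f (fw h (f' (bw h x))).

(* With [P = phi^(h^0) phi^(h^1) phi^(h^2) ..], the commutator of [P] with [h] telescopes to [phi]. *)
Lemma telescope c d j0 j1 h phi : j0 <= c -> c < d -> d <= j1 ->
  supp h j0 j1 -> fw h c = d -> supp phi c d ->
  exists P, supp P j0 j1 /\ forall x, fw P (fw h (bw P (bw h x))) = fw phi x.
Proof.
  intros Hc Hcd Hd Hh Hhc Hphi.
  pose proof (apow_cells h c d Hcd Hhc) as Hdisj.
  destruct (glue_ex c d (apow h) (fun _ => phi) Hcd Hdisj (fun _ => Hphi)) as [P [HP HP']].
  assert (Hin : forall n x, fw (apow h n) c <= x <= fw (apow h n) d ->
            fw P x = fw (apow h n) (fw phi (bw (apow h n) x))).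
  { intros n x Hx. rewrite HP. apply gluef_in; auto. }
  assert (Hin' : forall n x, fw (apow h n) c <= x <= fw (apow h n) d ->
            bw P x = fw (apow h n) (bw phi (bw (apow h n) x))).
  { intros n x Hx. rewrite HP'.
    apply (gluef_in c d (apow h) Hdisj (fun _ => ainv phi) (fun _ => supp_ainv _ _ _ Hphi)); auto. }
  assert (Hout : forall x, (forall n, ~ (fw (apow h n) c < x < fw (apow h n) d)) -> fw P x = x).
  { intros x Hx. rewrite HP. apply gluef_out; auto. }
  assert (Hout' : forall x, (forall n, ~ (fw (apow h n) c < x < fw (apow h n) d)) -> bw P x = x).
  { intros x Hx. rewrite HP'. apply gluef_out; auto. }
  assert (Hcell : forall n, c <= fw (apow h n) c /\ fw (apow h n) d <= j1).
  { intros n. split.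
    - destruct n; [simpl; lra|]. pose proof (Hdisj 0%nat (S n) ltac:(lia)). simpl in *. lra.
    - rewrite <- (supp_apow h j0 j1 n Hh j1) by lra. apply fw_le; auto. }
  exists P. split.
  - intros x Hx. apply Hout. intros n Hn. specialize (Hcell n). lra.
  - intros x.
    (* In cell 0 the point [h^-1 x] lies before all cells, so only the outer [P] acts, as [phi]. In
       a later cell the two conjugates of [phi] cancel. Elsewhere nothing moves. *)
    destruct (classic (exists n, fw (apow h n) c <= x <= fw (apow h n) d)) as [[[|n] Hx]|Hx].
    + simpl in Hx. rewrite (Hout' (bw h x)).
      * rewrite fw_bw. rewrite (Hin 0%nat); auto.
      * intros n Hn.
        assert (H1 : bw h x <= c). { rewrite <- (bw_fw h c). apply bw_le. lra. }
        specialize (Hcell n). lra.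
    + assert (Hbx : fw (apow h n) c <= bw h x <= fw (apow h n) d).
      { rewrite <- (bw_fw h (fw (apow h n) c)), <- (bw_fw h (fw (apow h n) d)).
        split; apply bw_le; apply Hx. }
      rewrite (Hin' n _ Hbx).
      set (y := bw phi (bw (apow h n) (bw h x))).
      change (fw h (fw (apow h n) y)) with (fw (apow h (S n)) y).
      rewrite (Hin (S n)).
      * rewrite bw_fw. unfold y. rewrite fw_bw.
        change (bw (apow h n) (bw h x)) with (bw (apow h (S n)) x). rewrite fw_bw.
        symmetry. apply Hphi. right. pose proof (Hdisj 0%nat (S n) ltac:(lia)). simpl in *. lra.
      * assert (Hy : c <= y <= d).
        { apply (supp_range (ainv phi)); [apply supp_ainv; auto|].
          destruct Hbx as [H1 H2]. apply (bw_le (apow h n)) in H1, H2. rewrite bw_fw in H1, H2. auto. }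
        split; apply fw_le; lra.
    + assert (Hnx : forall n, ~ (fw (apow h n) c < x < fw (apow h n) d)).
      { intros n Hn. apply Hx. exists n. lra. }
      rewrite (Hout' (bw h x)).
      * rewrite fw_bw, Hout by auto. symmetry. apply Hphi.
        apply NNPP. intros H. apply Hx. exists 0%nat. simpl. lra.
      * intros n Hn. apply Hx. exists (S n). simpl.
        rewrite <- (fw_bw h x). split; apply fw_le; lra.
Qed.

(** Two nested margins of width [e]. In the inner one [h] carries [c] to [d], so [phi i] is the
    commutator of some [P i] with [h]. In the outer one [s] carries [j0] to [j1], so [F] can hold
    [P i] in the [i]-th iterate of this interval. Conjugating by [s^i] brings [P i] back over the
    support of [h]; the other copies lie off that support and cancel in the commutator. *)
Lemma shifted_comm_ex c d e (phi : nat -> aut) : c < d -> 0 < e -> (forall i, supp (phi i) c d) ->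
  exists s h F, supp s (c - 2 * e) (d + 2 * e) /\ supp h (c - 2 * e) (d + 2 * e) /\
    supp F (c - 2 * e) (d + 2 * e) /\ forall i x, shifted_comm s h F i x = fw (phi i) x.
Proof.
  intros Hcd He Hphi. set (j0 := c - e). set (j1 := d + e).
  destruct (tent_ex j0 c d j1) as [h [Hh Eh]]; [unfold j0, j1; lra|unfold j0, j1; lra|].
  destruct (tent_ex (c - 2 * e) j0 j1 (d + 2 * e)) as [s [Hs Es]]; [unfold j0, j1; lra|unfold j0, j1; lra|].
  assert (Hhc : fw h c = d).
  { rewrite Eh, tentf_lo by (unfold j0, j1; lra). unfold j0. field. lra. }
  assert (Hsj : fw s j0 = j1).
  { rewrite Es, tentf_lo by (unfold j0, j1; lra). unfold j0, j1. field. lra. }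
  assert (HP : forall i, exists P, supp P j0 j1 /\ forall x, fw P (fw h (bw P (bw h x))) = fw (phi i) x).
  { intros i. apply (telescope c d); auto; unfold j0, j1; lra. }
  pose (P := fun i => proj1_sig (constructive_indefinite_description _ (HP i))).
  assert (HPs : forall i, supp (P i) j0 j1).
  { intros i. unfold P. destruct (constructive_indefinite_description _ (HP i)); simpl; tauto. }
  assert (HPc : forall i x, fw (P i) (fw h (bw (P i) (bw h x))) = fw (phi i) x).
  { intros i. unfold P. destruct (constructive_indefinite_description _ (HP i)); simpl; tauto. }
  clearbody P. clear HP.
  assert (Hj : j0 < j1) by (unfold j0, j1; lra).
  pose proof (apow_cells s j0 j1 Hj Hsj) as Hdisj.
  destruct (glue_ex j0 j1 (apow s) P Hj Hdisj HPs) as [F [HF HF']].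
  assert (Hcell : forall n, c - 2 * e <= fw (apow s n) j0 /\ fw (apow s n) j1 <= d + 2 * e).
  { intros n. pose proof (supp_apow s _ _ n Hs) as H.
    split; [rewrite <- (H (c - 2 * e)) by lra|rewrite <- (H (d + 2 * e)) by lra];
      apply fw_le; unfold j0, j1; lra. }
  exists s, h, F. split; [auto|split; [|split]].
  - apply supp_weaken with j0 j1; auto; unfold j0, j1; lra.
  - intros x Hx. rewrite HF. apply gluef_out. intros n Hn. specialize (Hcell n). lra.
  - intros i x. unfold shifted_comm.
    assert (Hmove : forall y, j0 <= y <= j1 -> fw (apow s i) j0 <= fw (apow s i) y <= fw (apow s i) j1)
      by (intros; split; apply fw_le; lra).
    destruct (classic (j0 <= x <= j1)) as [Hx|Hx].
    + pose proof (supp_range (ainv h) _ _ x (supp_ainv _ _ _ Hh) Hx) as H1. simpl in H1.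
      rewrite (HF' (fw (apow s i) (bw h x))).
      rewrite (gluef_in j0 j1 (apow s) Hdisj _ (fun i => supp_ainv _ _ _ (HPs i)) i) by auto.
      simpl. rewrite !bw_fw.
      pose proof (supp_range (ainv (P i)) _ _ _ (supp_ainv _ _ _ (HPs i)) H1) as H2. simpl in H2.
      pose proof (supp_range h _ _ _ Hh H2) as H3.
      rewrite HF, (gluef_in j0 j1 (apow s) Hdisj _ HPs i) by auto. rewrite !bw_fw. auto.
    + replace (bw h x) with x by (symmetry; apply (supp_ainv _ _ _ Hh); lra).
      set (y := bw (apow s i) (bw F (fw (apow s i) x))).
      (* The conjugate of [F] fixes [j0] and [j1], so it keeps a point outside the support of
         [h]. *)
      assert (Efix : forall z, z = j0 \/ z = j1 -> bw F (fw (apow s i) z) = fw (apow s i) z).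
      { intros z Hz. rewrite HF'.
        assert (Hzz : j0 <= z <= j1) by lra.
        rewrite (gluef_in j0 j1 (apow s) Hdisj _ (fun i => supp_ainv _ _ _ (HPs i)) i) by auto.
        rewrite bw_fw. f_equal. apply (supp_ainv _ _ _ (HPs i)). lra. }
      assert (Hy : y <= j0 \/ j1 <= y).
      { destruct (Rle_dec x j0) as [Hx0|Hx0]; [left|right].
        - rewrite <- (bw_fw (apow s i) j0), <- (Efix j0) by auto. apply bw_le, bw_le, fw_le. lra.
        - rewrite <- (bw_fw (apow s i) j1), <- (Efix j1) by auto. apply bw_le, bw_le, fw_le. lra. }
      rewrite (Hh y Hy). unfold y. rewrite !fw_bw, bw_fw. symmetry. apply Hphi.
      unfold j0, j1 in Hx. lra.
Qed.

(** * Periodic extension of a map supported in a unit interval *)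

Definition perf (c : R) (f : R -> R) (x : R) : R :=
  f (x - IZR (Int_part (x - c))) + IZR (Int_part (x - c)).

Lemma perf_eq c a y n : supp a c (c + 1) -> c <= y <= c + 1 ->
  perf c (fw a) (y + IZR n) = fw a y + IZR n.
Proof.
  intros Ha Hy. unfold perf. pose proof (base_Int_part (y + IZR n - c)) as H.
  set (m := Int_part (y + IZR n - c)) in *.
  assert (Hmn : (m = n \/ m = n + 1)%Z).
  { assert (IZR m < IZR (n + 2))%R by (rewrite plus_IZR; lra).
    assert (IZR (n - 1) < IZR m)%R by (rewrite minus_IZR; lra).
    apply lt_IZR in H0, H1. lia. }
  destruct Hmn as [->| ->].
  - replace (y + IZR n - IZR n) with y by lra. auto.
  - rewrite plus_IZR in *. assert (y = c + 1) as -> by lra.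
    replace (c + 1 + IZR n - (IZR n + 1)) with c by lra. rewrite !Ha by lra. lra.
Qed.

Lemma perf_le c a x y : supp a c (c + 1) -> x <= y -> perf c (fw a) x <= perf c (fw a) y.
Proof.
  intros Ha Hxy. destruct (integer_translate c x) as [n Hn], (integer_translate c y) as [m Hm].
  replace x with (x - IZR n + IZR n) by lra. replace y with (y - IZR m + IZR m) by lra.
  rewrite !perf_eq by (auto; lra).
  assert (Hnm : (n < m + 1)%Z).
  { apply lt_IZR. rewrite plus_IZR. lra. }
  destruct (Z.eq_dec n m) as [->|Hne].
  - apply Rplus_le_compat_r, fw_le. lra.
  - assert (IZR (n + 1) <= IZR m) by (apply IZR_le; lia). rewrite plus_IZR in *.
    pose proof (supp_range a _ _ (x - IZR n) Ha). pose proof (supp_range a _ _ (y - IZR m) Ha). lra.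
Qed.

Lemma perf_inv c a x : supp a c (c + 1) -> perf c (bw a) (perf c (fw a) x) = x.
Proof.
  intros Ha. destruct (integer_translate c x) as [n Hn]. replace x with (x - IZR n + IZR n) by lra.
  rewrite perf_eq by (auto; lra). change (bw a) with (fw (ainv a)).
  rewrite perf_eq; [|apply supp_ainv; auto|apply supp_range; auto; lra].
  simpl. rewrite bw_fw. auto.
Qed.

Lemma perf_ex c a : supp a c (c + 1) -> exists A, periodic A /\
  forall y n, c <= y <= c + 1 ->
    fw A (y + IZR n) = fw a y + IZR n /\ bw A (y + IZR n) = bw a y + IZR n.
Proof.
  intros Ha. pose proof (supp_ainv _ _ _ Ha) as Ha'.
  exists (Aut (perf c (fw a)) (perf c (bw a)) (fun x => perf_inv c (ainv a) x Ha')
    (fun x => perf_inv c a x Ha) (fun x y => perf_le c a x y Ha) (fun x y => perf_le c (ainv a) x y Ha')).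
  split.
  - intros x. simpl. destruct (integer_translate c x) as [n Hn].
    replace (x + 1) with (x - IZR n + IZR (n + 1)) by (rewrite plus_IZR; lra).
    rewrite perf_eq by (auto; lra).
    replace x with (x - IZR n + IZR n) at 2 by lra. rewrite perf_eq by (auto; lra).
    rewrite plus_IZR. lra.
  - intros y n Hy. simpl. split; [apply perf_eq; auto|].
    apply (perf_eq c (ainv a)); auto.
Qed.

Lemma periodic_shifted_comm_ex c d (phi : nat -> aut) : c < d < c + 1 -> (forall i, supp (phi i) c d) ->
  exists s h F, periodic s /\ periodic h /\ periodic F /\
    forall i y n, c <= y <= c + 1 -> shifted_comm s h F i (y + IZR n) = fw (phi i) y + IZR n.
Proof.
  (* With this margin the interval from [c - 2e] to [d + 2e] has length exactly 1. *)
  intros Hcd Hphi. set (e := (1 - (d - c)) / 4).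
  assert (He : 0 < e) by (unfold e; lra).
  destruct (shifted_comm_ex c d e phi) as [s [h [F [Hs [Hh [HF E]]]]]]; auto; [lra|].
  set (b := c - 2 * e) in *. replace (d + 2 * e) with (b + 1) in * by (unfold b, e; lra).
  destruct (perf_ex b s Hs) as [S [PS ES]], (perf_ex b h Hh) as [H [PH EH]], (perf_ex b F HF) as [G [PG EG]].
  exists S, H, G. repeat split; auto.
  assert (Hbw : forall a y, supp a b (b + 1) -> b <= y <= b + 1 -> b <= bw a y <= b + 1).
  { intros a y Ha Hy. apply (supp_range (ainv a)); auto. apply supp_ainv; auto. }
  assert (HpowE : forall i y n, b <= y <= b + 1 -> fw (apow S i) (y + IZR n) = fw (apow s i) y + IZR n /\
     bw (apow S i) (y + IZR n) = bw (apow s i) y + IZR n).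
  { intros i n. induction i as [|i IH]; intros m Hy; [split; auto|].
    split.
    - rewrite !apow_S_r. rewrite (proj1 (ES n m Hy)). clear IH.
      assert (Hgen : forall j y, b <= y <= b + 1 -> fw (apow S j) (y + IZR m) = fw (apow s j) y + IZR m).
      { induction j as [|j IH]; intros y Hy'; auto. rewrite !apow_S_r, (proj1 (ES y m Hy')).
        apply IH. apply supp_range; auto. }
      apply Hgen. apply supp_range; auto.
    - assert (Hgen : forall j y, b <= y <= b + 1 -> bw (apow S j) (y + IZR m) = bw (apow s j) y + IZR m).
      { induction j as [|j IHj]; intros y Hy'; auto. rewrite !bw_apow_S, (proj2 (ES y m Hy')).
        apply IHj. apply Hbw; auto. }
      apply Hgen; auto. }
  assert (Hmain : forall i y n, b <= y <= b + 1 -> shifted_comm S H G i (y + IZR n) = fw (phi i) y + IZR n).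
  { intros i y n Hy. rewrite <- E. unfold shifted_comm.
    pose proof (supp_apow s b (b + 1) i Hs) as Hsi.
    assert (H1 := Hbw h y Hh Hy). set (y1 := bw h y) in *.
    assert (H2 := supp_range _ _ _ _ Hsi H1). set (y2 := fw (apow s i) y1) in *.
    assert (H3 := Hbw F y2 HF H2). set (y3 := bw F y2) in *.
    assert (H4 := Hbw _ y3 Hsi H3). set (y4 := bw (apow s i) y3) in *.
    assert (H5 := supp_range _ _ _ _ Hh H4). set (y5 := fw h y4) in *.
    assert (H6 := supp_range _ _ _ _ Hsi H5). set (y6 := fw (apow s i) y5) in *.
    assert (H7 := supp_range _ _ _ _ HF H6). set (y7 := fw F y6) in *.
    rewrite (proj2 (EH y n Hy)). fold y1.
    rewrite (proj1 (HpowE i y1 n H1)). fold y2.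
    rewrite (proj2 (EG y2 n H2)). fold y3.
    rewrite (proj2 (HpowE i y3 n H3)). fold y4.
    rewrite (proj1 (EH y4 n H4)). fold y5.
    rewrite (proj1 (HpowE i y5 n H5)). fold y6.
    rewrite (proj1 (EG y6 n H6)). fold y7.
    apply (HpowE i y7 n H7). }
  intros i y n Hy.
  destruct (Rle_dec y (b + 1)) as [Hyb|Hyb].
  - apply Hmain. unfold b, e in *; lra.
  (* Past [b + 1] the point [y - 1] lies between [b] and [c], and [phi i] fixes both [y] and
     [y - 1]. *)
  - replace (y + IZR n) with (y - 1 + IZR (n + 1)) by (rewrite plus_IZR; lra).
    rewrite Hmain by (unfold b, e in *; lra).
    rewrite !(Hphi i), plus_IZR by (unfold b, e in *; lra). lra.
Qed.

(** * Realizing right-computable numbers *)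
Local Open Scope R_scope.

Definition gen (j : nat) : word := [(j, true)].

(** Generators [a], [a + 1], [a + 2] stand for [s], [h], [F]. With [g] as 0, [v] as 1 and one such
    block at 2 and at 5 for the two arcs of [u], there are eight generators. *)
Definition shifted_word (a i : nat) : word :=
  comm (winv (wpow (gen a) i) ++ gen (a + 2) ++ wpow (gen a) i) (gen (a + 1)).

Definition trans_word (i : nat) : word :=
  comm (shifted_word 2 i ++ shifted_word 5 i) (gen 1).

Lemma act_gen_pow rho a n x : fw (act rho (wpow (gen a) n)) x = fw (apow (rho a) n) x.
Proof.
  revert x. induction n as [|n IH]; intros x; auto. rewrite wpow_S, act_app, IH. reflexivity.
Qed.

Lemma act_shifted_word rho a i x :
  fw (act rho (shifted_word a i)) x = shifted_comm (rho a) (rho (a + 1)%nat) (rho (a + 2)%nat) i x.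
Proof.
  unfold shifted_word, shifted_comm. rewrite act_comm.
  set (A := act rho (winv (wpow (gen a) i) ++ gen (a + 2) ++ wpow (gen a) i)).
  assert (EA : forall y, fw A y =
     bw (apow (rho a) i) (fw (rho (a + 2)%nat) (fw (apow (rho a) i) y))).
  { intros y. unfold A. rewrite !act_app, act_winv, act_gen_pow.
    rewrite (bw_ext _ (apow (rho a) i)) by apply act_gen_pow. reflexivity. }
  assert (EA' : forall y, bw A y =
     bw (apow (rho a) i) (bw (rho (a + 2)%nat) (fw (apow (rho a) i) y))).
  { apply (bw_ext A (acomp (ainv (apow (rho a) i)) (acomp (rho (a + 2)%nat) (apow (rho a) i)))). exact EA. }
  rewrite EA, EA'. reflexivity.
Qed.

Section Translation.
Variables (T : R) (t : nat -> R) (g : aut).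
Hypothesis HT : 0 <= T < 1.
Hypothesis Ht : forall i, 0 <= t i <= T.
Hypothesis Hg : periodic g.
(** A quarter of the gap leaves [1 - 3e - t i >= e], which makes the slopes [b i] below positive. *)
Let e := (1 - T) / 4.
Let l := 1 - e.

(* [v] is the piecewise affine map with [0 -> e], [l -> 2e], commuting with [x -> x + 1], with a
   repelling fixed point [- del] and an attracting one [p]; [u] carries them to the fixed points of
   [v + t] and fixes [0] and [l], where the slope of [v] changes.  As [v] and [v + t] have the same
   slopes, the piecewise affine [u] satisfies [u v = v u + t]. *)
Lemma translation_as_comm : exists rho : nat -> aut, (forall i, periodic (rho i)) /\ rho 0%nat = g /\
  forall i x, fw (act rho (trans_word i)) x = x + t i.
Proof.
  assert (He : 0 < e <= 1 / 4) by (unfold e; lra).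
  assert (Hte : forall i, 0 <= t i <= 1 - 4 * e) by (intros i; specialize (Ht i); unfold e; lra).
  assert (Hl : l = 1 - e) by reflexivity.
  clearbody l e. subst l.
  set (D := 1 - 2 * e). assert (HD : 1 / 2 <= D) by (unfold D; lra).
  (* These solve [e + p mu = p] and [e - del lam = - del], where [mu = e/(1-e)] and [lam = (1-e)/e]
     are the slopes of [v]. *)
  set (p := e * (1 - e) / D). set (del := e * e / D).
  (* The slopes of [u] around its fixed points 0 and [l = 1 - e]. The equation [u v = v u + t] at 0
     demands [u(e) = e + t], and at [l] it demands [u(2e) = 2e + t]. *)
  set (a := fun i => (e + t i) / e). set (b := fun i => (1 - 3 * e - t i) / (1 - 3 * e)).
  assert (HpD : p * D = e * (1 - e)) by (unfold p; field; lra).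
  assert (HdD : del * D = e * e) by (unfold del; field; lra).
  assert (Ha : forall i, a i * e = e + t i) by (intros i; unfold a; field; lra).
  assert (Hb : forall i, b i * (1 - 3 * e) = 1 - 3 * e - t i) by (intros i; unfold b; field; lra).
  assert (Hp : 0 < p < 1 - e) by (unfold D in *; nra).
  assert (Hdel : 0 < del < e) by (unfold D in *; nra).
  assert (Hpa : forall i, a i * p * D = (e + t i) * (1 - e)).
  { intros i. rewrite Rmult_assoc, HpD, <- Ha. ring. }
  assert (Hda : forall i, a i * del * D = (e + t i) * e).
  { intros i. rewrite Rmult_assoc, HdD, <- Ha. ring. }
  assert (Ha1 : forall i, 1 <= a i) by (intros i; specialize (Ha i); specialize (Hte i); nra).
  assert (Hb1 : forall i, 0 < b i <= 1) by (intros i; specialize (Hb i); specialize (Hte i); nra).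
  assert (Hap : forall i, 0 < a i * p < 1 - e).
  { intros i. specialize (Hpa i). specialize (Hte i). unfold D in *. nra. }
  assert (Had : forall i, 0 < a i * del < e).
  { intros i. specialize (Hda i). specialize (Hte i). unfold D in *. nra. }
  (* [u] is cut at its fixed points 0 and [1 - e], because [periodic_shifted_comm_ex] needs arcs
     shorter than 1. Each arc contains one break of [u], at a fixed point of [v]. *)
  assert (Hphi1 : forall i, exists f, supp f 0 (1 - e) /\ forall x, fw f x = tentf 0 p (a i * p) (1 - e) x)
    by (intros i; apply tent_ex; auto).
  assert (Hphi2 : forall i, exists f, supp f (1 - e) 1 /\
            forall x, fw f x = tentf (1 - e) (1 - del) (1 - a i * del) 1 x)
    by (intros i; specialize (Had i); apply tent_ex; lra).
  pose (phi1 := fun i => proj1_sig (constructive_indefinite_description _ (Hphi1 i))).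
  pose (phi2 := fun i => proj1_sig (constructive_indefinite_description _ (Hphi2 i))).
  assert (S1 : forall i, supp (phi1 i) 0 (1 - e) /\ forall x, fw (phi1 i) x = tentf 0 p (a i * p) (1 - e) x).
  { intros i. unfold phi1. destruct (constructive_indefinite_description _ (Hphi1 i)); auto. }
  assert (S2 : forall i, supp (phi2 i) (1 - e) 1 /\
            forall x, fw (phi2 i) x = tentf (1 - e) (1 - del) (1 - a i * del) 1 x).
  { intros i. unfold phi2. destruct (constructive_indefinite_description _ (Hphi2 i)); auto. }
  clearbody phi1 phi2. clear Hphi1 Hphi2.
  destruct (periodic_shifted_comm_ex 0 (1 - e) phi1) as [s1 [h1 [F1 [Ps1 [Ph1 [PF1 E1]]]]]];
    [lra|apply S1|].
  destruct (periodic_shifted_comm_ex (1 - e) 1 phi2) as [s2 [h2 [F2 [Ps2 [Ph2 [PF2 E2]]]]]];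
    [lra|apply S2|].
  destruct (tent_ex 0 (1 - e) e 1) as [v0 [Sv Ev0]]; [lra|lra|].
  destruct (perf_ex 0 v0) as [V0 [PV0 EV0]]; [rewrite Rplus_0_l; auto|].
  set (v := acomp (atrans e) V0).
  exists (fun j => match j with
     0%nat => g | 1%nat => v | 2%nat => s1 | 3%nat => h1 | 4%nat => F1
     | 5%nat => s2 | 6%nat => h2 | _ => F2 end).
  assert (Pv : periodic v).
  { intros x. simpl. rewrite PV0. lra. }
  set (rho := fun j => match j with
     0%nat => g | 1%nat => v | 2%nat => s1 | 3%nat => h1 | 4%nat => F1
     | 5%nat => s2 | 6%nat => h2 | _ => F2 end).
  assert (Prho : forall i, periodic (rho i)).
  { intros i. do 7 (destruct i; [exact ltac:(auto)|]). auto. }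
  split; [exact Prho|split; [reflexivity|]].
  intros i x. unfold trans_word. rewrite act_comm.
  set (u := act rho (shifted_word 2 i ++ shifted_word 5 i)).
  assert (Pu : periodic u) by (apply periodic_act; auto).
  assert (Eu : forall y, fw u y = shifted_comm s1 h1 F1 i (shifted_comm s2 h2 F2 i y)).
  { intros y. unfold u. rewrite act_app, !act_shifted_word. reflexivity. }
  assert (Ew : act rho (gen 1) = acomp v aid) by reflexivity. rewrite Ew. clear Ew.
  cbn [fw bw acomp aid].
  change (fw (atrans e) ?y) with (y + e) in *.
  enough (Hmain : forall y, fw u (fw v y) = fw v (fw u y) + t i).
  { change (fw u (fw v (bw u (bw v x))) = x + t i). rewrite Hmain, !fw_bw. auto. }
  specialize (Hte i). specialize (Ha i). specialize (Hb i). specialize (Hpa i). specialize (Hda i).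
  specialize (Ha1 i). specialize (Hb1 i). specialize (Hap i). specialize (Had i).
  assert (E1' : forall y n, 0 <= y <= 1 -> shifted_comm s1 h1 F1 i (y + IZR n) =
            tentf 0 p (a i * p) (1 - e) y + IZR n).
  { intros y n Hy. rewrite E1 by lra. f_equal. apply S1. }
  assert (E2' : forall y n, 1 - e <= y <= 1 - e + 1 -> shifted_comm s2 h2 F2 i (y + IZR n) =
            tentf (1 - e) (1 - del) (1 - a i * del) 1 y + IZR n).
  { intros y n Hy. rewrite E2 by lra. f_equal. apply S2. }
  assert (Hu1 : forall y, - del <= y <= p -> fw u y = a i * y).
  { intros y Hy. rewrite Eu. destruct (Rle_dec y 0) as [H0|H0].
    - pose proof (E2' (y + 1) (-1)%Z ltac:(lra)) as E. replace (y + 1 + -1) with y in E by lra.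
      rewrite E, tentf_hi by lra.
      pose proof (E1' (a i * y + 1) (-1)%Z ltac:(nra)) as E'.
      replace (1 - (1 - (y + 1)) * ((1 - (1 - a i * del)) / (1 - (1 - del))) + -1)
        with (a i * y + 1 + -1) by (field; lra).
      rewrite E', tentf_out by (try lra; right; nra). lra.
    - pose proof (E2' (y + 1) (-1)%Z ltac:(lra)) as E. replace (y + 1 + -1) with y in E by lra.
      rewrite E, tentf_out by lra.
      pose proof (E1' y 0%Z ltac:(lra)) as E'. rewrite Rplus_0_r in E'.
      replace (y + 1 + -1) with y by lra. rewrite E', tentf_lo by lra. field. lra. }
  assert (Hu2 : forall y, p <= y <= 1 - del -> fw u y = 1 - e + (y - (1 - e)) * b i).
  { intros y Hy. rewrite Eu. destruct (Rle_dec y (1 - e)) as [H0|H0].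
    - pose proof (E2' (y + 1) (-1)%Z ltac:(lra)) as E. replace (y + 1 + -1) with y in E by lra.
      rewrite E, tentf_out by lra.
      pose proof (E1' y 0%Z ltac:(lra)) as E'. rewrite Rplus_0_r in E'.
      replace (y + 1 + -1) with y by lra. rewrite E', tentf_hi by lra.
      assert (Hs : (1 - e - a i * p) / (1 - e - p) = b i).
      { apply Rmult_eq_reg_r with (1 - e - p); [|lra].
        replace ((1 - e - a i * p) / (1 - e - p) * (1 - e - p)) with (1 - e - a i * p) by (field; lra).
        apply Rmult_eq_reg_r with D; [|lra].
        replace (b i * (1 - e - p) * D) with (b i * ((1 - e) * D - p * D)) by ring.
        replace ((1 - e - a i * p) * D) with ((1 - e) * D - a i * p * D) by ring.
        rewrite HpD, Hpa.
        replace (b i * ((1 - e) * D - e * (1 - e))) with (b i * (1 - 3 * e) * (1 - e)) by (unfold D; ring).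
        rewrite Hb. unfold D. ring. }
      rewrite Hs. lra.
    - pose proof (E2' y 0%Z ltac:(lra)) as E. rewrite Rplus_0_r in E.
      rewrite E, tentf_lo by lra.
      assert (Hs : (1 - a i * del - (1 - e)) / (1 - del - (1 - e)) = b i).
      { apply Rmult_eq_reg_r with (e - del); [|lra].
        replace ((1 - a i * del - (1 - e)) / (1 - del - (1 - e)) * (e - del)) with (e - a i * del) by (field; lra).
        apply Rmult_eq_reg_r with D; [|lra].
        replace (b i * (e - del) * D) with (b i * (e * D - del * D)) by ring.
        replace ((e - a i * del) * D) with (e * D - a i * del * D) by ring.
        rewrite HdD, Hda.
        replace (b i * (e * D - e * e)) with (b i * (1 - 3 * e) * e) by (unfold D; ring).
        rewrite Hb. unfold D. ring. }
      rewrite Hs.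
      assert (Hz : 1 - e <= 1 - e + (y - (1 - e)) * b i <= 1) by nra.
      pose proof (E1' (1 - e + (y - (1 - e)) * b i) 0%Z ltac:(lra)) as E'. rewrite Rplus_0_r in *.
      rewrite E', tentf_out by lra. lra. }
  set (lam := (1 - e) / e). assert (Hlam : lam * e = 1 - e) by (unfold lam; field; lra).
  set (mu := e / (1 - e)). assert (Hmu : mu * (1 - e) = e) by (unfold mu; field; lra).
  assert (Ev : forall y n, 0 <= y <= 1 -> fw v (y + IZR n) = tentf 0 (1 - e) e 1 y + IZR n + e).
  { intros y n Hy. simpl. rewrite (proj1 (EV0 y n ltac:(lra))), Ev0. auto. }
  assert (Hv1 : forall y, - e <= y <= 0 -> fw v y = e + y * lam).
  { intros y Hy. pose proof (Ev (y + 1) (-1)%Z ltac:(lra)) as E. replace (y + 1 + -1) with y in E by lra.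
    rewrite E, tentf_hi by lra. unfold lam. field. lra. }
  assert (Hv2 : forall y, 0 <= y <= 1 - e -> fw v y = e + y * mu).
  { intros y Hy. pose proof (Ev y 0%Z ltac:(lra)) as E. rewrite Rplus_0_r in E.
    rewrite E, tentf_lo by lra. unfold mu. field. lra. }
  assert (Hv3 : forall y, 1 - e <= y <= 1 -> fw v y = 2 * e + (y - (1 - e)) * lam).
  { intros y Hy. pose proof (Ev y 0%Z ltac:(lra)) as E. rewrite Rplus_0_r in E.
    rewrite E, tentf_hi by lra. unfold lam. field. lra. }
  clear Ev Ev0 EV0 E1 E2 E1' E2' S1 S2 Eu.
  assert (Hfd : del * lam = e + del).
  { apply Rmult_eq_reg_r with D; [|lra].
    replace (del * lam * D) with (lam * (del * D)) by ring.
    replace ((e + del) * D) with (e * D + del * D) by ring. rewrite HdD.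
    replace (lam * (e * e)) with (lam * e * e) by ring. rewrite Hlam. unfold D. ring. }
  assert (Hfp : p * mu = p - e).
  { apply Rmult_eq_reg_r with D; [|lra].
    replace (p * mu * D) with (mu * (p * D)) by ring.
    replace ((p - e) * D) with (p * D - e * D) by ring. rewrite HpD.
    replace (mu * (e * (1 - e))) with (mu * (1 - e) * e) by ring. rewrite Hmu. unfold D. ring. }
  assert (Hp2 : p <= 2 * e) by (unfold D in *; nra).
  assert (Hlam0 : 0 < lam) by (unfold lam; apply Rdiv_lt_0_compat; lra).
  assert (Hmu0 : 0 < mu) by (unfold mu; apply Rdiv_lt_0_compat; lra).
  (* The interval is cut at 0, [p] and [1 - e]. Its parts on either side of [p] are invariant under
     [v], so [u] has the same affine formula at [y] and at [v y]; as [u] fixes 0 and [1 - e], so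
     does [v] at [y] and at [u y]. *)
  assert (Hfund : forall y, - del <= y <= 1 - del -> fw u (fw v y) = fw v (fw u y) + t i).
  { intros y Hy.
    assert (Hcase : - del <= y <= 0 \/ 0 <= y <= p \/ p <= y <= 1 - e \/ 1 - e <= y <= 1 - del) by lra.
    destruct Hcase as [H|[H|[H|H]]].
    - rewrite (Hu1 y), (Hv1 y), (Hv1 (a i * y)), Hu1 by (try lra; nra). nra.
    - rewrite (Hu1 y), (Hv2 y), (Hv2 (a i * y)), Hu1 by (try lra; nra). nra.
    - rewrite (Hu2 y), (Hv2 y), Hv2, Hu2 by (try lra; nra).
      replace (1 - e + (e + y * mu - (1 - e)) * b i) with
        (1 - e - b i * (1 - 3 * e) + (y - (1 - e)) * b i * mu
           + (mu * (1 - e) - e) * b i) by ring.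
      rewrite Hb, Hmu.
      replace (e + (1 - e + (y - (1 - e)) * b i) * mu) with
        (e + mu * (1 - e) + (y - (1 - e)) * b i * mu) by ring. rewrite Hmu. lra.
    - rewrite (Hu2 y), (Hv3 y), Hv3, Hu2 by (try lra; nra).
      replace (1 - e + (2 * e + (y - (1 - e)) * lam - (1 - e)) * b i) with
        (1 - e - b i * (1 - 3 * e) + (y - (1 - e)) * b i * lam) by ring.
      rewrite Hb. lra. }
  intros y. destruct (integer_translate (- del) y) as [n Hn].
  replace y with (y - IZR n + IZR n) by lra.
  rewrite !periodic_IZR, Hfund by (auto; lra). lra.
Qed.
End Translation.

(** * The presentation attached to an upper cut *)

Lemma eqG_mono (Rl Rl' : word -> Prop) u v : (forall r, Rl r -> Rl' r) -> eqG Rl u v -> eqG Rl' u v.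
Proof.
  intros H E. induction E.
  - apply eqG_refl.
  - apply eqG_sym; auto.
  - eapply eqG_trans; eauto.
  - apply eqG_ctx; auto.
  - apply eqG_free.
  - apply eqG_rel; auto.
Qed.

(** A derivation is finite. This yields the uniform [T < 1] in [relators_lower], which the whole
    family of relators would not allow. *)
Lemma eqG_bounded (A : nat -> Prop) (f : nat -> word) u v :
  eqG (fun r => exists i, A i /\ r = f i) u v ->
  exists N, eqG (fun r => exists i, (i < N)%nat /\ A i /\ r = f i) u v.
Proof.
  intros E. induction E as [w|u v _ [N IH]|u v w _ [N IH1] _ [M IH2]|a b u v _ [N IH]|l|r [i [Hi ->]]].
  - exists 0%nat. apply eqG_refl.
  - exists N. apply eqG_sym; auto.
  - exists (N + M)%nat. apply eqG_trans with v.
    + refine (eqG_mono _ _ _ _ _ IH1). intros r [i [Hi H]]. exists i. split; [lia|auto].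
    + refine (eqG_mono _ _ _ _ _ IH2). intros r [i [Hi H]]. exists i. split; [lia|auto].
  - exists N. apply eqG_ctx; auto.
  - exists 0%nat. apply eqG_free.
  - exists (S i). apply eqG_rel. exists i. auto.
Qed.

(** The index codes the fraction itself, as [p1 i / p2 i]. Each fraction has its own commutator
    because the translation that it must realize depends on the fraction. *)
Definition relator (i : nat) : word :=
  wpow (gen 0) (p2 i) ++ winv (wpow (trans_word i) (p1 i)).
Definition relators (beta : R) (r : word) : Prop :=
  exists i, UC beta (p1 i) (p2 i) /\ r = relator i.

Lemma over_gen j : (j < 8)%nat -> over 8 (gen j).
Proof. intros H. constructor; [exact H|constructor]. Qed.
Lemma over_trans_word i : over 8 (trans_word i).
Proof.
  assert (H : forall a, (a + 2 < 8)%nat -> over 8 (shifted_word a i)).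
  { intros a Ha. apply over_comm; [apply over_app; [|apply over_app]|];
      try apply over_winv; try apply over_wpow; apply over_gen; lia. }
  apply over_comm; [apply over_app; apply H; lia|apply over_gen; lia].
Qed.

Lemma relators_recursive beta :
  Sg 2 (fun v => UC beta (nth 0 v 0%nat) (nth 1 v 0%nat)) -> recursive_presentation 8 (relators beta).
Proof.
  intros HUC. split.
  - intros r [i [_ ->]]. apply over_app; [|apply over_winv]; apply over_wpow;
      [apply over_gen; lia|apply over_trans_word].
  - apply RE_Sg.
    assert (HC : Comp 1 (fun v => wcode (relator (nth 0 v 0%nat)))).
    { assert (Hs : forall a, Comp 1 (fun v => wcode (shifted_word a (nth 0 v 0%nat)))).
      { intros a. unfold shifted_word.
        apply Comp_ext with (fun v => ccomm (capp (cinv (cpow (wcode (gen a)) (nth 0 v 0%nat)))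
           (capp (wcode (gen (a + 2))) (cpow (wcode (gen a)) (nth 0 v 0%nat)))) (wcode (gen (a + 1)))).
        - intros v _. rewrite wcode_comm, !wcode_app, wcode_inv, !wcode_pow. auto.
        - comp. }
      pose proof (Hs 2%nat) as H2. pose proof (Hs 5%nat) as H5.
      apply Comp_ext with (fun v => capp (cpow (wcode (gen 0)) (p2 (nth 0 v 0%nat)))
        (cinv (cpow (ccomm (capp (wcode (shifted_word 2 (nth 0 v 0%nat)))
                                 (wcode (shifted_word 5 (nth 0 v 0%nat)))) (wcode (gen 1)))
                    (p1 (nth 0 v 0%nat))))).
      - intros v _. unfold relator, trans_word.
        rewrite wcode_app, wcode_inv, !wcode_pow, wcode_comm, wcode_app. auto.
      - comp. }
    apply Sg_ext with (fun v => exists i, UC beta (p1 i) (p2 i) /\ nth 0 v 0%nat = wcode (relator i)).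
    + intros v _. split.
      * intros [i [Hi E]]. exists (relator i). split; auto. exists i; auto.
      * intros [r [[i [Hi ->]] E]]. exists i; auto.
    + apply Sg_ex, Sg_and; cbv beta.
      * apply (Sg_Env _ 2 _ (fun w => [p1 (nth 0 w 0%nat); p2 (nth 0 w 0%nat)]) HUC). env.
      * apply Sg_eq; [comp|]. apply (Comp_Env _ 1 _ (fun w => [nth 0 w 0%nat]) HC). env.
Qed.

Lemma relators_upper beta p q : UC beta p q -> forall j,
  exists m, cl_le 8 (relators beta) (wpow (gen 0) (q * j)) m /\ (2 * m <= p * j + 4)%nat.
Proof.
  intros H j.
  destruct (cl_comm_wpow 8 (relators beta) (shifted_word 2 (npair p q) ++ shifted_word 5 (npair p q)) (gen 1)
    (p * j)) as [m [Hm Hle]].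
  - pose proof (over_trans_word (npair p q)) as Ho. apply Forall_app in Ho as [Ho _]. exact Ho.
  - apply over_gen; lia.
  - exists m. split; auto. fold (trans_word (npair p q)) in Hm. rewrite wpow_mul in *.
    assert (E : eqG (relators beta) (wpow (gen 0) q) (wpow (trans_word (npair p q)) p)).
    { apply eqG_quot. apply eqG_rel. exists (npair p q). unfold relator. rewrite p1_npair, p2_npair. auto. }
    rewrite E. exact Hm.
Qed.

Lemma bounded_below_one (f : nat -> R) N : (forall i, f i < 1) ->
  exists T, 0 <= T < 1 /\ forall i, (i < N)%nat -> f i <= T.
Proof.
  intros Hf. induction N as [|N [T [HT H]]].
  - exists 0. split; [lra|]. intros; lia.
  - exists (Rmax T (f N)). specialize (Hf N). split.
    + pose proof (Rmax_l T (f N)). split; [lra|]. apply Rmax_lub_lt; lra.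
    + intros i Hi. assert (i = N \/ (i < N)%nat) as [->|Hi'] by lia; [apply Rmax_r|].
      apply Rle_trans with T; [auto|apply Rmax_l].
Qed.

Lemma act_pow_translation rho w s n x : (forall x, fw (act rho w) x = x + s) ->
  fw (act rho (wpow w n)) x = x + INR n * s.
Proof.
  intros H. induction n as [|n IH]; [simpl; lra|].
  rewrite wpow_S, act_app, IH, H, S_INR. lra.
Qed.

Lemma relators_lower beta n m : 0 <= beta ->
  cl_le 8 (relators beta) (wpow (gen 0) n) m -> INR n * beta <= 2 * INR m.
Proof.
  intros Hb [ps [<- [_ E]]]. apply eqG_bounded in E as [N E].
  pose (ratio := fun i => INR (p2 i) * beta / INR (p1 i)).
  assert (Hratio : forall i, UC beta (p1 i) (p2 i) ->
            0 < INR (p1 i) /\ 0 <= ratio i < 1 /\ INR (p1 i) * ratio i = INR (p2 i) * beta).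
  { intros i [Hq H].
    assert (Hq' : 0 < INR (p2 i)) by (apply lt_0_INR; auto).
    assert (Hlt : INR (p2 i) * beta < INR (p1 i)).
    { apply Rmult_lt_compat_r with (r := INR (p2 i)) in H; auto.
      replace (INR (p1 i) / INR (p2 i) * INR (p2 i)) with (INR (p1 i)) in H by (field; lra). lra. }
    assert (0 <= INR (p2 i) * beta) by (apply Rmult_le_pos; lra).
    unfold ratio. split; [lra|split; [split|field; lra]].
    - apply Rdiv_le_0_compat; lra.
    - apply Rmult_lt_reg_r with (INR (p1 i)); [lra|].
      replace (INR (p2 i) * beta / INR (p1 i) * INR (p1 i)) with (INR (p2 i) * beta) by (field; lra). lra. }
  (* Indices that carry no relator, and below those from [N] on, get the default translation length
     0. *)
  pose (f := fun i => if excluded_middle_informative (UC beta (p1 i) (p2 i)) then ratio i else 0).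
  assert (Hf : forall i, 0 <= f i < 1).
  { intros i. unfold f. destruct (excluded_middle_informative _) as [H|H]; [apply Hratio; auto|lra]. }
  destruct (bounded_below_one f N) as [T [HT HfT]]; [apply Hf|].
  pose (t := fun i => if le_lt_dec N i then 0 else f i).
  destruct (translation_as_comm T t (atrans beta) HT) as [rho [Hper [H0 Htr]]].
  { intros i. unfold t. destruct (le_lt_dec N i); [lra|]. split; [apply Hf|auto]. }
  { intros x. simpl. lra. }
  assert (Hg : forall x, fw (act rho (gen 0)) x = x + beta).
  { intros x. simpl. unfold lact. simpl. rewrite H0. reflexivity. }
  assert (Hrel : forall r, (exists i, (i < N)%nat /\ UC beta (p1 i) (p2 i) /\ r = relator i) ->
            forall x, fw (act rho r) x = x).
  { intros r [i [Hi [HUC ->]]] x. unfold relator. rewrite act_app, act_winv.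
    rewrite (act_pow_translation rho _ beta); auto.
    rewrite <- (fw_bw (act rho (wpow (trans_word i) (p1 i))) x) at 2.
    rewrite (act_pow_translation rho (trans_word i) (t i)); auto.
    assert (Ht : t i = ratio i).
    { unfold t, f. destruct (le_lt_dec N i); [lia|].
      destruct (excluded_middle_informative _); tauto. }
    rewrite Ht. destruct (Hratio i HUC) as [_ [_ ->]]. auto. }
  pose proof (eqG_act rho _ _ _ Hrel E 0) as Heq.
  rewrite (act_pow_translation rho _ beta) in Heq by auto.
  pose proof (act_comm_prod_le rho ps 0 Hper) as Hle. unfold comm_prod in Hle. rewrite <- Heq in Hle. lra.
Qed.

Lemma right_computable_SCLrp alpha : 0 <= alpha -> right_computable alpha -> SCLrp alpha.
Proof.
  intros Ha Hrc. apply right_computable_UC in Hrc; auto.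
  exists 8%nat, (relators (2 * alpha)), (gen 0). split; [|split].
  - apply relators_recursive.
    (* The condition [2 alpha < p/q] is [alpha < p/(2q)]. *)
    apply Sg_ext with (fun v => UC alpha (nth 0 v 0%nat) (nth 1 v 0%nat + nth 1 v 0%nat)).
    + intros v _. unfold UC. rewrite plus_INR.
      generalize (nth 0 v 0%nat) as p, (nth 1 v 0%nat) as q. intros p q.
      split; intros [Hq H]; (split; [lia|]);
        assert (Hq' : 0 < INR q) by (apply lt_0_INR; lia);
        replace (INR p / INR q) with (2 * (INR p / (INR q + INR q))) in * by (field; lra); lra.
    + apply (Sg_Env _ 2 _ (fun v => [nth 0 v 0%nat; (nth 1 v 0 + nth 1 v 0)%nat]) Hrc). env.
  - apply over_gen. lia.
  - apply scl_is_intro; auto.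
    + intros n m H. apply relators_lower in H; lra.
    + intros p q H. apply relators_upper; auto.
Qed.

Lemma SCLrp_iff alpha : SCLrp alpha <-> (0 <= alpha /\ right_computable alpha).
Proof.
  split; [apply SCLrp_right_computable|]. intros [H1 H2]. apply right_computable_SCLrp; auto.
Qed.

(** * A semi-decidable set with non-semi-decidable complement *)
Local Open Scope nat_scope.

Definition lcodes (v : list nat) : nat := fold_right (fun x r => S (npair x r)) 0 v.

Fixpoint pcode (f : prf) : nat :=
  match f with
  | PZero => npair 0 0
  | PSucc => npair 1 0
  | PProj i => npair 2 i
  | PComp f gs => npair 3 (npair (pcode f) (lcodes (map pcode gs)))
  | PPrec f g => npair 4 (npair (pcode f) (pcode g))
  | PMu f => npair 5 (pcode f)
  end.

(* The judgements of the evaluation relation, on codes: [fact 0] is [peval f v y], [fact 1] its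
   pointwise version for lists of functions, [fact 2] says that [f (m :: v)] is positive for all
   [m < n], and [fact 3] is [nth i v = y]. *)
Definition fact (tag x y z : nat) : nat := npair tag (npair x (npair y z)).

Definition fact_base (c : nat) : Prop :=
  (exists v, c = fact 0 (npair 0 0) v 0) \/
  (exists x v, c = fact 0 (npair 1 0) (S (npair x v)) (S x)) \/
  (exists v, c = fact 1 0 v 0) \/
  (exists f v, c = fact 2 f v 0) \/
  (exists i, c = fact 3 i 0 0) \/
  (exists y v, c = fact 3 0 (S (npair y v)) y).

Definition fact_step (p q c : nat) : Prop :=
  (exists i x v y, p = fact 3 i v y /\ c = fact 3 (S i) (S (npair x v)) y) \/
  (exists i v y, p = fact 3 i v y /\ c = fact 0 (npair 2 i) v y) \/
  (exists g gs v y ys, p = fact 0 g v y /\ q = fact 1 gs v ys /\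
     c = fact 1 (S (npair g gs)) v (S (npair y ys))) \/
  (exists f gs v ys z, p = fact 1 gs v ys /\ q = fact 0 f ys z /\
     c = fact 0 (npair 3 (npair f gs)) v z) \/
  (exists f g v z, p = fact 0 f v z /\ c = fact 0 (npair 4 (npair f g)) (S (npair 0 v)) z) \/
  (exists f g n v y z, p = fact 0 (npair 4 (npair f g)) (S (npair n v)) y /\
     q = fact 0 g (S (npair n (S (npair y v)))) z /\
     c = fact 0 (npair 4 (npair f g)) (S (npair (S n) v)) z) \/
  (exists f v n k, p = fact 2 f v n /\ q = fact 0 f (S (npair n v)) (S k) /\ c = fact 2 f v (S n)) \/
  (exists f v n, p = fact 2 f v n /\ q = fact 0 f (S (npair n v)) 0 /\ c = fact 0 (npair 5 f) v n).

(** The diagonal argument needs one Sigma_1 relation for all programs at once, hence evaluation as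
    an inference system on codes. *)
Definition derivable : nat -> Prop := clos fact_base fact_step.

Lemma derivable_Sg : Sg 1 (fun v => derivable (nth 0 v 0)).
Proof. apply clos_Sg; unfold fact_base, fact_step, fact; sg. Qed.

Lemma derivable_nth i v : derivable (fact 3 i (lcodes v) (nth i v 0)).
Proof.
  revert i. induction v as [|x v IH]; intros i.
  (* Reading past the end of the list gives the default 0, which is the fifth axiom. *)
  - destruct i; constructor; right; right; right; right; left; eexists; reflexivity.
  - destruct i as [|i].
    + constructor. do 5 right. simpl. eauto.
    + apply clos_step with (2 := IH i) (3 := IH i). left. simpl. repeat eexists.
Qed.

Lemma derivable_peval f v y : peval f v y -> derivable (fact 0 (pcode f) (lcodes v) y).
Proof.
  revert f v y. apply (peval_ind_nested (fun f v y => derivable (fact 0 (pcode f) (lcodes v) y))).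
  - intros v. constructor. left. eexists. reflexivity.
  - intros x v. constructor. right. left. repeat eexists.
  - intros i v. apply clos_step with (2 := derivable_nth i v) (3 := derivable_nth i v).
    right. left. repeat eexists.
  - intros f gs v ys z _ F _ IH.
    assert (H : derivable (fact 1 (lcodes (map pcode gs)) (lcodes v) (lcodes ys))).
    { clear -F. induction F as [|g y gs ys Hg _ IH].
      - constructor. do 2 right. left. eexists. reflexivity.
      - apply clos_step with (2 := Hg) (3 := IH). do 2 right. left. simpl. repeat eexists. }
    apply clos_step with (2 := H) (3 := IH). do 3 right. left. simpl. repeat eexists.
  - intros f g v z _ IH. apply clos_step with (2 := IH) (3 := IH).
    do 4 right. left. simpl. repeat eexists.
  - intros f g n v y z _ IH1 _ IH2. apply clos_step with (2 := IH1) (3 := IH2).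
    do 5 right. left. simpl. repeat eexists.
  - intros f v n _ IH Hlt.
    assert (H : forall m, m <= n -> derivable (fact 2 (pcode f) (lcodes v) m)).
    { induction m as [|m IHm]; intros Hm.
      - constructor. do 3 right. left. repeat eexists.
      - destruct (Hlt m Hm) as [k [_ Hk]].
        apply clos_step with (2 := IHm ltac:(lia)) (3 := Hk). do 6 right. left. simpl. repeat eexists. }
    apply clos_step with (2 := H n ltac:(lia)) (3 := IH). do 7 right. simpl. repeat eexists.
Qed.

(** Soundness is claimed only for numbers that code actual programs and lists. The four judgements
    are treated together because their rules call one another. *)
Definition meaning (c : nat) : Prop := forall x y z,
  (c = fact 0 x y z -> forall F V, x = pcode F -> y = lcodes V -> peval F V z) /\
  (c = fact 1 x y z -> forall Gs V, x = lcodes (map pcode Gs) -> y = lcodes V ->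
     exists Ys, z = lcodes Ys /\ Forall2 (fun G Y => peval G V Y) Gs Ys) /\
  (c = fact 2 x y z -> forall F V, x = pcode F -> y = lcodes V ->
     forall m, m < z -> exists k, peval F (m :: V) (S k)) /\
  (c = fact 3 x y z -> forall V, y = lcodes V -> nth x V 0 = z).

Lemma meaning0 x y z F V : meaning (fact 0 x y z) -> x = pcode F -> y = lcodes V -> peval F V z.
Proof. intros H. apply (H x y z). auto. Qed.

Lemma derivable_sound c : derivable c -> meaning c.
Proof.
  intros H. induction H as [c Hc|p q c Hc Hp IHp Hq IHq].
  - unfold fact_base in Hc.
    repeat match goal with
    | H : _ \/ _ |- _ => destruct H
    | H : exists _, _ |- _ => destruct H
    end; subst; intros a b d; (split; [|split; [|split]]); intros E; unfold fact in E; npair_inj;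
      try discriminate; subst.
    + intros F V HF HV. destruct F; simpl in HF; npair_inj; try discriminate. constructor.
    + intros F V HF HV. destruct F; simpl in HF; npair_inj; try discriminate.
      destruct V; simpl in HV; [discriminate|]. npair_inj. subst. constructor.
    + intros [|G Gs] V HG HV; [|discriminate]. exists []. auto.
    + intros F V HF HV m Hm. lia.
    + intros V HV. destruct V; [|discriminate]. destruct a; auto.
    + intros V HV. destruct V; simpl in HV; [discriminate|]. npair_inj. subst. auto.
  - unfold fact_step in Hc.
    repeat match goal with
    | H : _ \/ _ |- _ => destruct H
    | H : exists _, _ |- _ => destruct H
    | H : _ /\ _ |- _ => destruct H
    end; subst; intros a b d; (split; [|split; [|split]]); intros E; unfold fact in E; npair_inj;
      try discriminate; subst.
    + intros V HV. destruct V as [|y V]; simpl in HV; [discriminate|]. npair_inj. subst.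
      simpl. eapply (IHp _ _ _); [reflexivity|auto].
    + intros F V HF HV. destruct F; simpl in HF; npair_inj; try discriminate. subst.
      match goal with |- peval _ _ ?y => assert (E : nth n V 0 = y) end.
      { eapply (IHp _ _ _); [reflexivity|auto]. }
      rewrite <- E. constructor.
    + intros [|G Gs] V HG HV; simpl in HG; [discriminate|]. npair_inj. subst.
      destruct (proj1 (proj2 (IHq _ _ _)) eq_refl Gs V eq_refl eq_refl) as [Ys [-> HYs]].
      eexists (_ :: Ys). split; [reflexivity|]. constructor; auto.
      eapply meaning0; eauto.
    + intros F V HF HV. destruct F as [| |i|F Gs|F G|F]; simpl in HF; npair_inj; try discriminate. subst.
      destruct (proj1 (proj2 (IHp _ _ _)) eq_refl Gs V eq_refl eq_refl) as [Ys [-> HYs]].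
      econstructor; eauto. eapply meaning0; eauto.
    + intros F V HF HV. destruct F as [| |i|F Gs|F G|F]; simpl in HF; npair_inj; try discriminate. subst.
      destruct V as [|y V]; simpl in HV; [discriminate|]. npair_inj. subst.
      constructor. eapply meaning0; eauto.
    + intros F V HF HV. destruct F as [| |i|F Gs|F G|F]; simpl in HF; npair_inj; try discriminate. subst.
      destruct V as [|y V]; simpl in HV; [discriminate|]. npair_inj. subst.
      eapply ev_precS.
      * apply (meaning0 _ _ _ (PPrec F G) (_ :: V) IHp); reflexivity.
      * apply (meaning0 _ _ _ G (_ :: _ :: V) IHq); reflexivity.
    + intros F V HF HV m Hm. subst.
      match type of IHp with meaning (fact 2 _ _ ?n) => assert (Hc : m < n \/ m = n) by lia end.
      destruct Hc as [Hlt| ->].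
      * eapply (IHp _ _ _); eauto.
      * eexists. eapply (meaning0 _ _ _ F (_ :: V)); eauto.
    + intros F V HF HV. destruct F as [| |i|F Gs|F G|F]; simpl in HF; npair_inj; try discriminate. subst.
      constructor.
      * eapply (meaning0 _ _ _ F (_ :: V)); eauto.
      * intros m Hm. eapply (IHp _ _ _); eauto.
Qed.

(** The diagonal halting problem; [S (npair e 0)] is the code of the list [[e]]. *)
Definition halting (e : nat) : Prop := exists y, derivable (fact 0 e (S (npair e 0)) y).

Lemma halting_Sg : Sg 1 (fun v => halting (nth 0 v 0)).
Proof.
  pose proof derivable_Sg as H. unfold halting, fact. apply Sg_ex. cbv beta.
  apply (Sg_Env _ 1 _ (fun w => [npair 0 (npair (nth 0 (tl w) 0)
    (npair (S (npair (nth 0 (tl w) 0) 0)) (nth 0 w 0)))]) H). env.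
Qed.

Lemma halting_pcode f : halting (pcode f) <-> exists y, peval f [pcode f] y.
Proof.
  split; intros [y H]; exists y.
  - eapply meaning0; [apply derivable_sound; exact H|reflexivity|reflexivity].
  - apply derivable_peval in H. exact H.
Qed.

(** A program semi-deciding the complement would halt on its own code exactly when it does not. *)
Lemma not_halting_not_Sg : ~ Sg 1 (fun v => ~ halting (nth 0 v 0)).
Proof.
  intros H. apply (RE_Sg (fun e => ~ halting e)) in H as [f Hf].
  specialize (Hf (pcode f)). rewrite <- halting_pcode in Hf. tauto.
Qed.

Lemma halting_ex : exists e, halting e.
Proof. exists (pcode PZero). apply halting_pcode. exists 0. constructor. Qed.

(** * Sums and differences *)
Local Open Scope R_scope.

(** The slack [p/q - alpha - beta] is shared between two rational upper bounds. Conversely both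
    bounds are strict, so a weak inequality, cleared of denominators, suffices. *)
Lemma UC_plus alpha beta p q : 0 <= alpha -> 0 <= beta ->
  UC (alpha + beta) p q <-> (0 < q)%nat /\ exists a b c d, UC alpha a b /\ UC beta c d /\
    ((a * d + c * b) * q <= p * (b * d))%nat.
Proof.
  intros Ha Hb. split.
  - intros [Hq H]. split; auto. set (r := INR p / INR q) in *.
    destruct (rational_between alpha (alpha + (r - alpha - beta) / 2)) as [a [b [Hb0 Hab]]]; [auto|lra|].
    destruct (rational_between beta (beta + (r - alpha - beta) / 2)) as [c [d [Hd0 Hcd]]]; [auto|lra|].
    exists a, b, c, d. split; [split; tauto|split; [split; tauto|]].
    apply INR_le. rewrite !mult_INR, plus_INR, !mult_INR.
    apply lt_0_INR in Hq, Hb0, Hd0.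
    assert (H1 : INR a / INR b + INR c / INR d <= r) by lra.
    assert (H2 : 0 < INR b * INR d * INR q) by auto using Rmult_lt_0_compat.
    apply Rmult_le_compat_r with (r := INR b * INR d * INR q) in H1; [|lra].
    replace ((INR a / INR b + INR c / INR d) * (INR b * INR d * INR q)) with
      ((INR a * INR d + INR c * INR b) * INR q) in H1 by (field; lra).
    replace (r * (INR b * INR d * INR q)) with (INR p * (INR b * INR d)) in H1 by (unfold r; field; lra).
    exact H1.
  - intros [Hq [a [b [c [d [[Hb0 H1] [[Hd0 H2] H]]]]]]]. split; auto.
    apply le_INR in H. rewrite !mult_INR, plus_INR, !mult_INR in H.
    apply lt_0_INR in Hq, Hb0, Hd0.
    apply Rlt_le_trans with (INR a / INR b + INR c / INR d); [lra|].
    assert (H3 : 0 < INR b * INR d * INR q) by auto using Rmult_lt_0_compat.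
    apply Rmult_le_reg_r with (INR b * INR d * INR q); auto.
    replace ((INR a / INR b + INR c / INR d) * (INR b * INR d * INR q)) with
      ((INR a * INR d + INR c * INR b) * INR q) by (field; lra).
    replace (INR p / INR q * (INR b * INR d * INR q)) with (INR p * (INR b * INR d)) by (field; lra).
    exact H.
Qed.

Lemma SCLrp_plus alpha beta : SCLrp alpha -> SCLrp beta -> SCLrp (alpha + beta).
Proof.
  rewrite !SCLrp_iff. intros [Ha HA] [Hb HB]. split; [lra|].
  apply right_computable_UC in HA, HB; auto. apply right_computable_UC; [lra|].
  refine (Sg_ext _ _ _ (fun v _ => iff_sym (UC_plus alpha beta _ _ Ha Hb)) _).
  apply Sg_and; [sg|]. apply Sg_ex, Sg_ex, Sg_ex, Sg_ex, Sg_and; [|apply Sg_and; [|sg]]; cbv beta.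
  - apply (Sg_Env _ 2 _ (fun w => [nth 0 (tl (tl (tl w))) 0%nat; nth 0 (tl (tl w)) 0%nat]) HA). env.
  - apply (Sg_Env _ 2 _ (fun w => [nth 0 (tl w) 0%nat; nth 0 w 0%nat]) HB). env.
Qed.

Lemma Comp_pow m X Y : Comp m X -> Comp m Y -> Comp m (fun v => (X v ^ Y v)%nat).
Proof.
  intros HX HY.
  apply Comp_ext with (fun v => nat_rect (fun _ => nat) 1%nat (fun n y => (X v * y)%nat) (Y v)).
  - intros v _. induction (Y v) as [|n IH]; [reflexivity|]. simpl nat_rect. rewrite IH. reflexivity.
  - apply (Comp_prec m (fun _ => 1%nat) (fun w => (X (tl (tl w)) * nth 1 w 0)%nat) Y); comp.
Qed.

Ltac comp_user ::= first [ comp_arith | apply Comp_pow; comp ].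

(* [subsum A N a] says that the binary expansion [0.b_0 b_1 .. b_(N-1)] of [a / 2^N] has
   [b_i = 1] only for indices [i] in [A]. *)
Inductive subsum (A : nat -> Prop) : nat -> nat -> Prop :=
  | subsum_0 : subsum A 0 0
  | subsum_skip N a : subsum A N a -> subsum A (S N) (2 * a)
  | subsum_take N a : A N -> subsum A N a -> subsum A (S N) (2 * a + 1).

(** The set may depend on a parameter, which the closure carries along unchanged:
    [halting_real_not_Sg] removes a variable [n] from the halting set. *)
Lemma subsum_Sg (A : nat -> nat -> Prop) : Sg 2 (fun v => A (nth 0 v 0%nat) (nth 1 v 0%nat)) ->
  Sg 3 (fun v => subsum (A (nth 0 v 0%nat)) (nth 1 v 0%nat) (nth 2 v 0%nat)).
Proof.
  intros HA.
  pose (B := fun c => exists n, c = npair n (npair 0 0)).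
  pose (St := fun p (q : nat) c => exists n N a, p = npair n (npair N a) /\
    (c = npair n (npair (S N) (2 * a)) \/ A n N /\ c = npair n (npair (S N) (2 * a + 1)))).
  assert (HC : Sg 1 (fun v => clos B St (nth 0 v 0%nat))).
  { apply clos_Sg; unfold B, St; [sg|].
    apply Sg_ex, Sg_ex, Sg_ex, Sg_and; [sg|]. apply Sg_or; [sg|]. apply Sg_and; [|sg]. cbv beta.
    apply (Sg_Env _ 2 _ (fun w => [nth 0 (tl (tl w)) 0%nat; nth 0 (tl w) 0%nat]) HA). env. }
  assert (H : forall n N a, clos B St (npair n (npair N a)) <-> subsum (A n) N a).
  { intros n N a. split.
    - remember (npair n (npair N a)) as c eqn:E. intros Hc. revert n N a E.
      induction Hc as [c [m ->]|p q c [m [M [b [-> [->|[HAm ->]]]]]] _ IH _ _];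
        intros n N a E; npair_inj; subst; constructor; auto.
    - intros Hs. induction Hs as [|N a _ IH|N a HN _ IH].
      + constructor. exists n. auto.
      + apply clos_step with (2 := IH) (3 := IH). exists n, N, a. auto.
      + apply clos_step with (2 := IH) (3 := IH). exists n, N, a. auto. }
  refine (Sg_ext _ _ _ (fun v _ => H _ _ _) _).
  apply (Sg_Env _ 1 _ (fun v => [npair (nth 0 v 0%nat) (npair (nth 1 v 0%nat) (nth 2 v 0%nat))]) HC). env.
Qed.

Lemma subsum_lt A N a : subsum A N a -> (a < 2 ^ N)%nat.
Proof. intros H. induction H; simpl; lia. Qed.
Lemma subsum_zero A N : subsum A N 0.
Proof. induction N; [constructor|]. apply (subsum_skip A N 0); auto. Qed.
Lemma subsum_mono (A B : nat -> Prop) N a : (forall i, A i -> B i) -> subsum A N a -> subsum B N a.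
Proof. intros HAB H. induction H; constructor; auto. Qed.
Lemma subsum_extend A N a j : subsum A N a -> subsum A (j + N) (2 ^ j * a).
Proof.
  intros H. induction j as [|j IH]; [simpl; rewrite Nat.add_0_r; auto|].
  replace (2 ^ S j * a)%nat with (2 * (2 ^ j * a))%nat by (simpl; lia). apply subsum_skip. auto.
Qed.
(* Inserting the digit [n] adds [2^-(n+1)]. *)
Lemma subsum_insert (A : nat -> Prop) n N a : A n -> subsum (fun i => A i /\ i <> n) N a ->
  ((N <= n)%nat -> subsum A N a) /\
  ((n < N)%nat -> exists a', subsum A N a' /\ (a' * 2 ^ S n = a * 2 ^ S n + 2 ^ N)%nat).
Proof.
  intros Hn H. induction H as [|N a H [IH1 IH2]|N a [HN HNn] H [IH1 IH2]].
  - split; [constructor|lia].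
  - split; intros HNn; [apply subsum_skip, IH1; lia|].
    destruct (Nat.eq_dec N n) as [->|Hne].
    + exists (2 * a + 1)%nat. split; [apply subsum_take; auto|]. simpl. lia.
    + destruct IH2 as [a' [H1 H2]]; [lia|]. exists (2 * a')%nat. split; [constructor; auto|].
      rewrite <- !Nat.mul_assoc, H2. simpl. lia.
  - split; intros HNn'; [apply subsum_take; auto; apply IH1; lia|].
    destruct IH2 as [a' [H1 H2]]; [lia|]. exists (2 * a' + 1)%nat. split; [constructor; auto|].
    rewrite !Nat.mul_add_distr_r, <- !Nat.mul_assoc, H2. simpl. lia.
Qed.

Definition binval (N a : nat) : R := INR a / 2 ^ N.

Lemma pow2_INR N : INR (2 ^ N) = 2 ^ N.
Proof. rewrite pow_INR. reflexivity. Qed.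
Lemma pow2_pos N : 0 < 2 ^ N.
Proof. apply pow_lt. lra. Qed.

Section HaltingReal.
Variable s : R.
Hypothesis Hs : is_lub (fun x => exists N a, subsum halting N a /\ x = binval N a) s.

Lemma binval_le N a : subsum halting N a -> binval N a <= s.
Proof. intros H. apply Hs. eauto. Qed.

Lemma halting_real_approx x : x < s -> exists N a, subsum halting N a /\ x < binval N a.
Proof.
  intros Hx. apply NNPP. intros Hn. apply (Rlt_not_le _ _ Hx). apply Hs.
  intros y [N [a [H ->]]]. apply Rnot_lt_le. intros Hlt. apply Hn. eauto.
Qed.

Lemma halting_real_bounds : 0 < s <= 1.
Proof.
  split.
  - destruct halting_ex as [e He].
    apply Rlt_le_trans with (binval (S e) 1).
    + unfold binval. pose proof (pow2_pos (S e)). apply Rdiv_lt_0_compat; [simpl; lra|auto].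
    + apply binval_le. apply (subsum_take halting e 0 He). apply subsum_zero.
  - apply Hs. intros y [N [a [H ->]]]. apply subsum_lt in H. apply lt_INR in H.
    rewrite pow2_INR in H. unfold binval. pose proof (pow2_pos N).
    apply Rmult_le_reg_r with (2 ^ N); auto.
    replace (INR a / 2 ^ N * 2 ^ N) with (INR a) by (field; lra). lra.
Qed.

(** The condition is [1 - p/q < s], and [s] is a supremum of semi-decidable finite sums, so one of
    them already exceeds [1 - p/q]. *)
Lemma one_minus_halting_real_Sg : Sg 2 (fun v => UC (1 - s) (nth 0 v 0%nat) (nth 1 v 0%nat)).
Proof.
  assert (HS : Sg 3 (fun v => subsum halting (nth 1 v 0%nat) (nth 2 v 0%nat))).
  { apply (subsum_Sg (fun _ => halting)).
    apply (Sg_Env _ 1 _ (fun v => [nth 1 v 0%nat]) halting_Sg). env. }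
  apply Sg_ext with (fun v => (0 < nth 1 v 0)%nat /\ exists N a,
    (nth 1 v 0 * 2 ^ N < nth 0 v 0 * 2 ^ N + a * nth 1 v 0)%nat /\ subsum halting N a).
  - intros v _. generalize (nth 0 v 0%nat) as p, (nth 1 v 0%nat) as q. intros p q. unfold UC.
    assert (Heq : forall N a, (0 < q)%nat ->
       (1 - INR p / INR q < binval N a <-> (q * 2 ^ N < p * 2 ^ N + a * q)%nat)).
    { intros N a Hq. apply lt_0_INR in Hq. pose proof (pow2_pos N) as HN.
      assert (HqN : 0 < INR q * 2 ^ N) by (apply Rmult_lt_0_compat; auto).
      assert (E1 : (1 - INR p / INR q) * (INR q * 2 ^ N) = INR q * 2 ^ N - INR p * 2 ^ N) by (field; lra).
      assert (E2 : binval N a * (INR q * 2 ^ N) = INR a * INR q) by (unfold binval; field; lra).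
      split; intros H.
      - apply INR_lt. rewrite plus_INR, !mult_INR, !pow2_INR.
        apply Rmult_lt_compat_r with (r := INR q * 2 ^ N) in H; auto. lra.
      - apply lt_INR in H. rewrite plus_INR, !mult_INR, !pow2_INR in H.
        apply Rmult_lt_reg_r with (INR q * 2 ^ N); auto. lra. }
    split.
    + intros [Hq [N [a [H1 H2]]]]. split; auto. apply Heq in H1; auto. apply binval_le in H2. lra.
    + intros [Hq H]. split; auto. destruct (halting_real_approx (1 - INR p / INR q)) as [N [a [H1 H2]]]; [lra|].
      exists N, a. split; auto. apply Heq; auto.
  - apply Sg_and; [sg|]. apply Sg_ex, Sg_ex, Sg_and; [sg|]. cbv beta.
    apply (Sg_Env _ 3 _ (fun w => [0%nat; nth 0 (tl w) 0%nat; nth 0 w 0%nat]) HS). env.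
Qed.

(** Rational upper bounds of [s] would certify non-halting: [n] does not halt iff some sum of digits
    avoiding [n] comes within [2^-(n+1)] of a fraction above [s]. Were [n] halting, inserting its
    digit would give a sum of at least that fraction, hence above [s]. *)
Lemma halting_real_not_Sg : ~ Sg 2 (fun v => UC s (nth 0 v 0%nat) (nth 1 v 0%nat)).
Proof.
  intros HU. apply not_halting_not_Sg.
  assert (HS : Sg 3 (fun v => subsum (fun i => halting i /\ i <> nth 0 v 0%nat) (nth 1 v 0%nat) (nth 2 v 0%nat))).
  { apply (subsum_Sg (fun n i => halting i /\ i <> n)). apply Sg_and.
    - apply (Sg_Env _ 1 _ (fun v => [nth 1 v 0%nat]) halting_Sg). env.
    - apply Sg_ext with (fun v => (nth 1 v 0 < nth 0 v 0 \/ nth 0 v 0 < nth 1 v 0)%nat); [intros; lia|sg]. }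
  apply Sg_ext with (fun v => exists N a p q, (nth 0 v 0 < N)%nat /\
    ((p * (2 ^ N * 2 ^ S (nth 0 v 0)) <= (a * 2 ^ S (nth 0 v 0) + 2 ^ N) * q)%nat /\
     (subsum (fun i => halting i /\ i <> nth 0 v 0%nat) N a /\ UC s p q))).
  - intros v _. generalize (nth 0 v 0%nat) as n. intros n.
    assert (Heq : forall N a p q, (0 < q)%nat ->
       (INR p / INR q <= binval N a + / 2 ^ S n <-> (p * (2 ^ N * 2 ^ S n) <= (a * 2 ^ S n + 2 ^ N) * q)%nat)).
    { intros N a p q Hq. apply lt_0_INR in Hq. pose proof (pow2_pos N) as HN. pose proof (pow2_pos (S n)) as Hn.
      assert (Hpos : 0 < INR q * (2 ^ N * 2 ^ S n)) by auto using Rmult_lt_0_compat.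
      assert (E1 : INR p / INR q * (INR q * (2 ^ N * 2 ^ S n)) = INR p * (2 ^ N * 2 ^ S n)) by (field; lra).
      assert (E2 : (binval N a + / 2 ^ S n) * (INR q * (2 ^ N * 2 ^ S n)) = (INR a * 2 ^ S n + 2 ^ N) * INR q)
        by (unfold binval; field; lra).
      split; intros H.
      - apply INR_le. rewrite !mult_INR, plus_INR, !mult_INR, !pow2_INR.
        apply Rmult_le_compat_r with (r := INR q * (2 ^ N * 2 ^ S n)) in H; lra.
      - apply le_INR in H. rewrite !mult_INR, plus_INR, !mult_INR, !pow2_INR in H.
        apply Rmult_le_reg_r with (INR q * (2 ^ N * 2 ^ S n)); lra. }
    split.
    + intros [N [a [p [q [HN [H1 [H2 [Hq H3]]]]]]]] Hh. apply Heq in H1; auto.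
      destruct (subsum_insert halting n N a Hh H2) as [_ H]. destruct (H HN) as [a' [H4 H5]].
      apply binval_le in H4. apply (f_equal INR) in H5.
      rewrite plus_INR, !mult_INR, !pow2_INR in H5. pose proof (pow2_pos N). pose proof (pow2_pos (S n)).
      assert (binval N a' = binval N a + / 2 ^ S n); [|lra].
      unfold binval. apply Rmult_eq_reg_r with (2 ^ S n); [|lra].
      replace ((INR a / 2 ^ N + / 2 ^ S n) * 2 ^ S n) with ((INR a * 2 ^ S n + 2 ^ N) / 2 ^ N) by (field; lra).
      rewrite <- H5. field. lra.
    + intros Hh. pose proof (pow2_pos (S n)) as Hn.
      assert (Hinv : 0 < / 2 ^ S n) by (apply Rinv_0_lt_compat; auto).
      destruct (halting_real_approx (s - / 2 ^ S n)) as [N [a [H1 H2]]]; [lra|].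
      destruct (rational_between s (binval N a + / 2 ^ S n)) as [p [q [Hq Hpq]]];
        [apply Rlt_le, halting_real_bounds|lra|].
      (* Appending [S n] zero digits makes the expansion longer than [n] without changing its
         value. *)
      exists (S n + N)%nat, (2 ^ S n * a)%nat, p, q. split; [lia|]. split; [|split; [|split; tauto]].
      * apply Heq; auto.
        replace (binval (S n + N) (2 ^ S n * a)) with (binval N a); [lra|].
        unfold binval. rewrite mult_INR, pow2_INR, pow_add. pose proof (pow2_pos N). field.
        split; lra.
      * apply subsum_mono with halting; [intros i Hi; split; auto; intros ->; auto|].
        apply subsum_extend; auto.
  - apply Sg_ex, Sg_ex, Sg_ex, Sg_ex, Sg_and; [sg|]. apply Sg_and; [sg|]. apply Sg_and; cbv beta.
    + apply (Sg_Env _ 3 _ (fun w => [nth 0 (tl (tl (tl (tl w)))) 0%nat; nth 0 (tl (tl (tl w))) 0%nat;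
        nth 0 (tl (tl w)) 0%nat]) HS). env.
    + apply (Sg_Env _ 2 _ (fun w => [nth 0 (tl w) 0%nat; nth 0 w 0%nat]) HU). env.
Qed.
End HaltingReal.

Lemma SCLrp_not_closed_under_subtraction :
  exists alpha beta, SCLrp alpha /\ SCLrp beta /\ alpha - beta > 0 /\ ~ SCLrp (alpha - beta).
Proof.
  destruct (completeness (fun x => exists N a, subsum halting N a /\ x = binval N a)) as [s Hs].
  - exists 1. intros y [N [a [H ->]]]. apply subsum_lt in H. apply lt_INR in H.
    rewrite pow2_INR in H. unfold binval. pose proof (pow2_pos N).
    apply Rmult_le_reg_r with (2 ^ N); auto.
    replace (INR a / 2 ^ N * 2 ^ N) with (INR a) by (field; lra). lra.
  - exists (binval 0 0), 0%nat, 0%nat. split; [constructor|auto].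
  - pose proof (halting_real_bounds s Hs) as Hb.
    exists 1, (1 - s). replace (1 - (1 - s)) with s by lra.
    split; [|split; [|split; [lra|]]].
    + apply right_computable_SCLrp; [lra|]. apply right_computable_UC; [lra|].
      apply Sg_ext with (fun v => (0 < nth 1 v 0 /\ nth 1 v 0 < nth 0 v 0)%nat); [|sg].
      intros v _. generalize (nth 0 v 0%nat) as p, (nth 1 v 0%nat) as q. intros p q. unfold UC.
      replace 1 with (INR 1 / INR 1) by (simpl; field).
      split; intros [Hq H]; (split; auto); [apply quot_lt; lia|apply quot_lt in H; lia].
    + apply right_computable_SCLrp; [lra|]. apply right_computable_UC; [lra|].
      apply one_minus_halting_real_Sg; auto.
    + intros H. apply SCLrp_right_computable in H as [_ H]. apply right_computable_UC in H; [|lra].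
      apply (halting_real_not_Sg s Hs H).
Qed.

(** * Algebraic numbers *)
Local Open Scope R_scope.

Fixpoint zpoly_weight (k : Z) (cs : list Z) : list Z :=
  match cs with [] => [] | c :: cs' => (k * c)%Z :: zpoly_weight (k + 1) cs' end.
Definition zpoly_deriv (cs : list Z) : list Z :=
  match cs with [] => [] | _ :: cs' => zpoly_weight 1 cs' end.

Lemma zpoly_weight_length k cs : length (zpoly_weight k cs) = length cs.
Proof. revert k. induction cs; intros k; simpl; auto. Qed.

(** The product rule for [x^k] times the polynomial, divided by [x^(k-1)]. *)
Lemma zpoly_weight_eval k cs x : zpoly_eval (zpoly_weight k cs) x =
  IZR k * zpoly_eval cs x + x * zpoly_eval (zpoly_deriv cs) x.
Proof.
  revert k. induction cs as [|c cs IH]; intros k; simpl; [lra|].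
  rewrite (IH (k + 1)%Z), (IH 1%Z), mult_IZR, plus_IZR. ring.
Qed.

Lemma zpoly_weight_nonzero k cs : (0 < k)%Z ->
  Exists (fun c => c <> 0%Z) cs -> Exists (fun c => c <> 0%Z) (zpoly_weight k cs).
Proof.
  intros Hk H. revert k Hk. induction H; intros k Hk; simpl.
  - apply Exists_cons_hd. nia.
  - apply Exists_cons_tl. apply IHExists. lia.
Qed.

Lemma zpoly_is_derive cs x : is_derive (zpoly_eval cs) x (zpoly_eval (zpoly_deriv cs) x).
Proof.
  induction cs as [|c cs IH]; simpl.
  - apply @is_derive_const.
  - rewrite zpoly_weight_eval.
    apply (is_derive_ext (fun y => plus (IZR c) (mult y (zpoly_eval cs y)))); [reflexivity|].
    replace (1 * zpoly_eval cs x + x * zpoly_eval (zpoly_deriv cs) x) with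
      (plus zero (plus (mult 1 (zpoly_eval cs x)) (mult x (zpoly_eval (zpoly_deriv cs) x))))
      by (unfold plus, mult, zero; simpl; ring).
    apply @is_derive_plus; [apply @is_derive_const|].
    apply @is_derive_mult; [apply @is_derive_id|exact IH|intros; apply Rmult_comm].
Qed.

(** While the derivative vanishes at [alpha] too, pass to it: the length drops, and a nonzero
    constant has no root. *)
Lemma algebraic_simple_root alpha : algebraic_real alpha ->
  exists cs, zpoly_eval cs alpha = 0 /\ zpoly_eval (zpoly_deriv cs) alpha <> 0.
Proof.
  intros [cs [Hnz Hroot]]. remember (length cs) as n eqn:Hn.
  revert cs Hn Hnz Hroot. induction (lt_wf n) as [n _ IH]. intros cs -> Hnz Hroot.
  destruct (classic (zpoly_eval (zpoly_deriv cs) alpha = 0)) as [H|H]; [|eauto].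
  destruct cs as [|c cs]; [inversion Hnz|].
  destruct (classic (Exists (fun c => c <> 0%Z) cs)) as [Hcs|Hcs].
  - apply (IH (length (zpoly_deriv (c :: cs)))) with (zpoly_deriv (c :: cs)); auto.
    + simpl. rewrite zpoly_weight_length. lia.
    + apply zpoly_weight_nonzero; auto. lia.
  - exfalso.
    assert (Hz : forall x, zpoly_eval cs x = 0).
    { intros x. clear -Hcs. induction cs as [|d cs IH]; simpl; auto.
      destruct (Z.eq_dec d 0) as [->|Hd]; [|destruct Hcs; apply Exists_cons_hd; auto].
      rewrite IH; [lra|]. intros H. apply Hcs. apply Exists_cons_tl; auto. }
    simpl in Hroot. rewrite Hz in Hroot.
    inversion Hnz as [? ? Hc|? ? Hc]; subst; [|auto].
    apply Hc. apply eq_IZR. lra.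
Qed.

(* [q ^ length cs] times the value at [p / q], with the coefficients of either sign kept apart. *)
Fixpoint zpoly_pos (cs : list Z) (p q : nat) : nat :=
  match cs with
  | [] => 0
  | c :: cs' => Z.to_nat c * q ^ length cs + p * zpoly_pos cs' p q
  end.

Lemma Comp_zpoly_pos cs : Comp 2 (fun v => zpoly_pos cs (nth 0 v 0%nat) (nth 1 v 0%nat)).
Proof.
  induction cs as [|c cs IH]; cbn [zpoly_pos]; [apply Comp_const|].
  apply Comp_add; apply Comp_mul; try comp; apply Comp_pow; comp.
Qed.

Lemma zpoly_pos_spec cs p q : (0 < q)%nat ->
  zpoly_eval cs (INR p / INR q) * INR q ^ length cs =
  INR (zpoly_pos cs p q) - INR (zpoly_pos (map Z.opp cs) p q).
Proof.
  intros Hq. apply lt_0_INR in Hq. induction cs as [|c cs IH].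
  - simpl. lra.
  - cbn [zpoly_eval zpoly_pos map].
    rewrite !plus_INR, !mult_INR, !pow_INR. cbn [length]. rewrite length_map.
    replace (IZR c) with (INR (Z.to_nat c) - INR (Z.to_nat (- c))).
    + cbn [length pow].
      replace ((INR (Z.to_nat c) - INR (Z.to_nat (- c)) + INR p / INR q * zpoly_eval cs (INR p / INR q)) *
        (INR q * INR q ^ length cs)) with
        ((INR (Z.to_nat c) - INR (Z.to_nat (- c))) * (INR q * INR q ^ length cs) +
         INR p * (zpoly_eval cs (INR p / INR q) * INR q ^ length cs)) by (field; lra).
      rewrite IH. ring.
    + rewrite !INR_IZR_INZ, <- minus_IZR. f_equal. lia.
Qed.

(** Near [alpha] the difference quotient differs from [L] by less than [L], so it is positive. *)
Lemma sign_change f alpha L : is_derive f alpha L -> f alpha = 0 -> 0 < L ->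
  exists d, 0 < d /\ forall x, Rabs (x - alpha) < d -> (alpha < x <-> 0 < f x).
Proof.
  intros Hd H0 HL. apply is_derive_Reals in Hd.
  destruct (Hd L HL) as [d Hdel]. exists d. split; [apply cond_pos|]. intros x Hx.
  destruct (Req_dec x alpha) as [->|Hne]; [rewrite H0; lra|].
  specialize (Hdel (x - alpha) ltac:(lra) Hx).
  replace (alpha + (x - alpha)) with x in Hdel by lra. rewrite H0, Rminus_0_r in Hdel.
  apply Rabs_def2 in Hdel as [_ Hdel].
  assert (Hq : 0 < f x / (x - alpha)) by lra.
  replace (f x) with (f x / (x - alpha) * (x - alpha)) by (field; lra). split; intros H.
  - apply Rmult_lt_0_compat; lra.
  - apply Rnot_le_lt. intros Hle. nra.
Qed.

(** The sign of the polynomial is conclusive only close to [alpha], since it may have other roots.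
    Two fixed fractions [pa/qa < alpha < pb/qb] within the neighbourhood decide everything outside
    them. *)
Lemma algebraic_right_computable alpha : 0 <= alpha -> algebraic_real alpha -> right_computable alpha.
Proof.
  intros Ha Halg. apply right_computable_UC; auto.
  destruct (algebraic_simple_root alpha Halg) as [cs0 [Hr Hd]].
  assert (exists cs, zpoly_eval cs alpha = 0 /\ 0 < zpoly_eval (zpoly_deriv cs) alpha) as [cs [Hroot Hder]].
  { destruct (Rlt_le_dec 0 (zpoly_eval (zpoly_deriv cs0) alpha)) as [H|H]; [eauto|].
    assert (Hopp : forall cs x, zpoly_eval (map Z.opp cs) x = - zpoly_eval cs x).
    { clear. induction cs as [|c cs IH]; intros x; simpl; [lra|]. rewrite IH, opp_IZR. lra. }
    assert (Hopp' : forall k cs, zpoly_weight k (map Z.opp cs) = map Z.opp (zpoly_weight k cs)).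
    { clear. intros k cs; revert k. induction cs as [|c cs IH]; intros k; simpl; auto.
      rewrite IH. f_equal. lia. }
    exists (map Z.opp cs0). rewrite Hopp. split; [lra|].
    replace (zpoly_deriv (map Z.opp cs0)) with (map Z.opp (zpoly_deriv cs0))
      by (destruct cs0; simpl; auto).
    rewrite Hopp. lra. }
  destruct (sign_change _ _ _ (zpoly_is_derive cs alpha) Hroot Hder) as [d [Hd0 Hsign]].
  destruct (rational_between alpha (alpha + d)) as [pb [qb [Hqb Hb]]]; [auto|lra|].
  (* At 0 there is no non-negative fraction below to serve as left bracket. *)
  destruct (Req_dec alpha 0) as [->|Hne].
  { apply Sg_ext with (fun v => (0 < nth 1 v 0 /\ 0 < nth 0 v 0)%nat); [|sg].
    intros v _. generalize (nth 0 v 0%nat) as p, (nth 1 v 0%nat) as q. intros p q. unfold UC.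
    replace 0 with (INR 0 / INR 1) by (simpl; field).
    split; intros [Hq H]; (split; auto); [apply quot_lt; lia|apply quot_lt in H; lia]. }
  destruct (rational_between (Rmax 0 (alpha - d)) alpha) as [pa [qa [Hqa HA]]];
    [apply Rmax_l|apply Rmax_lub_lt; lra|].
  pose proof (Rmax_r 0 (alpha - d)).
  apply Sg_ext with (fun v => (0 < nth 1 v 0)%nat /\
    ((pb * nth 1 v 0 < nth 0 v 0 * qb)%nat \/
     ((pa * nth 1 v 0 < nth 0 v 0 * qa)%nat /\ (nth 0 v 0 * qb <= pb * nth 1 v 0)%nat /\
      (zpoly_pos (map Z.opp cs) (nth 0 v 0%nat) (nth 1 v 0%nat) < zpoly_pos cs (nth 0 v 0%nat) (nth 1 v 0%nat))%nat))).
  - intros v _. generalize (nth 0 v 0%nat) as p, (nth 1 v 0%nat) as q. intros p q. unfold UC.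
    assert (Hpos : (0 < q)%nat -> (0 < zpoly_eval cs (INR p / INR q) <->
              (zpoly_pos (map Z.opp cs) p q < zpoly_pos cs p q)%nat)).
    { intros Hq. pose proof (zpoly_pos_spec cs p q Hq) as E. apply lt_0_INR in Hq.
      apply (pow_lt _ (length cs)) in Hq. split; intros H1.
      - apply INR_lt. nra.
      - apply lt_INR in H1. nra. }
    split.
    + intros [Hq H1]. split; auto. destruct H1 as [H1|[H1 [H2 H3]]].
      * apply quot_lt in H1; auto. lra.
      * apply quot_lt in H1; auto. apply Hpos in H3; auto. apply Hsign; auto.
        apply Rabs_def1; [|lra].
        destruct (Rlt_le_dec (INR pb / INR qb) (INR p / INR q)) as [H4|H4]; [|lra].
        apply quot_lt in H4; auto. lia.
    + intros [Hq H1]. split; auto.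
      destruct (Nat.lt_ge_cases (pb * q) (p * qb)) as [H2|H2]; auto. right.
      assert (H3 : (pa * q < p * qa)%nat) by (apply quot_lt; auto; lra).
      split; [auto|split; auto]. apply Hpos; auto. apply Hsign; auto.
      apply Rabs_def1; [|lra].
      destruct (Rlt_le_dec (INR pb / INR qb) (INR p / INR q)) as [H4|H4]; [|lra].
      apply quot_lt in H4; auto. lia.
  - pose proof (Comp_zpoly_pos cs) as HC1. pose proof (Comp_zpoly_pos (map Z.opp cs)) as HC2.
    apply Sg_and; [sg|]. apply Sg_or; [sg|]. apply Sg_and; [sg|]. apply Sg_and; [sg|].
    apply Sg_lt; auto.
Qed.

Theorem theorem1p1 :
  (forall alpha : R, SCLrp alpha <-> (0 <= alpha /\ right_computable alpha)) /\
  (forall alpha : R, 0 <= alpha -> computable_real alpha -> SCLrp alpha) /\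
  (forall alpha : R, 0 <= alpha -> algebraic_real alpha -> SCLrp alpha) /\
  (forall alpha beta : R, SCLrp alpha -> SCLrp beta -> SCLrp (alpha + beta)) /\
  (exists alpha beta : R,
      SCLrp alpha /\ SCLrp beta /\ alpha - beta > 0 /\ ~ SCLrp (alpha - beta)).
Proof.
  split; [exact SCLrp_iff|]. split; [|split; [|split]].
  - intros alpha Ha H. apply right_computable_SCLrp; auto. apply Decidable_RE; auto.
  - intros alpha Ha H. apply right_computable_SCLrp; auto. apply algebraic_right_computable; auto.
  - exact SCLrp_plus.
  - exact SCLrp_not_closed_under_subtraction.
Qed.
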